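(* Let $m\ge 2$ and let $\Omega\subset\mathbb{R}^m$ be a non-empty horn-shaped set with $|\Omega|<\infty$ and $|\Omega'|_{m-1}<\infty$. Let $\lambda\ge\lambda(\Omega)$ be a real number such that $$\mu(\Omega')\ge (m-1)(\lambda-\mu(\Omega')),$$ and let $\varepsilon\in(0,|\Omega|\mu(\Omega')^{m/2}]$. Then $$\frac{1}{|\Omega|}\|u_{\Omega}\|_1^2\le 2\varepsilon+\frac{2|\Omega'|_{m-1}}{|\Omega|}\,|S|_1+\frac{2^{5/2}|\Omega'|_{m-1}}{|\Omega|}(\lambda-\mu(\Omega'))^{-1/2}\Big(\log\big(\varepsilon^{-1}|\Omega|\mu(\Omega')^{m/2}\big)\Big)^{1/2},$$ where $$S=\Big\{x_1\in\mathbb{R}:\ \Omega(x_1/2)\neq\emptyset,\ \frac{\mu(\Omega(x_1/2))-\mu(\Omega')}{2(\lambda-\mu(\Omega'))}\le\log\big(\varepsilon^{-1}|\Omega|\,\mu(\Omega(x_1/2))^{m/2}\big)\Big\}.$$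
   Context: Points of $\mathbb{R}^m$ are written $(x_1,x')$ with $x_1\in\mathbb{R}$, $x'\in\mathbb{R}^{m-1}$. For an open set $\Omega\subset\mathbb{R}^m$ put $\Omega(x_1)=\{x'\in\mathbb{R}^{m-1}:(x_1,x')\in\Omega\}$ and $\Omega'=\bigcup_{x_1\in\mathbb{R}}\Omega(x_1)\subset\mathbb{R}^{m-1}$. For a non-empty open set $D\subset\mathbb{R}^{m-1}$ of finite $(m-1)$-dimensional measure, $\mu(D)$ denotes the first eigenvalue of the Dirichlet Laplacian $-\Delta$ on $L^2(D)$ in dimension $m-1$. A set $\Omega\subset\mathbb{R}^m$ is horn-shaped if it is open and connected, $x_1>x_2>0$ implies $\Omega(x_1)\subset\Omega(x_2)$, and $x_1<x_2<0$ implies $\Omega(x_1)\subset\Omega(x_2)$ (here $x_1,x_2$ are real numbers). $|\cdot|$ is Lebesgue measure in $\mathbb{R}^m$ and $|\cdot|_k$ is $k$-dimensional Lebesgue measure in $\mathbb{R}^k$, $k<m$. $\lambda(\Omega)$ is the first eigenvalue of the Dirichlet Laplacian $-\Delta$ on $L^2(\Omega)$, and $u_\Omega\in H^1_0(\Omega)$ is the corresponding eigenfunction, chosen positive with $\|u_\Omega\|_2=1$; $\|\cdot\|_1$ is the $L^1(\Omega)$ norm. *)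

(* Defs.v *)
From HB Require Import structures.
From mathcomp Require Import all_boot all_order all_algebra.
From mathcomp Require Import all_classical all_reals all_analysis.

Set Implicit Arguments.
Unset Strict Implicit.
Unset Printing Implicit Defensive.

Import Order.TTheory GRing.Theory Num.Theory.
Import numFieldNormedType.Exports.

Local Open Scope classical_set_scope.
Local Open Scope ring_scope.

(* 'rV[R]_n carries the sigma-algebra generated by the coordinate maps, which
   is the Borel sigma-algebra of its topology (every open set is a countable
   union of boxes). *)
Section rV_measurable.
Context {R : realType}.
Variable n : nat.

Definition rV_coord (i : 'I_n) (x : 'rV[R]_n) : measurableTypeR R := x ord0 i.

Let rV_set0 : g_sigma_preimage rV_coord set0.
Proof. exact: sigma_algebra0. Qed.

Let rV_setC A : g_sigma_preimage rV_coord A -> g_sigma_preimage rV_coord (~` A).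
Proof. exact: sigma_algebraC. Qed.

Let rV_bigcup (F : _^nat) : (forall i, g_sigma_preimage rV_coord (F i)) ->
  g_sigma_preimage rV_coord (\bigcup_i (F i)).
Proof. exact: sigma_algebra_bigcup. Qed.

HB.instance Definition _ := @isMeasurable.Build default_measure_display
  'rV[R]_n (g_sigma_preimage rV_coord) rV_set0 rV_setC rV_bigcup.

End rV_measurable.

Section lebesgue_rV.
Context {R : realType}.

Definition rV_cons (n : nat) (x1 : R) (x' : 'rV[R]_n) : 'rV[R]_n.+1 :=
  row_mx (x1%:M : 'rV[R]_1) x'.

Lemma measurable_rV_coord (n : nat) (i : 'I_n) :
  measurable_fun [set: 'rV[R]_n] (rV_coord i).
Proof.
move=> _ Y mY; rewrite setTI; apply: sub_sigma_algebra => /=.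
rewrite -bigcup_seq/=; exists i => /=; first by rewrite mem_index_enum.
by exists Y => //; rewrite setTI.
Qed.

Lemma measurable_funrV d (T : measurableType d) (n : nat) (f : T -> 'rV[R]_n) :
  (forall i, measurable_fun [set: T] (rV_coord i \o f)) ->
  measurable_fun [set: T] f.
Proof.
move=> mf.
have h : g_sigma_preimage (fun i => rV_coord i \o f) `<=` measurable.
  apply: smallest_sub; first exact: sigma_algebra_measurable.
  case: n => [|n] in f mf *; first by rewrite big_ord0.
  rewrite -bigcup_mkord_ord; apply: bigcup_sub => i Ii.
  by move=> A [B mB <-]; exact: mf.
by move=> _ A mA; apply: h; rewrite g_sigma_preimage_comp; exists A.
Qed.

Definition rV_consp (n : nat) (p : measurableTypeR R * 'rV[R]_n) :
  'rV[R]_n.+1 := rV_cons p.1 p.2.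

Let coord0_rV_cons (n : nat) (x1 : R) (x' : 'rV[R]_n) :
  rV_cons x1 x' ord0 ord0 = x1.
Proof.
have -> : (ord0 : 'I_n.+1) = lshift n (ord0 : 'I_1) by exact: val_inj.
by rewrite /rV_cons (@row_mxEl _ 1 1 n) mxE.
Qed.

Let coordS_rV_cons (n : nat) (x1 : R) (x' : 'rV[R]_n) (j : 'I_n) :
  rV_cons x1 x' ord0 (lift ord0 j) = x' ord0 j.
Proof.
have -> : lift ord0 j = @rshift 1 n j by exact: val_inj.
by rewrite /rV_cons (@row_mxEr _ 1 1 n).
Qed.

Let measurable_rV_consp (n : nat) :
  measurable_fun [set: measurableTypeR R * 'rV[R]_n] (@rV_consp n).
Proof.
apply: measurable_funrV => i.
case: (unliftP ord0 i) => [j|] ->.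
  rewrite (_ : _ \o _ = rV_coord j \o snd).
    by apply: measurableT_comp => //; exact: measurable_rV_coord.
  by apply/funext => -[x y] /=; exact: coordS_rV_cons.
rewrite (_ : _ \o _ = fst)//.
by apply/funext => -[x y] /=; exact: coord0_rV_cons.
Qed.

HB.instance Definition _ (n : nat) :=
  isMeasurableFun.Build _ _ _ _ (@rV_consp n) (@measurable_rV_consp n).

Let rV_uncons (n : nat) (x : 'rV[R]_n.+1) : measurableTypeR R * 'rV[R]_n :=
  (rV_coord ord0 x, \row_j rV_coord (lift ord0 j) x).

Let measurable_rV_uncons (n : nat) :
  measurable_fun [set: 'rV[R]_n.+1] (@rV_uncons n).
Proof.
apply: measurable_fun_pair; first exact: measurable_rV_coord.
apply: measurable_funrV => j.
rewrite (_ : _ \o _ = rV_coord (lift ord0 j)).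
  exact: measurable_rV_coord.
by apply/funext => x /=; rewrite /rV_coord mxE.
Qed.

Let rV_conspK (n : nat) : cancel (@rV_consp n) (@rV_uncons n).
Proof.
move=> -[x1 x']; rewrite /rV_uncons /rV_consp /rV_coord /= coord0_rV_cons.
by congr pair; apply/rowP => j; rewrite mxE coordS_rV_cons.
Qed.

Section lebesgue_rV_succ.
Variables (n : nat) (mu : {sigma_finite_measure set 'rV[R]_n -> \bar R}).

Definition lebesgue_rV_succ : set 'rV[R]_n.+1 -> \bar R :=
  pushforward (@lebesgue_measure R \x mu)%E (@rV_consp n).

Let lebesgue_rV_succ0 : lebesgue_rV_succ set0 = 0%E.
Proof. exact: measure0. Qed.

Let lebesgue_rV_succ_ge0 A : (0 <= lebesgue_rV_succ A)%E.
Proof. exact: measure_ge0. Qed.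

Let lebesgue_rV_succ_sigma_additive : semi_sigma_additive lebesgue_rV_succ.
Proof. exact: measure_semi_sigma_additive. Qed.

HB.instance Definition _ := isMeasure.Build _ _ _ lebesgue_rV_succ
  lebesgue_rV_succ0 lebesgue_rV_succ_ge0 lebesgue_rV_succ_sigma_additive.

Let lebesgue_rV_succ_sigma_finite : sigma_finite setT lebesgue_rV_succ.
Proof.
have /sigma_finiteP[F [TF ndF Foo]] := sigma_finiteT (@lebesgue_measure R).
have /sigma_finiteP[G [TG ndG Goo]] := sigma_finiteT mu.
exists (fun k => @rV_uncons n @^-1` (F k `*` G k)).
  apply/esym; rewrite -subTset => x _.
  have : [set: measurableTypeR R] (rV_uncons x).1 by [].
  have : [set: 'rV[R]_n] (rV_uncons x).2 by [].
  rewrite TF TG => -[k _ Gk] [j _ Fj]; exists (maxn j k) => //; split.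
    by move: Fj; exact/subsetPset/ndF/leq_maxl.
  by move: Gk; exact/subsetPset/ndG/leq_maxr.
move=> k; have [mF Fk] := Foo k; have [mG Gk] := Goo k; split.
  rewrite -[X in measurable X]setTI.
  by apply: measurable_rV_uncons => //; exact: measurableX.
rewrite /lebesgue_rV_succ /pushforward -comp_preimage.
rewrite (_ : _ \o _ = id) ?preimage_id; last first.
  by apply/funext => p; exact: rV_conspK.
by rewrite product_measure1E// lte_mul_pinfty// ge0_fin_numE.
Qed.

HB.instance Definition _ := Measure_isSigmaFinite.Build _ _ _ lebesgue_rV_succ
  lebesgue_rV_succ_sigma_finite.

End lebesgue_rV_succ.

(* Lebesgue measure on R^n, as the n-fold product of the one on R; R^0 is a
   point of mass 1. *)
Fixpoint lebesgue_rV (n : nat) : {sigma_finite_measure set 'rV[R]_n -> \bar R} :=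
  match n with
  | 0 => [the {sigma_finite_measure set 'rV[R]_0 -> \bar R} of \d_(0 : 'rV[R]_0)]
  | k.+1 => [the {sigma_finite_measure set 'rV[R]_k.+1 -> \bar R} of
              lebesgue_rV_succ (lebesgue_rV k)]
  end.

End lebesgue_rV.

(* Used only for sets of finite measure. *)
Definition vol (R : realType) (n : nat) (A : set 'rV[R]_n) : R :=
  fine (lebesgue_rV n A).

Section dirichlet_laplacian.
Context {R : realType} {n : nat}.
Implicit Types (D : set 'rV[R]_n) (u f phi : 'rV[R]_n -> R)
  (g : 'I_n -> 'rV[R]_n -> R).

Local Notation leb := (lebesgue_rV n).

Definition partial (i : 'I_n) f : 'rV[R]_n -> R :=
  fun x => 'D_(delta_mx ord0 i : 'rV[R]_n) f x.

Definition smooth f : Prop :=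
  forall (s : seq 'I_n) (x : 'rV[R]_n), differentiable (foldr partial f s) x.

Definition supp f : set 'rV[R]_n := closure [set x | f x != 0].

Definition test_fun D phi : Prop :=
  [/\ smooth phi, compact (supp phi) & supp phi `<=` D].

Definition L2 D f : Prop :=
  measurable_fun D f /\ (\int[leb]_(x in D) ((f x) ^+ 2)%:E < +oo)%E.

(* g is the distributional gradient of u on D *)
Definition weak_grad D u g : Prop :=
  forall i phi, test_fun D phi ->
    \int[leb]_(x in D) (u x * partial i phi x) =
    - \int[leb]_(x in D) (g i x * phi x).

(* u is in H^1_0(D), the closure of C_c^oo(D) in H^1(D), and g is its gradient *)
Definition H10 D u g : Prop :=
  [/\ L2 D u, forall i, L2 D (g i), weak_grad D u g &
      forall e : R, 0 < e -> exists2 phi, test_fun D phi &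
        (\int[leb]_(x in D)
           ((u x - phi x) ^+ 2 + \sum_i (g i x - partial i phi x) ^+ 2)%:E
         < e%:E)%E].

(* The graph of the Dirichlet Laplacian on L^2(D): u lies in its domain
   {u in H^1_0(D) | Delta u in L^2(D)} and - Delta u = f. *)
Definition dirichlet_laplacian D u f : Prop :=
  L2 D f /\ exists2 g, H10 D u g &
    forall phi, test_fun D phi ->
      \int[leb]_(x in D) (\sum_i g i x * partial i phi x) =
      \int[leb]_(x in D) (f x * phi x).

Definition eigenfunction D (l : R) u : Prop :=
  dirichlet_laplacian D u (fun x => l * u x) /\
  ~ {ae leb, forall x, D x -> u x = 0}.

Definition eigenvalues D : set R := [set l | exists u, eigenfunction D l u].

(* The smallest eigenvalue: for a non-empty open D of finite measure the
   infimum is attained. *)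
Definition first_eigenvalue D : R := inf (eigenvalues D).

(* Elements of L^2(D) are represented by Borel functions, which matter only up
   to null sets inside D; so positivity is required almost everywhere. *)
Definition first_eigenfunction D u : Prop :=
  [/\ eigenfunction D (first_eigenvalue D) u,
      {ae leb, forall x, D x -> 0 < u x} &
      (\int[leb]_(x in D) ((u x) ^+ 2)%:E = 1)%E].

End dirichlet_laplacian.

Section horn_shaped.
Context {R : realType} {n : nat}.
Implicit Types Omega : set 'rV[R]_n.+1.

(* A point (x1, x') of R^(n+1) is rV_cons x1 x'; in the usual notation slice
   Omega x1 is Omega(x1) and shadow Omega, their union, is Omega'. *)
Definition slice Omega (x1 : R) : set 'rV[R]_n :=
  [set x' | Omega (rV_cons x1 x')].

Definition shadow Omega : set 'rV[R]_n :=
  \bigcup_(x1 in [set: R]) slice Omega x1.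

Definition horn_shaped Omega : Prop :=
  [/\ open Omega, connected Omega,
      forall x1 x2 : R, 0 < x2 -> x2 < x1 ->
        slice Omega x1 `<=` slice Omega x2 &
      forall x1 x2 : R, x1 < x2 -> x2 < 0 ->
        slice Omega x1 `<=` slice Omega x2].

End horn_shaped.

(* Main.v *)
(* Put D = lambda - mu(Omega') and L = log(eps^-1 |Omega| mu(Omega')^(m/2)).  The
   case eps >= 1/2 is Cauchy-Schwarz.  Otherwise let A be the set of the points
   of Omega whose first coordinate lies in S or in [-T, T], T = (2 L / D)^(1/2).
   Then ||u||_1^2 <= 2 |A| + 2 |Omega| int_(Omega \ A) u^2 and
   |A| <= |Omega'| (|S| + 2 T), so it suffices that the tail integral is at most
   eps.  Let 2 a be the smallest |x1| > T outside S, on one side of 0.  Beyond a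
   the slices of Omega are contained in slices whose first eigenvalue is at least
   mu(Omega') + 2 D L >= lambda + kappa^2, where kappa^2 = D (2 L - 1).  Testing
   the eigenvalue equation with eta u, for a logistic function eta of x1, gives
   an Agmon estimate: the integral of u^2 over |x1| >= 2 a is of order
   exp (- 2 kappa a) <= exp (- kappa T).  That this is at most eps / 2 uses
   |Omega| mu(Omega')^(m/2) >= 3, which follows from a Faber-Krahn inequality
   obtained by comparing test functions with their translates.  The strict
   inequality lambda(Omega) > mu(Omega') holds because equality would force
   the derivative of u in x1 to vanish.

   Slices and Omega' enter through the Rayleigh quotient, whose infimum is shown
   to be an eigenvalue: a minimizing sequence is made Cauchy in L^2 with an
   ultrafilter, because small means over the cells of a grid force a small norm,
   and the parallelogram law makes it Cauchy in H^1. *)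

Require Import Defs.
From HB Require Import structures.
From mathcomp Require Import all_boot all_order all_algebra.
From mathcomp Require Import all_classical all_reals all_analysis.
From mathcomp Require Import measurable_realfun zify ring lra.

Set Implicit Arguments.
Unset Strict Implicit.
Unset Printing Implicit Defensive.

Import Order.TTheory GRing.Theory Num.Theory.
Import numFieldNormedType.Exports.

Local Open Scope classical_set_scope.
Local Open Scope ring_scope.

(** * Borel sets, Tonelli and translation invariance on R^n *)

Section rV_measure.
Context {R : realType}.

(** All estimates are proved for test functions, where slices, translates and products with a weight
    make sense at every point. The eigenfunction enters only through [eigen_approx], so neither
    slicing nor a product rule is needed in H^1_0. The logistic weight eta, with |eta'| = 2 kappa
    eta (1 - eta), is exponential weight and cutoff in one: it is bounded, so eta phi stays bounded
    in H^1, and completing the square costs eta'^2 / (4 eta) = kappa^2 eta (1 - eta)^2, which the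
    gap kappa^2 eta on the far slices outweighs. T is chosen so that 2 |Omega'| 2 T / |Omega| is
    exactly the third term of the bound. Then kappa T = sqrt (2 L (2 L - 1)) is nearly 2 L, and exp
    (- kappa T) is of order (eps / q)^2 with q = |Omega| mu(Omega')^(m/2): one factor eps / q more
    than needed, which pays for the numerical constants once q >= 3. The hypothesis relating
    mu(Omega') and lambda serves this bound on q: it gives lambda(Omega) <= 2 mu(Omega'), so that a
    Faber-Krahn inequality for lambda(Omega) bounds mu(Omega') from below. *)

Lemma rV_cons0 (n : nat) (x1 : R) (x' : 'rV[R]_n) :
  rV_cons x1 x' ord0 ord0 = x1.
Proof.
have -> : (ord0 : 'I_n.+1) = lshift n (ord0 : 'I_1) by exact: val_inj.
by rewrite /rV_cons (@row_mxEl _ 1 1 n) mxE.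
Qed.

Lemma rV_consS (n : nat) (x1 : R) (x' : 'rV[R]_n) (j : 'I_n) :
  rV_cons x1 x' ord0 (lift ord0 j) = x' ord0 j.
Proof.
have -> : lift ord0 j = @rshift 1 n j by exact: val_inj.
by rewrite /rV_cons (@row_mxEr _ 1 1 n).
Qed.

Definition rV_behead (n : nat) (x : 'rV[R]_n.+1) : 'rV[R]_n :=
  \row_j x ord0 (lift ord0 j).

Lemma rV_consK (n : nat) (x : 'rV[R]_n.+1) :
  rV_cons (x ord0 ord0) (rV_behead x) = x.
Proof.
apply/rowP => i; case: (unliftP ord0 i) => [j|] ->; last by rewrite rV_cons0.
by rewrite rV_consS mxE.
Qed.

Lemma rV_behead_cons (n : nat) (x1 : R) (x' : 'rV[R]_n) :
  rV_behead (rV_cons x1 x') = x'.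
Proof. by apply/rowP => j; rewrite mxE rV_consS. Qed.

Lemma rV_consD (n : nat) (a b : R) (x y : 'rV[R]_n) :
  rV_cons a x + rV_cons b y = rV_cons (a + b) (x + y).
Proof.
apply/rowP => i; rewrite mxE; case: (unliftP ord0 i) => [j|] ->.
  by rewrite !rV_consS mxE.
by rewrite !rV_cons0.
Qed.

(** Second countability by hand: U is the union of the boxes [B p] that it contains, with rational
    center and radius 1 / (k + 1), and the index type is countable. *)
Lemma measurable_rV_open (n : nat) (U : set 'rV[R]_n) :
  open U -> measurable U.
Proof.
move=> oU.
pose B (p : 'rV[rat]_n * nat) : set 'rV[R]_n :=
  [set x | forall i, `|x ord0 i - ratr (p.1 ord0 i)| < p.2.+1%:R^-1].
have mB p : measurable (B p).
  rewrite (_ : B p = \bigcap_(i in [set: 'I_n])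
      (rV_coord i @^-1` [set r | `|r - ratr (p.1 ord0 i)| < p.2.+1%:R^-1])).
    apply: fin_bigcap_measurable => // i _.
    rewrite -[X in measurable X]setTI; apply: measurable_rV_coord => //.
    rewrite (_ : mkset _ = ball (ratr (p.1 ord0 i) : R) (p.2.+1%:R^-1)).
      exact: measurable_ball.
    by apply/seteqP; split=> r /=; rewrite /ball/= distrC.
  by apply/seteqP; split=> x /= Bx i; [move=> _|]; exact: Bx.
rewrite (_ : U = \bigcup_(p in [set p | B p `<=` U]) B p); last first.
  apply/seteqP; split=> [x Ux|x [p/=]]; last by move=> BU Bx; exact: BU.
  have /nbhs_ballP[e /= e0 eU] : nbhs x U by exact: open_nbhs_nbhs.
  have e20 : 0 < e / 2 by rewrite divr_gt0.
  pose k := Num.truncn (e / 2)^-1.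
  have ke : k.+1%:R^-1 < e / 2.
    by rewrite invf_plt ?posrE// /k Num.Theory.truncnS_gt.
  have k0 : 0 < k.+1%:R^-1 :> R by rewrite invr_gt0.
  have qP i : exists q : rat, `|x ord0 i - ratr q| < k.+1%:R^-1.
    have /rat_in_itvoo[q] : x ord0 i - k.+1%:R^-1 < x ord0 i + k.+1%:R^-1.
      by rewrite ltrD2l gtrN.
    rewrite in_itv/= => /andP[q1 q2]; exists q.
    by rewrite ltr_distlC q1.
  have [q qP'] := choice qP.
  exists (\row_i q i, k) => [y By|i]; last by rewrite /= mxE; exact: qP'.
  apply: eU; split=> // i j; rewrite ord1 /ball/=.
  have := By j; rewrite /= mxE => By'.
  rewrite (le_lt_trans (ler_distD (ratr (q j)) _ _))//.
  rewrite [ltRHS](splitr e) ltrD//; first by rewrite (lt_trans (qP' j)).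
  by rewrite distrC (lt_trans By').
rewrite bigcup_mkcond; apply: countable_bigcupT_measurable => //.
by move=> p; case: ifP.
Qed.

Lemma measurable_rV_continuous (n : nat) (f : 'rV[R]_n -> R) :
  continuous f -> measurable_fun setT f.
Proof.
move=> cf; apply: (measurability _ (RGenOpens.measurableE R)).
move=> _ [_ [a [b ->] <-]]; rewrite setTI; apply: measurable_rV_open.
by apply: open_comp => // x _; exact: cf.
Qed.

Lemma measurable_rV_cons d (T : measurableType d) (n : nat)
    (f : T -> R) (g : T -> 'rV[R]_n) :
  measurable_fun setT f -> measurable_fun setT g ->
  measurable_fun setT (fun t => rV_cons (f t) (g t)).
Proof.
move=> mf mg; apply: measurable_funrV => i.
case: (unliftP ord0 i) => [j|] ->.
  rewrite (_ : _ \o _ = rV_coord j \o g).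
    by apply: measurableT_comp => //; exact: measurable_rV_coord.
  by apply/funext => x /=; rewrite /rV_coord rV_consS.
rewrite (_ : _ \o _ = f)//.
by apply/funext => x /=; rewrite /rV_coord rV_cons0.
Qed.

Lemma measurable_rVD d (T : measurableType d) (n : nat) (f g : T -> 'rV[R]_n) :
  measurable_fun setT f -> measurable_fun setT g ->
  measurable_fun setT (fun t => f t + g t).
Proof.
move=> mf mg; apply: measurable_funrV => i.
rewrite (_ : _ \o _ = (rV_coord i \o f) \+ (rV_coord i \o g)).
  by apply: measurable_funD; apply: measurableT_comp => //;
    exact: measurable_rV_coord.
by apply/funext => x /=; rewrite /rV_coord mxE.
Qed.

Lemma measurable_rVZ d (T : measurableType d) (n : nat) (f : T -> R)
    (g : T -> 'rV[R]_n) :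
  measurable_fun setT f -> measurable_fun setT g ->
  measurable_fun setT (fun t => f t *: g t).
Proof.
move=> mf mg; apply: measurable_funrV => i.
rewrite (_ : _ \o _ = f \* (rV_coord i \o g)).
  by apply: measurable_funM => //; apply: measurableT_comp => //;
    exact: measurable_rV_coord.
by apply/funext => x /=; rewrite /rV_coord mxE.
Qed.

Lemma measurable_slice_fun d (T : measurableType d) (n : nat)
    (F : 'rV[R]_n.+1 -> T) :
  measurable_fun setT F ->
  measurable_fun setT (fun p : measurableTypeR R * 'rV[R]_n => F (rV_cons p.1 p.2)).
Proof.
move=> mF; apply: measurableT_comp => //; apply: measurable_rV_cons.
  exact: measurable_fst.
exact: measurable_snd.
Qed.

Lemma ge0_integral_rV_cons (n : nat) (F : 'rV[R]_n.+1 -> \bar R) :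
  measurable_fun setT F -> (forall x, 0 <= F x)%E ->
  (\int[lebesgue_rV n.+1]_x F x =
   \int[@lebesgue_measure R]_t \int[lebesgue_rV n]_y F (rV_cons t y))%E.
Proof.
move=> mF F0.
rewrite /= /lebesgue_rV_succ ge0_integral_pushforward//.
by rewrite preimage_setT fubini_tonelli1//=; exact: measurable_slice_fun.
Qed.

Lemma measurable_integral_rV_cons (n : nat) (F : 'rV[R]_n.+1 -> \bar R) :
  measurable_fun setT F -> (forall x, 0 <= F x)%E ->
  measurable_fun setT (fun t : measurableTypeR R =>
    \int[lebesgue_rV n]_y F (rV_cons t y))%E.
Proof.
move=> mF F0; apply: (@measurable_fun_fubini_tonelli_F _ _ _ _ _ (lebesgue_rV n)
  (fun p : measurableTypeR R * 'rV[R]_n => F (rV_cons p.1 p.2))) => //.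
exact: measurable_slice_fun.
Qed.


(** By uniqueness of Lebesgue measure it is enough to compare the half-open intervals. *)
Lemma lebesgue_measure_shift (h : R) (A : set R) : measurable A ->
  pushforward (@lebesgue_measure R)
    ((fun x => x + h) : measurableTypeR R -> measurableTypeR R) A
  = lebesgue_measure A.
Proof.
move=> mA.
have msh : measurable_fun setT
    ((fun x => x + h) : measurableTypeR R -> measurableTypeR R).
  by apply: measurable_funD => //; exact: measurable_cst.
pose mfm := isMeasurableFun.Build _ _ _ _ _ msh.
pose sh : {mfun measurableTypeR R >-> measurableTypeR R} :=
  HB.pack (fun x : measurableTypeR R => x + h : measurableTypeR R) mfm.
rewrite -[fun x => x + h]/(sh : _ -> _).
apply/esym/lebesgue_measure_unique => //= _ [[a b]] _ <-.
rewrite /pushforward /= (_ : _ @^-1` _ = `]a - h, b - h]%classic).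
  rewrite !lebesgue_measure_itv/= !lte_fin ltrD2r.
  by case: ifP => // _; rewrite -!EFinB; congr EFin; ring.
apply/seteqP; split => x /=; rewrite !in_itv/= => /andP[? ?]; apply/andP; split; lra.
Qed.

Lemma ge0_integral_shift (h : R) (f : R -> \bar R) :
  measurable_fun setT f -> (forall x, 0 <= f x)%E ->
  (\int[@lebesgue_measure R]_x f (x + h)%R = \int[@lebesgue_measure R]_x f x)%E.
Proof.
move=> mf f0.
have msh : measurable_fun setT
    ((fun x => x + h) : measurableTypeR R -> measurableTypeR R).
  by apply: measurable_funD => //; exact: measurable_cst.
transitivity (\int[pushforward (@lebesgue_measure R)
  ((fun x => x + h)%R : measurableTypeR R -> measurableTypeR R)]_x f x)%E.
  by rewrite ge0_integral_pushforward.
by apply: eq_measure_integral => A mA _; exact: lebesgue_measure_shift.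
Qed.

Lemma ge0_integral_rV_shift (n : nat) (h : 'rV[R]_n) (f : 'rV[R]_n -> \bar R) :
  measurable_fun setT f -> (forall x, 0 <= f x)%E ->
  (\int[lebesgue_rV n]_x f (x + h)%R = \int[lebesgue_rV n]_x f x)%E.
Proof.
elim: n => [|n IH] in h f *.
  move=> mf f0; apply: eq_integral => x _; congr f.
  by apply/rowP => -[].
move=> mf f0.
have mfh : measurable_fun [set: 'rV[R]_n.+1] (fun x : 'rV[R]_n.+1 => f (x + h)).
  apply: measurableT_comp => //; apply: measurable_rVD => //.
rewrite (ge0_integral_rV_cons mfh (fun x => f0 _)) (ge0_integral_rV_cons mf f0).
rewrite -[h]rV_consK.
under eq_integral => t _.
  under eq_integral => y _ do rewrite rV_consD.
  rewrite (IH (rV_behead h) (fun y => f (rV_cons (t + h ord0 ord0) y)))//; last first.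
    apply: measurableT_comp => //; apply: measurable_rV_cons => //.
  over.
apply: (ge0_integral_shift _ (f := fun t => \int[lebesgue_rV n]_y f (rV_cons t y))%E).
  exact: measurable_integral_rV_cons.
by move=> t; exact: integral_ge0.
Qed.

End rV_measure.

(** Serves the Cauchy-Schwarz inequality of two semidefinite forms, the L^2 product and
    [dir - rho * ip]. Either may be degenerate, so c = 0 has to be allowed. *)
Lemma quadratic_discr (R : realFieldType) (a b c : R) : 0 <= c ->
  (forall t, 0 <= a + 2 * t * b + t ^+ 2 * c) -> b ^+ 2 <= a * c.
Proof.
move=> c_ge0 key.
have [c0|c0] := eqVneq c 0.
  have [b0|b0] := eqVneq b 0; first by rewrite b0 c0 expr0n mulr0.
  (* For c = 0 this value of t makes the quadratic equal to -1. *)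
  have := key (- (a + 1) / (2 * b)).
  rewrite c0 mulr0 addr0 (_ : 2 * _ * _ = - (a + 1)); last by field.
  lra.
have cp : 0 < c by rewrite lt_def c0.
have := key (- b / c).
rewrite (_ : _ + _ = a - b ^+ 2 / c); last by field.
by rewrite subr_ge0 ler_pdivrMr.
Qed.

(** * Square-integrable functions over a measure space *)

Section square_integrable.
Context d (T : measurableType d) (R : realType).
Variables (mu : {measure set T -> \bar R}) (D : set T) (mD : measurable D).
Implicit Types f g h : T -> R.

(** The same condition as [L2], for any measure space, so that intervals, cells, slices and the
    whole space are treated alike. *)
Definition sqint f : Prop :=
  measurable_fun D f /\ (\int[mu]_(x in D) ((f x) ^+ 2)%:E < +oo)%E.

(** A real number even when the integral is not finite, in which case it is 0; hence bilinearity is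
    stated under [sqint]. *)
Definition ip f g : R := \int[mu]_(x in D) (f x * g x).

Let msqr f : measurable_fun D f -> measurable_fun D (fun x => (f x ^+ 2)%:E).
Proof. by move=> mf; apply/measurable_EFinP; exact: measurable_funX. Qed.

Lemma sqint_integrable_sqr f : sqint f ->
  mu.-integrable D (EFin \o (fun x => f x ^+ 2)).
Proof.
move=> [mf fy]; apply/integrableP; split; first exact: msqr.
by under eq_integral do rewrite gee0_abs ?lee_fin ?sqr_ge0//.
Qed.

Lemma sqint_integrable f g : sqint f -> sqint g ->
  mu.-integrable D (EFin \o (fun x => f x * g x)).
Proof.
move=> sf sg; have [[mf _] [mg _]] := (sf, sg).
have sfg := integrableD mD (sqint_integrable_sqr sf) (sqint_integrable_sqr sg).
apply: (le_integrable mD _ _ sfg).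
  by apply/measurable_EFinP; exact: measurable_funM.
move=> x Dx /=; rewrite lee_fin normrM.
rewrite [leRHS]ger0_norm ?addr_ge0 ?sqr_ge0//.
rewrite -(real_normK (num_real (f x))) -(real_normK (num_real (g x))).
have := sqr_ge0 (`|f x| - `|g x|).
have := mulr_ge0 (normr_ge0 (f x)) (normr_ge0 (g x)).
by nra.
Qed.

Lemma sqintZ (c : R) f : sqint f -> sqint (fun x => c * f x).
Proof.
move=> sf; split.
  by apply: measurable_funM; [exact: measurable_cst|case: sf].
under eq_integral do rewrite exprMn EFinM.
have [mf foo] := sf.
rewrite ge0_integralZl_EFin ?sqr_ge0//; last 2 first.
- by move=> x _; rewrite lee_fin sqr_ge0.
- exact: msqr.
by rewrite lte_mul_pinfty// lee_fin sqr_ge0.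
Qed.

Lemma sqint_le f g : measurable_fun D f -> (forall x, D x -> f x ^+ 2 <= g x ^+ 2) ->
  sqint g -> sqint f.
Proof.
move=> mf fg [mg goo]; split=> //; apply: le_lt_trans goo.
apply: ge0_le_integral => //.
- by move=> x _; rewrite lee_fin sqr_ge0.
- exact: msqr.
- exact: msqr.
Qed.

Lemma sqintD f g : sqint f -> sqint g -> sqint (fun x => f x + g x).
Proof.
move=> sf sg; have [[mf _] [mg _]] := (sf, sg).
have mfg : measurable_fun D (fun x => f x + g x) by exact: measurable_funD.
split=> //.
have sfg := integrableD mD
  (sqint_integrable_sqr (sqintZ 2 sf)) (sqint_integrable_sqr (sqintZ 2 sg)).
have := integrable_lty mD sfg; apply: le_lt_trans.
apply: ge0_le_integral => //.
- by move=> x _; rewrite lee_fin sqr_ge0.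
- exact: msqr.
- by have /integrableP[] := sfg.
- move=> x Dx; rewrite /= -EFinD lee_fin.
  have := sqr_ge0 (f x - g x); have := sqr_ge0 (f x); have := sqr_ge0 (g x).
  by nra.
Qed.

Lemma sqintN f : sqint f -> sqint (fun x => - f x).
Proof.
move=> sf; rewrite (_ : (fun _ => _) = (fun x => -1 * f x)); first exact: sqintZ.
by apply/funext => x; rewrite mulN1r.
Qed.

Lemma sqintB f g : sqint f -> sqint g -> sqint (fun x => f x - g x).
Proof. by move=> sf sg; apply: sqintD => //; exact: sqintN. Qed.

Lemma sqint_mul_bounded (h f : T -> R) (M : R) : measurable_fun D h ->
  (forall x, D x -> `|h x| <= M) -> sqint f -> sqint (fun x => h x * f x).
Proof.
move=> mh hM sf; have [mf _] := sf.
apply: (@sqint_le _ (fun x => M * f x)); [exact: measurable_funM| |exact: sqintZ].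
move=> x Dx; rewrite !exprMn ler_wpM2r ?sqr_ge0//.
have := hM _ Dx; have := normr_ge0 (h x); rewrite -(real_normK (num_real (h x))).
by move=> h0 hM'; rewrite lerXn2r ?nnegrE// (le_trans h0).
Qed.

Lemma sqint_bounded f (M : R) : (mu D < +oo)%E -> measurable_fun D f ->
  (forall x, D x -> `|f x| <= M) -> sqint f.
Proof.
move=> Doo mf fM; split => //.
rewrite (@le_lt_trans _ _ (\int[mu]_(x in D) (M ^+ 2)%:E)%E)//.
  apply: ge0_le_integral => //.
  - by move=> x _; rewrite lee_fin sqr_ge0.
  - exact: msqr.
  - move=> x Dx; rewrite lee_fin -(real_normK (num_real (f x))).
    by rewrite lerXn2r ?nnegrE ?(le_trans _ (fM _ Dx)) ?fM.
by rewrite integral_cst// lte_mul_pinfty// lee_fin sqr_ge0.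
Qed.

Lemma ipC f g : ip f g = ip g f.
Proof. by apply: eq_Rintegral => x _; rewrite mulrC. Qed.

Lemma eq_ip f f' g g' : (forall x, D x -> f x = f' x) ->
  (forall x, D x -> g x = g' x) -> ip f g = ip f' g'.
Proof.
by move=> ff' gg'; apply: eq_Rintegral => x /set_mem Dx; rewrite ff'// gg'.
Qed.

Lemma ipZl (c : R) f g : sqint f -> sqint g -> ip (fun x => c * f x) g = c * ip f g.
Proof.
move=> sf sg; rewrite /ip -RintegralZl//; last exact: sqint_integrable.
by apply: eq_Rintegral => x _; rewrite mulrA.
Qed.

Lemma ipZr (c : R) f g : sqint f -> sqint g -> ip f (fun x => c * g x) = c * ip f g.
Proof. by move=> sf sg; rewrite ipC ipZl// ipC. Qed.

Lemma ipDl f g h : sqint f -> sqint g -> sqint h ->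
  ip (fun x => f x + g x) h = ip f h + ip g h.
Proof.
move=> sf sg sh; rewrite /ip -RintegralD//; [|exact: sqint_integrable..].
by apply: eq_Rintegral => x _; rewrite mulrDl.
Qed.

Lemma ipDr f g h : sqint f -> sqint g -> sqint h ->
  ip h (fun x => f x + g x) = ip h f + ip h g.
Proof. by move=> sf sg sh; rewrite ipC ipDl// !(ipC h). Qed.

Lemma ipBl f g h : sqint f -> sqint g -> sqint h ->
  ip (fun x => f x - g x) h = ip f h - ip g h.
Proof.
move=> sf sg sh; rewrite /ip -RintegralB//; [|exact: sqint_integrable..].
by apply: eq_Rintegral => x _; rewrite mulrBl.
Qed.

Lemma ipBr f g h : sqint f -> sqint g -> sqint h ->
  ip h (fun x => f x - g x) = ip h f - ip h g.
Proof. by move=> sf sg sh; rewrite ipC ipBl// !(ipC h). Qed.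

Lemma ip_ge0 f : 0 <= ip f f.
Proof. by apply: Rintegral_ge0 => x _; rewrite -expr2 sqr_ge0. Qed.

Lemma ip_sqrE f : sqint f -> (\int[mu]_(x in D) (f x ^+ 2)%:E = (ip f f)%:E)%E.
Proof.
move=> sf; rewrite /ip /Rintegral fineK//.
exact/integrable_fin_num/sqint_integrable.
Qed.

Lemma ip_le f g f' g' : sqint f -> sqint g -> sqint f' -> sqint g' ->
  (forall x, D x -> f x * g x <= f' x * g' x) -> ip f g <= ip f' g'.
Proof. by move=> *; apply: le_Rintegral => //; exact: sqint_integrable. Qed.

Lemma ip_sqrD f g : sqint f -> sqint g ->
  ip (fun x => f x + g x) (fun x => f x + g x) = ip f f + 2 * ip f g + ip g g.
Proof.
move=> sf sg; have sfg := sqintD sf sg.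
by rewrite ipDl// !ipDr// (ipC g f); ring.
Qed.

Lemma ip_sqrB f g : sqint f -> sqint g ->
  ip (fun x => f x - g x) (fun x => f x - g x) = ip f f - 2 * ip f g + ip g g.
Proof.
move=> sf sg; have sfg := sqintB sf sg.
by rewrite ipBl// !ipBr// (ipC g f); ring.
Qed.

Lemma ip_sqr_linear f g (c : R) : sqint f -> sqint g ->
  ip (fun x => f x + c * g x) (fun x => f x + c * g x) =
  ip f f + 2 * c * ip f g + c ^+ 2 * ip g g.
Proof.
move=> sf sg; have sc := sqintZ c sg.
by rewrite ip_sqrD// ipZr// ipZl// ipZr//; ring.
Qed.

Lemma cauchy_schwarz f g : sqint f -> sqint g ->
  ip f g ^+ 2 <= ip f f * ip g g.
Proof.
move=> sf sg; apply: quadratic_discr => [|t]; first exact: ip_ge0.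
by rewrite -ip_sqr_linear// ip_ge0.
Qed.

Lemma cauchy_schwarz_abs f g : sqint f -> sqint g ->
  `|ip f g| <= Num.sqrt (ip f f) * Num.sqrt (ip g g).
Proof.
move=> sf sg; rewrite -sqrtrM ?ip_ge0// -sqrtr_sqr.
by rewrite ler_wsqrtr// cauchy_schwarz.
Qed.

Lemma cvg_ip (f g : (T -> R)^nat) (f0 g0 : T -> R) :
  (forall k, sqint (f k)) -> (forall k, sqint (g k)) -> sqint f0 -> sqint g0 ->
  ip (fun x => f k x - f0 x) (fun x => f k x - f0 x) @[k --> \oo] --> 0 ->
  ip (fun x => g k x - g0 x) (fun x => g k x - g0 x) @[k --> \oo] --> 0 ->
  ip (f k) (g k) @[k --> \oo] --> ip f0 g0.
Proof.
move=> sf sg sf0 sg0 cf cg.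
have csqrt (u : R^nat) : u @ \oo --> 0 -> Num.sqrt (u k) @[k --> \oo] --> 0.
  by move=> u0; rewrite -[X in _ --> X]sqrtr0; apply: continuous_cvg => //; exact: sqrt_continuous.
pose F k := Num.sqrt (ip (fun x => f k x - f0 x) (fun x => f k x - f0 x)).
pose G k := Num.sqrt (ip (fun x => g k x - g0 x) (fun x => g k x - g0 x)).
have cF : F @ \oo --> 0 by exact: csqrt.
have cG : G @ \oo --> 0 by exact: csqrt.
apply/cvgrPdist_le => /= e e0.
have cH : (F k * G k + F k * Num.sqrt (ip g0 g0) + Num.sqrt (ip f0 f0) * G k)
    @[k --> \oo] --> 0.
  rewrite (_ : 0 = 0 * 0 + 0 * Num.sqrt (ip g0 g0) + Num.sqrt (ip f0 f0) * 0); last first.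
    by rewrite !mul0r mulr0 !addr0.
  apply: cvgD; last exact: cvgMr.
  by apply: cvgD; [exact: cvgM|exact: cvgMl].
near=> k.
apply: (@le_trans _ _ (F k * G k + F k * Num.sqrt (ip g0 g0) + Num.sqrt (ip f0 f0) * G k)).
  have sfk := sqintB (sf k) sf0; have sgk := sqintB (sg k) sg0.
  rewrite distrC (_ : _ - _ = ip (fun x => f k x - f0 x) (fun x => g k x - g0 x) +
    ip (fun x => f k x - f0 x) g0 + ip f0 (fun x => g k x - g0 x)).
    rewrite !(le_trans (ler_normD _ _))// lerD//; last exact: cauchy_schwarz_abs.
    by rewrite (le_trans (ler_normD _ _))// lerD//; exact: cauchy_schwarz_abs.
  rewrite ipBl// !ipBr// ipBl//.
  by ring.
rewrite -[leLHS]subr0; apply: (le_trans (ler_norm _)); near: k.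
by move/cvgrPdist_le : cH => /(_ e e0); apply: filterS => k; rewrite distrC.
Unshelve. all: by end_near. Qed.

Let geometric_bound (N : nat) : \sum_(k < N) (4^-1 : R) ^+ k <= 2.
Proof.
suff : \sum_(k < N) (4^-1 : R) ^+ k <= 2 - 2 * 4^-1 ^+ N.
  by move/le_trans; apply; rewrite gerBl mulr_ge0// exprn_ge0// invr_ge0.
elim: N => [|N IH]; first by rewrite big_ord0 expr0; lra.
rewrite big_ord_recr/= exprS.
have : 0 <= (4^-1 : R) ^+ N by rewrite exprn_ge0// invr_ge0.
move: IH; set a := \sum_(_ < _) _; set b := _ ^+ N; lra.
Qed.

Let dist_geometric (u : R^nat) (H : R) :
  (forall k, `|u k.+1 - u k| <= H * 2^-1 ^+ k) ->
  forall k j, `|u (k + j)%N - u k| <= 2 * H * 2^-1 ^+ k.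
Proof.
move=> uH k j.
have H0 : 0 <= H by have := uH 0; rewrite expr0 mulr1; exact: le_trans.
have p0 i : 0 <= (2^-1 : R) ^+ i by rewrite exprn_ge0// invr_ge0.
suff : `|u (k + j)%N - u k| <= 2 * H * 2^-1 ^+ k - 2 * H * 2^-1 ^+ (k + j).
  by move/le_trans; apply; rewrite gerBl !mulr_ge0.
elim: j => [|j IH]; first by rewrite addn0 !subrr normr0.
rewrite addnS (le_trans (ler_distD (u (k + j)%N) _ _))//.
have := uH (k + j)%N; rewrite exprS; move: IH.
set a := `|_|; set b := `|_|; set c := _ ^+ k; set e := _ ^+ (k + j) => ha hb.
rewrite (_ : 2 * H * (2^-1 * e) = H * e); last by field.
lra.
Qed.

(** Riesz-Fischer for a fast sequence. The weights 4^k keep h, the sum of the g k, integrable, and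
    where h is finite they give |f_(k+1) - f_k| <= H 2^-k. Hence f_k converges there with squared
    error at most 4 * 4^-k * h, and integrating this bound yields the L^2 convergence. *)
Lemma sqint_complete (f : (T -> R)^nat) : (forall k, sqint (f k)) ->
  (forall k, ip (fun x => f k.+1 x - f k x) (fun x => f k.+1 x - f k x)
             <= 16^-1 ^+ k) ->
  exists2 f0, sqint f0 &
    ip (fun x => f k x - f0 x) (fun x => f k x - f0 x) @[k --> \oo] --> 0.
Proof.
move=> sf fk.
pose g k x := 4 ^+ k * (f k.+1 x - f k x) ^+ 2.
have g0 k x : 0 <= g k x by rewrite mulr_ge0 ?sqr_ge0 ?exprn_ge0.
have mdf k : measurable_fun D (fun x => f k.+1 x - f k x).
  by case: (sqintB (sf k.+1) (sf k)).
have mg k : measurable_fun D (fun x => (g k x)%:E).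
  apply/measurable_EFinP; apply: measurable_funM; first exact: measurable_cst.
  exact: measurable_funX.
pose h x := (\sum_(k <oo) (g k x)%:E)%E.
have h0 x : (0 <= h x)%E by apply: nneseries_ge0 => k _ _; rewrite lee_fin.
have mh : measurable_fun D h.
  by apply: (ge0_emeasurable_sum (P := xpredT)) => // k x Dx _; rewrite lee_fin.
have ih : (\int[mu]_(x in D) h x <= 2%:E)%E.
  rewrite integral_nneseries//; last by move=> k x _; rewrite lee_fin.
  apply: lime_le.
    by apply: is_cvg_nneseries => k _ _; apply: integral_ge0 => x _; rewrite lee_fin.
  near=> N; rewrite big_mkord.
  apply: (@le_trans _ _ (\sum_(k < N) ((4^-1 : R) ^+ k)%:E)%E); last first.
    by rewrite sumEFin lee_fin geometric_bound.
  apply: lee_sum => k _.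
  under eq_integral do rewrite EFinM.
  rewrite ge0_integralZl_EFin ?exprn_ge0//; last 2 first.
  - by move=> x _; rewrite lee_fin sqr_ge0.
  - exact: msqr.
  rewrite ip_sqrE; last exact: sqintB.
  rewrite -EFinM lee_fin.
  rewrite (_ : 4^-1 ^+ k = 4 ^+ k * 16^-1 ^+ k); last first.
    by rewrite -exprMn; congr (_ ^+ _); field.
  by rewrite ler_pM2l ?exprn_gt0.
pose G := D `&` [set x | (h x < +oo)%E].
have mG : measurable G by exact: emeasurable_fun_infty_o.
have GD : G `<=` D by move=> x [].
pose H x := Num.sqrt (fine (h x)).
have Hg x : G x -> forall k, `|f k.+1 x - f k x| <= H x * 2^-1 ^+ k.
  move=> [Dx hx] k.
  have hfin : h x \is a fin_num by rewrite ge0_fin_numE.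
  have gh : g k x <= fine (h x).
    rewrite -lee_fin fineK//.
    apply: (@le_trans _ _ (\sum_(0 <= i < k.+1) (g i x)%:E)%E); last first.
      by apply: nneseries_lim_ge => i _; rewrite lee_fin.
    rewrite big_nat_recr//= leeDr//.
    by apply: sume_ge0 => i _; rewrite lee_fin.
  rewrite -sqrtr_sqr -(sqr_sqrtr (exprn_ge0 k _ : 0 <= (2^-1 : R) ^+ k)) ?invr_ge0//.
  rewrite sqr_sqrtr; last by rewrite exprn_ge0// invr_ge0.
  rewrite -[X in _ * X]ger0_norm; last by rewrite exprn_ge0// invr_ge0.
  rewrite -sqrtr_sqr -sqrtrM; last exact: fine_ge0.
  apply: ler_wsqrtr; move: gh; rewrite /g => gh.
  rewrite -exprM mulnC exprM.
  rewrite (_ : (2^-1 : R) ^+ 2 = 4^-1); last by field.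
  by rewrite exprVn ler_pdivlMr ?exprn_gt0// mulrC.
(* G has full measure in D; the value 0 elsewhere makes f0 the pointwise limit on D of the
   measurable functions [\1_G * f k]. *)
pose f0 x := if x \in G then limn (fun k => f k x) else 0.
have cf0 x : G x -> f k x @[k --> \oo] --> f0 x.
  move=> Gx; rewrite /f0 mem_set//.
  apply: (@cauchy_cvg R); apply: cauchy_exP => _/posnumP[e].
  have p2 : (fun k => 2 * H x * 2^-1 ^+ k) @ \oo --> (2 * H x * 0 : R).
    apply: cvgMr; apply: cvg_expr.
    by rewrite ger0_norm ?invr_ge0// invf_lt1// ltr1n.
  rewrite mulr0 in p2.
  move/cvgrPdist_lt : p2 => /(_ e%:num [gt0 of e%:num]) [k _ kP].
  exists (f k x); exists k => // j /= kj.
  have := dist_geometric (Hg x Gx) k (j - k); rewrite subnKC// => hd.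
  rewrite /ball/= distrC (le_lt_trans hd)//.
  have := kP k (leqnn k); rewrite sub0r normrN; apply: le_lt_trans.
  exact: ler_norm.
have bf0 x : G x -> forall k, (f k x - f0 x) ^+ 2 <= 4 * 4^-1 ^+ k * fine (h x).
  move=> Gx k.
  have : `|f k x - f0 x| <= 2 * H x * 2^-1 ^+ k.
    rewrite distrC.
    have cd : `|f (k + j)%N x - f k x| @[j --> \oo] --> `|f0 x - f k x|.
      apply: cvg_norm; apply: cvgB; last exact: cvg_cst.
      under eq_fun do rewrite addnC.
      by have := cf0 x Gx; rewrite -(cvg_shiftn k).
    rewrite -(cvg_lim _ cd)//.
    apply: limr_le; first by apply/cvg_ex; eexists; exact: cd.
    by near=> j; exact: (dist_geometric (Hg x Gx)).
  have H0 : 0 <= H x by rewrite sqrtr_ge0.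
  have B0 : 0 <= 2 * H x * 2^-1 ^+ k.
    by rewrite !mulr_ge0// exprn_ge0// invr_ge0.
  rewrite -ler_sqr ?nnegrE//.
  rewrite (real_normK (num_real _)) => /le_trans; apply.
  rewrite !exprMn sqr_sqrtr ?fine_ge0//.
  rewrite -exprM mulnC exprM (_ : (2^-1 : R) ^+ 2 = 4^-1); last by field.
  by rewrite le_eqVlt; apply/orP; left; apply/eqP; ring.
have mf0 : measurable_fun D f0.
  have : measurable_fun D (fun x => \1_G x * f0 x).
    apply: (measurable_fun_cvg (h := fun k x => \1_G x * f k x)) => [k|x Dx].
      by apply: measurable_funM; [exact: measurable_indic|case: (sf k)].
    rewrite indicE; have [xG|/negbTE xG] := boolP (x \in G); rewrite /=.
      rewrite mul1r; under eq_fun do rewrite mul1r.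
      exact/cf0/set_mem.
    by rewrite mul0r; under eq_fun do rewrite mul0r; exact: cvg_cst.
  apply: eq_measurable_fun => x _; rewrite indicE /f0.
  by case: ifPn => // xG; rewrite ?mul1r// mul0r.
have aeG : {ae mu, forall x, D x -> G x}.
  have /integrable_ae : mu.-integrable D h.
    apply/integrableP; split=> //.
    under eq_integral do rewrite gee0_abs//.
    exact: (le_lt_trans ih (ltry _)).
  move=> /(_ mD); apply: filterS => x hx Dx; split=> //.
  by move: (hx Dx) => /=; rewrite ge0_fin_numE.
have key k : (\int[mu]_(x in D) ((f k x - f0 x) ^+ 2)%:E <= (8 * 4^-1 ^+ k)%:E)%E.
  have mfk : measurable_fun D (fun x => f k x - f0 x).
    by apply: measurable_funB => //; case: (sf k).
  apply: (@le_trans _ _ (\int[mu]_(x in D) ((4 * 4^-1 ^+ k)%:E * h x))%E).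
    apply: ae_ge0_le_integral => //.
    - by move=> x _; rewrite lee_fin sqr_ge0.
    - exact: msqr.
    - by move=> x _; rewrite mule_ge0// lee_fin mulr_ge0// exprn_ge0.
    - exact: measurable_funeM.
    - apply: filterS aeG => x Gx Dx; have [_ hx] := Gx Dx.
      rewrite -[h x]fineK ?ge0_fin_numE// -EFinM lee_fin.
      exact: bf0 (Gx Dx) k.
  have p4 : 0 <= 4 * (4^-1 : R) ^+ k by rewrite mulr_ge0// exprn_ge0// invr_ge0.
  rewrite ge0_integralZl_EFin//.
  rewrite (_ : 8 * _ = (4 * 4^-1 ^+ k) * 2); last by ring.
  by rewrite [leRHS]EFinM; apply: lee_wpmul2l; rewrite ?lee_fin.
have sfk k : sqint (fun x => f k x - f0 x).
  split; last by rewrite (le_lt_trans (key k)) ?ltry.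
  by apply: measurable_funB => //; case: (sf k).
have sf0 : sqint f0.
  rewrite (_ : f0 = fun x => f 0%N x - (f 0%N x - f0 x)); first exact: sqintB.
  by apply/funext => x; ring.
exists f0 => //.
have c8 : (fun k => 8 * (4^-1 : R) ^+ k) @ \oo --> (0 : R).
  rewrite -(mulr0 8); apply: cvgMr; apply: cvg_expr.
  by rewrite ger0_norm ?invr_ge0// invf_lt1// ltr1n.
apply: (squeeze_cvgr _ (cvg_cst 0) c8); apply: nearW => k.
rewrite ip_ge0/=; have := key k; rewrite ip_sqrE//.
Unshelve. all: by end_near. Qed.

End square_integrable.

(** * C^1 functions along segments *)

Section calculus.
Context {R : realType} {n : nat}.
Implicit Types (f g phi psi : 'rV[R]_n -> R) (D : set 'rV[R]_n).

Definition C1 f : Prop :=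
  (forall x, differentiable f x) /\ (forall i, continuous (partial i f)).

Lemma smooth_differentiable f x : smooth f -> differentiable f x.
Proof. by move=> /(_ [::] x). Qed.

(** In [foldr partial f s] the last index of [s] is differentiated first, so one more inner
    derivative is an [rcons]. *)
Lemma smooth_partial i f : smooth f -> smooth (partial i f).
Proof. by move=> sf s x; have := sf (rcons s i) x; rewrite foldr_rcons. Qed.

Lemma smooth_C1 f : smooth f -> C1 f.
Proof.
move=> sf; split=> [x|i x]; first exact: smooth_differentiable.
exact/differentiable_continuous/smooth_differentiable/smooth_partial.
Qed.

Lemma C1_continuous f : C1 f -> continuous f.
Proof. by move=> [df _] x; exact: differentiable_continuous. Qed.

Lemma partial_derivable f i x : differentiable f x ->
  derivable f x (delta_mx ord0 i : 'rV[R]_n).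
Proof. by move=> df; exact: diff_derivable. Qed.

Lemma partialD f g i : (forall x, differentiable f x) -> (forall x, differentiable g x) ->
  partial i (fun x => f x + g x) = (fun x => partial i f x + partial i g x).
Proof.
move=> df dg; apply/funext => x.
by rewrite /partial -deriveD//; exact: partial_derivable.
Qed.

Lemma partialZ f i (c : R) : (forall x, differentiable f x) ->
  partial i (fun x => c * f x) = (fun x => c * partial i f x).
Proof.
move=> df; apply/funext => x; rewrite /partial.
exact: (@deriveZ R _ _ f c x (delta_mx ord0 i) (@partial_derivable f i x (df x))).
Qed.

Lemma partialM f g i : (forall x, differentiable f x) -> (forall x, differentiable g x) ->
  partial i (fun x => f x * g x) =
  (fun x => f x * partial i g x + g x * partial i f x).
Proof.
move=> df dg; apply/funext => x.
rewrite /partial (_ : (fun x => f x * g x) = f * g)//.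
by rewrite deriveM//; exact: partial_derivable.
Qed.

Lemma smooth_linear f g (c : R) : smooth f -> smooth g ->
  smooth (fun x => f x + c * g x).
Proof.
move=> sf sg s.
suff H : foldr partial (fun x => f x + c * g x) s =
    (fun x => foldr partial f s x + c * foldr partial g s x).
  move=> x; rewrite H; apply: differentiableD; first exact: sf.
  by apply: differentiableZ; exact: sg.
elim: s => [//|i s /= ->].
rewrite partialD; last 2 first.
- by move=> x; exact: sf.
- by move=> x; apply: differentiableZ; exact: sg.
by rewrite partialZ// => x; exact: sg.
Qed.

Lemma C1M f g : C1 f -> C1 g -> C1 (fun x => f x * g x).
Proof.
move=> f1 g1; have [[df pf] [dg pg]] := (f1, g1).
split=> [x|i]; first exact: differentiableM.
rewrite partialM// => x.
have h1 : {for x, continuous (fun x => f x * partial i g x)}.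
  by apply: continuousM; [exact: C1_continuous|exact: pg].
have h2 : {for x, continuous (fun x => g x * partial i f x)}.
  by apply: continuousM; [exact: C1_continuous|exact: pf].
exact: continuousD h1 h2.
Qed.

Lemma rV_delta_sum (h : 'rV[R]_n) : h = \sum_i h ord0 i *: delta_mx ord0 i.
Proof. exact: row_sum_delta. Qed.

Lemma derive_partial f x (h : 'rV[R]_n) : differentiable f x ->
  'D_h f x = \sum_i h ord0 i * partial i f x.
Proof.
move=> df; rewrite deriveE// {1}[h]rV_delta_sum linear_sum.
by apply: eq_bigr => i _; rewrite linearZ/= /partial deriveE.
Qed.

(** The directional derivative, written as a sum so that it is visibly continuous in x for a C^1
    function and linear in h. *)
Definition dgrad f (h x : 'rV[R]_n) : R := \sum_i h ord0 i * partial i f x.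

Lemma continuous_dgrad f h : C1 f -> continuous (dgrad f h).
Proof.
move=> [_ cf] x.
suff H (r : seq 'I_n) : {for x, continuous (fun x => \sum_(i <- r) h ord0 i * partial i f x)}.
  exact: H.
elim: r => [|i r IH].
  have -> : (fun x => \sum_(i <- [::]) h ord0 i * partial i f x) = cst 0.
    by apply/funext => y; rewrite big_nil.
  exact: cst_continuous.
have -> : (fun x => \sum_(j <- i :: r) h ord0 j * partial j f x) =
    (fun x => h ord0 i * partial i f x + \sum_(j <- r) h ord0 j * partial j f x).
  by apply/funext => y; rewrite big_cons.
apply: (@continuousD _ _ _ (fun x => h ord0 i * partial i f x)) => //.
by apply: continuousM; [exact: cst_continuous|exact: cf].
Qed.

Lemma is_derive_line f (x h : 'rV[R]_n) (t : R) : (forall y, differentiable f y) ->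
  is_derive t 1 (fun t : R => f (x + t *: h)) (dgrad f h (x + t *: h)).
Proof.
move=> df.
have E : (fun s : R => s^-1 *: (((fun t : R => f (x + t *: h)) \o shift t) (s *: 1) -
      f (x + t *: h))) =
    (fun s : R => s^-1 *: ((f \o shift (x + t *: h)) (s *: h) - f (x + t *: h))).
  apply/funext => s; congr (_ *: (_ - _)) => /=.
  by congr f; rewrite [s *: 1]mulr1 scalerDl addrCA addrC.
have dfh : derivable f (x + t *: h) h by exact: diff_derivable.
apply: DeriveDef; first by rewrite /derivable E.
by rewrite /derive E; exact: derive_partial.
Qed.

Lemma continuous_line (x h : 'rV[R]_n) : continuous (fun t : R => x + t *: h).
Proof.
by move=> t; apply: cvgD; [exact: cvg_cst|apply: cvgZl; exact: cvg_id].
Qed.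

Lemma integral_line f (x h : 'rV[R]_n) : C1 f ->
  (\int[@lebesgue_measure R]_(t in `[0%R, 1%R]) (dgrad f h (x + t *: h))%:E =
   (f (x + h) - f x)%:E)%E.
Proof.
move=> f1; have [df _] := f1.
rewrite (@continuous_FTC2 _ _ (fun t : R => f (x + t *: h)))//.
- by rewrite scale1r scale0r addr0 EFinB.
- apply: continuous_subspaceT => t.
  apply: continuous_comp; first exact: continuous_line.
  exact: continuous_dgrad.
- have cl : continuous (fun t : R => f (x + t *: h)).
    move=> t; apply: continuous_comp; first exact: continuous_line.
    exact: C1_continuous.
  split.
  + by move=> t _; have [] := is_derive_line x h t df.
  + exact/cvg_at_right_filter/cl.
  + exact/cvg_at_left_filter/cl.
- by move=> t _; rewrite derive1E; have [_ ->] := is_derive_line x h t df.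
Qed.

Lemma measurable_dgrad f h : C1 f -> measurable_fun setT (dgrad f h).
Proof. by move=> f1; apply: measurable_rV_continuous; exact: continuous_dgrad. Qed.

(** The fundamental theorem of calculus along the segment, then Cauchy-Schwarz against the constant
    1 on [0, 1]. *)
Lemma sqr_diff_le f (x h : 'rV[R]_n) : C1 f ->
  (((f (x + h) - f x) ^+ 2)%:E <=
   \int[@lebesgue_measure R]_(t in `[0%R, 1%R]) (dgrad f h (x + t *: h) ^+ 2)%:E)%E.
Proof.
move=> f1.
set g := fun t : R => dgrad f h (x + t *: h).
have cg : continuous g.
  by move=> t; apply: continuous_comp;
    [exact: continuous_line|exact: continuous_dgrad].
have m01 : measurable (`[0, 1]%classic : set (measurableTypeR R)) by [].
have mu01 : lebesgue_measure (`[0, 1]%classic : set R) = 1%E.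
  by rewrite lebesgue_measure_itv/= lte_fin ltr01 sube0.
have mg : measurable_fun (`[0, 1]%classic : set (measurableTypeR R)) g.
  by apply: measurable_funTS; exact: continuous_measurable_fun.
have [M Mg] : exists M, forall t, t \in `[0, 1]%R -> `|g t| <= M.
  have := @EVT_max R (fun t => `|g t|) 0 1 ler01.
  case; last by move=> c _ cM; exists `|g c|.
  apply: continuous_subspaceT => t.
  by apply: continuous_comp; [exact: cg|exact: norm_continuous].
have sg : sqint (@lebesgue_measure R) `[0, 1]%classic g.
  apply: (@sqint_bounded _ _ _ _ _ _ _ M) => //=.
  by rewrite mu01 ltry.
have s1 : sqint (@lebesgue_measure R) `[0, 1]%classic (cst 1).
  apply: (@sqint_bounded _ _ _ _ _ _ _ 1) => //=.
    by rewrite mu01 ltry.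
  by move=> t _; rewrite normr1.
have := cauchy_schwarz m01 sg s1.
rewrite [X in X ^+ 2 <= _](_ : _ = f (x + h) - f x); last first.
  rewrite /ip (_ : (fun t => _) = g); last by apply/funext => t; rewrite mulr1.
  by rewrite /Rintegral integral_line.
rewrite [X in _ <= _ * X](_ : _ = 1); last first.
  rewrite /ip /Rintegral; under eq_integral do rewrite mulr1 /=.
  by rewrite integral_cst// mul1e; exact: (congr1 fine mu01).
by rewrite mulr1 (ip_sqrE m01 sg) lee_fin.
Qed.

End calculus.

(** * Translates of a function compared with its gradient *)

Section translation.
Context {R : realType} {n : nat}.
Implicit Types (f g phi psi : 'rV[R]_n -> R) (D : set 'rV[R]_n).

Lemma measurable_line (h : 'rV[R]_n) : measurable_fun setT
  (fun p : measurableTypeR R * 'rV[R]_n => p.2 + p.1 *: h).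
Proof.
apply: measurable_rVD; first exact: measurable_snd.
by apply: measurable_rVZ; [exact: measurable_fst|exact: measurable_cst].
Qed.

(** Integrate [sqr_diff_le] over x and exchange the integrals: by translation invariance the inner
    one does not depend on t, which ranges over an interval of length 1. *)
Lemma translation_le f (h : 'rV[R]_n) : C1 f ->
  (\int[lebesgue_rV n]_x ((f (x + h) - f x) ^+ 2)%:E <=
   \int[lebesgue_rV n]_x (dgrad f h x ^+ 2)%:E)%E.
Proof.
move=> f1.
have mf : measurable_fun setT f by apply: measurable_rV_continuous; exact: C1_continuous.
have mg := measurable_dgrad h f1.
pose G (p : measurableTypeR R * 'rV[R]_n) : \bar R :=
  ((\1_(`[0%R, 1%R]%classic : set (measurableTypeR R)) p.1 * dgrad f h (p.2 + p.1 *: h) ^+ 2)%R)%:E.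
have mG : measurable_fun setT G.
  apply/measurable_EFinP; apply: measurable_funM.
    have m1 : measurable_fun setT
        (\1_(`[0%R, 1%R]%classic : set (measurableTypeR R)) : measurableTypeR R -> R).
      exact: measurable_indic.
    exact: (measurableT_comp m1 measurable_fst).
  apply: measurable_funX; apply: (measurableT_comp mg).
  exact: measurable_line.
have G0 p : (0 <= G p)%E by rewrite lee_fin mulr_ge0// sqr_ge0.
apply: (@le_trans _ _ (\int[lebesgue_rV n]_x \int[@lebesgue_measure R]_t G (t, x))%E).
  apply: ge0_le_integral => //.
  - by move=> x _; rewrite lee_fin sqr_ge0.
  - apply/measurable_EFinP; apply: measurable_funX; apply: measurable_funB => //.
    apply: measurableT_comp => //; apply: measurable_rVD => //.
  - exact: (measurable_fun_fubini_tonelli_G G mG G0).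
  - move=> x _; apply: (le_trans (sqr_diff_le x h f1)).
    rewrite le_eqVlt; apply/orP; left; apply/eqP.
    rewrite integral_mkcond; apply: eq_integral => t _.
    by rewrite /G/= patchE indicE; case: ifPn; rewrite ?mul1r ?mul0r.
rewrite -(fubini_tonelli G mG G0).
under eq_integral => t _.
  under eq_integral => x _ do rewrite /G/= EFinM.
  rewrite ge0_integralZl_EFin//; last 2 first.
  - by move=> x _; rewrite lee_fin sqr_ge0.
  - apply/measurable_EFinP; apply: measurable_funX; apply: (measurableT_comp mg).
    apply: measurable_rVD => //.
  rewrite (ge0_integral_rV_shift (t *: h) (f := fun x => (dgrad f h x ^+ 2)%:E)); last 2 first.
  - by apply/measurable_EFinP; exact: measurable_funX.
  - by move=> x; rewrite lee_fin sqr_ge0.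
  over.
rewrite ge0_integralZr//; last 2 first.
- by apply/measurable_EFinP; exact: measurable_indic.
- by apply: integral_ge0 => x _; rewrite lee_fin sqr_ge0.
rewrite integral_indic// setIT [X in (X * _)%E](_ : _ = 1%E) ?mul1e//.
transitivity (@lebesgue_measure R `[0%R, 1%R]%classic) => //.
by rewrite lebesgue_measure_itv/= lte_fin ltr01 sube0.
Qed.

End translation.

Section cube.
Context {R : realType}.

Definition cube (n : nat) (a : R) : set 'rV[R]_n :=
  [set x | forall i, `|x ord0 i| <= a].
Arguments cube : clear implicits.

Lemma cube_cons (n : nat) (a t : R) (y : 'rV[R]_n) :
  cube n.+1 a (rV_cons t y) <-> `|t| <= a /\ cube n a y.
Proof.
split=> [H|[ta ya] i]; last first.
  by case: (unliftP ord0 i) => [j|] ->; rewrite ?rV_consS ?rV_cons0.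
split; first by have := H ord0; rewrite rV_cons0.
by move=> j; have := H (lift ord0 j); rewrite rV_consS.
Qed.

Lemma measurable_cube (n : nat) (a : R) : measurable (cube n a).
Proof.
rewrite (_ : cube n a = \bigcap_(i in [set: 'I_n])
    (rV_coord i @^-1` `[- a, a]%classic)).
  apply: fin_bigcap_measurable => // i _.
  by rewrite -[X in measurable X]setTI; exact: measurable_rV_coord.
apply/seteqP; split=> x /= H i.
  by move=> _; rewrite /= in_itv/= -ler_norml; exact: H.
by have := H i I; rewrite /= in_itv/= -ler_norml.
Qed.

Lemma indic_cube_cons (n : nat) (a t : R) (y : 'rV[R]_n) :
  \1_(cube n.+1 a) (rV_cons t y) = \1_(`[- a, a]%classic : set R) t * \1_(cube n a) y :> R.
Proof.
rewrite !indicE -natrM mulnb; congr ((_ : bool)%:R).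
apply/idP/andP => [/set_mem/cube_cons[ta ya]|[/set_mem ta /set_mem ya]].
  by split; apply/mem_set => //=; rewrite in_itv/= -ler_norml.
by apply/mem_set/cube_cons; move: ta; rewrite /= in_itv/= -ler_norml.
Qed.

Lemma integral_sqr_affine (a c v k : R) : 0 < a ->
  (\int[@lebesgue_measure R]_(t in `[(- a)%R, a]) ((c + t * v) ^+ 2 + k)%:E =
   (2 * a * (c ^+ 2 + k + a ^+ 2 / 3 * v ^+ 2))%:E)%E.
Proof.
move=> a0.
pose p : {poly R} := (c ^+ 2 + k)%:P * 'X + (c * v)%:P * 'X^2 + (v ^+ 2 / 3)%:P * 'X^3.
have pE t : p^`().[t] = (c + t * v) ^+ 2 + k.
  by rewrite /p !poly.derivE !hornerE/=; field.
rewrite (@continuous_FTC2 _ _ (horner p)).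
- by rewrite -EFinB /p !(hornerD, hornerM, hornerC, hornerX, hornerXn); congr EFin; field.
- by rewrite gtrN.
- apply: continuous_subspaceT.
  rewrite (_ : (fun t => _) = horner p^`()); last by apply/funext => t; rewrite pE.
  exact: continuous_horner.
- split.
  + by move=> t _; exact: derivable_horner.
  + exact/cvg_at_right_filter/continuous_horner.
  + exact/cvg_at_left_filter/continuous_horner.
- by move=> t _; rewrite -derivE pE.
Qed.

Lemma measurable_sum_coord (n : nat) (c : R) (v : 'I_n -> R) :
  measurable_fun setT (fun h : 'rV[R]_n => c + \sum_i h ord0 i * v i).
Proof.
apply: measurable_funD; first exact: measurable_cst.
apply: measurable_sum => i; apply: measurable_funM; last exact: measurable_cst.
exact: (measurable_rV_coord i).
Qed.

(** The constant c carries the induction: with the first coordinate t fixed, c + t * v ord0 is the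
    constant for the remaining ones. Odd terms vanish by symmetry, and a^2 / 3 is the mean of t^2
    over [-a, a]. *)
Lemma integral_cube_sqr (n : nat) (a c : R) (v : 'I_n -> R) : 0 < a ->
  (\int[lebesgue_rV n]_h (\1_(cube n a) h * (c + \sum_i h ord0 i * v i) ^+ 2)%:E =
   ((2 * a) ^+ n * (c ^+ 2 + a ^+ 2 / 3 * \sum_i v i ^+ 2))%:E)%E.
Proof.
move=> a0; elim: n => [|n IH] in c v *.
  rewrite (_ : cube 0 a = setT); last by apply/seteqP; split => // x _ [].
  under eq_integral => h _ do rewrite big_ord0 addr0 indicT mul1r.
  rewrite integral_cst// big_ord0 mulr0 addr0 expr0 mul1r.
  by rewrite [X in (_ * X)%E](_ : _ = 1%E) ?mule1//= diracT.
have mF : measurable_fun [set: 'rV[R]_n.+1]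
    (fun h : 'rV[R]_n.+1 => (\1_(cube n.+1 a) h * (c + \sum_i h ord0 i * v i) ^+ 2)%:E).
  apply/measurable_EFinP; apply: measurable_funM.
    by apply: measurable_indic; exact: measurable_cube.
  by apply: measurable_funX; exact: measurable_sum_coord.
have F0 h : (0 <= (\1_(cube n.+1 a) h * (c + \sum_i h ord0 i * v i) ^+ 2)%:E)%E.
  by rewrite lee_fin mulr_ge0// sqr_ge0.
rewrite (ge0_integral_rV_cons mF F0).
pose w (j : 'I_n) := v (lift ord0 j).
transitivity (\int[@lebesgue_measure R]_(t in `[(- a)%R, a])
    (((2 * a) ^+ n)%:E * ((c + t * v ord0) ^+ 2 + a ^+ 2 / 3 * \sum_i w i ^+ 2)%R%:E))%E.
  rewrite [RHS]integral_mkcond; apply: eq_integral => t _.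
  rewrite patchE.
  under eq_integral => y _.
    rewrite indic_cube_cons -mulrA EFinM big_ord_recl rV_cons0 addrA.
    under eq_bigr => j _ do rewrite rV_consS -/(w j).
    over.
  rewrite ge0_integralZl_EFin//; last 2 first.
  - by move=> y _; rewrite lee_fin mulr_ge0// sqr_ge0.
  - apply/measurable_EFinP; apply: measurable_funM.
      by apply: measurable_indic; exact: measurable_cube.
    by apply: measurable_funX; exact: measurable_sum_coord.
  rewrite IH indicE; case: ifPn => _; last by rewrite mul0e.
  by rewrite mul1e EFinM.
rewrite ge0_integralZl_EFin//; last 3 first.
- by move=> t _; rewrite lee_fin addr_ge0// ?sqr_ge0// mulr_ge0 ?divr_ge0 ?sqr_ge0// sumr_ge0// => i _; rewrite sqr_ge0.
- apply/measurable_EFinP; apply: measurable_funD; last exact: measurable_cst.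
  apply: measurable_funX; apply: measurable_funD; first exact: measurable_cst.
  by apply: measurable_funM => //; exact: measurable_cst.
- by rewrite exprn_ge0// mulr_ge0// ltW.
rewrite integral_sqr_affine// -EFinM; congr EFin.
rewrite (_ : \sum_i v i ^+ 2 = v ord0 ^+ 2 + \sum_i w i ^+ 2) ?big_ord_recl//.
by rewrite [(2 * a) ^+ n.+1]exprS; set S := \sum_i _; set q := (2 * a) ^+ n; field.
Qed.

End cube.
Arguments cube {R} n a.

Section fubini_box.
Context {R : realType}.

Lemma measurable_box (n : nat) (A : 'I_n -> set R) : (forall i, measurable (A i)) ->
  measurable [set x : 'rV[R]_n | forall i, A i (x ord0 i)].
Proof.
move=> mA.
rewrite (_ : mkset _ = \bigcap_(i in [set: 'I_n]) (rV_coord i @^-1` A i)).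
  apply: fin_bigcap_measurable => // i _.
  by rewrite -[X in measurable X]setTI; apply: measurable_rV_coord => //; exact: mA.
by apply/seteqP; split=> x /= H i; [move=> _|]; exact: H.
Qed.

Lemma lebesgue_rV_box (n : nat) (A : 'I_n -> set R) (l : R) :
  (forall i, measurable (A i)) -> (forall i, lebesgue_measure (A i) = l%:E) ->
  lebesgue_rV n [set x : 'rV[R]_n | forall i, A i (x ord0 i)] = (l ^+ n)%:E.
Proof.
elim: n => [|n IH] in A * => mA lA.
  rewrite (_ : mkset _ = setT) ?expr0 /=; first exact: diracT.
  by apply/seteqP; split => // x _ [].
have mB := measurable_box mA.
rewrite -[X in lebesgue_rV n.+1 X]setIT -integral_indic//.
rewrite ge0_integral_rV_cons//; last first.
  by apply/measurable_EFinP; exact: measurable_indic.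
have mB' := @measurable_box n (fun j => A (lift ord0 j)) (fun j => mA _).
transitivity (\int[@lebesgue_measure R]_t ((\1_(A ord0) t)%:E * (l ^+ n)%:E))%E.
  apply: eq_integral => t _.
  rewrite -(IH (fun j => A (lift ord0 j)))// -[X in (_ * lebesgue_rV n X)%E]setIT -integral_indic//.
  rewrite -ge0_integralZl_EFin//; last by apply/measurable_EFinP; exact: measurable_indic.
  apply: eq_integral => y _; rewrite -EFinM; congr EFin.
  rewrite !indicE -natrM mulnb; congr ((_ : bool)%:R).
  apply/idP/andP => [/set_mem/= H|[/set_mem At /set_mem/= H]].
    split; apply/mem_set; first by have := H ord0; rewrite rV_cons0.
    by move=> j; have := H (lift ord0 j); rewrite rV_consS.
  by apply/mem_set => i; case: (unliftP ord0 i) => [j|] ->; rewrite ?rV_consS ?rV_cons0.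
rewrite ge0_integralZr//; last 2 first.
- by apply/measurable_EFinP; apply: measurable_indic; exact: mA.
- rewrite lee_fin exprn_ge0//.
  by rewrite -lee_fin -(lA ord0) measure_ge0.
rewrite integral_indic//; last exact: mA.
rewrite setIT [X in (X * _)%E](_ : _ = l%:E); last exact: lA.
by rewrite -EFinM exprS.
Qed.

End fubini_box.

Section cube_translation.
Context {R : realType} {n : nat}.
Local Notation leb := (lebesgue_rV n).
Implicit Types f : 'rV[R]_n -> R.

Lemma measurable_C1 f : C1 f -> measurable_fun setT f.
Proof. by move=> f1; apply: measurable_rV_continuous; exact: C1_continuous. Qed.

Lemma measurable_partial f i : C1 f -> measurable_fun setT (partial i f).
Proof. by move=> [_ f1]; apply: measurable_rV_continuous; exact: f1. Qed.

Let mindic (a : R) : measurable_fun setT (fun p : 'rV[R]_n * 'rV[R]_n => \1_(cube n a) p.2 : R).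
Proof.
have m1 : measurable_fun setT (\1_(cube n a) : 'rV[R]_n -> R).
  by apply: measurable_indic; exact: measurable_cube.
exact: (measurableT_comp m1 measurable_snd).
Qed.

Let mshift f : measurable_fun setT f ->
  measurable_fun setT (fun p : 'rV[R]_n * 'rV[R]_n => f (p.1 + p.2)).
Proof.
move=> mf; apply: (measurableT_comp mf).
by apply: measurable_rVD; [exact: measurable_fst|exact: measurable_snd].
Qed.

Let mfst f : measurable_fun setT f ->
  measurable_fun setT (fun p : 'rV[R]_n * 'rV[R]_n => f p.1).
Proof. by move=> mf; exact: (measurableT_comp mf measurable_fst). Qed.

(** For fixed h this is [translation_le]. Averaging the square of h . grad f over the cube kills the
    mixed products, so only |grad f|^2 remains, with no factor n. *)
Lemma cube_translation f (a : R) : C1 f -> 0 < a ->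
  (\int[leb]_x \int[leb]_h (\1_(cube n a) h * (f (x + h) - f x) ^+ 2)%:E <=
   ((2 * a) ^+ n * (a ^+ 2 / 3))%:E *
     \int[leb]_x (\sum_i partial i f x ^+ 2)%:E)%E.
Proof.
move=> f1 a0; have mf := measurable_C1 f1.
pose F (p : 'rV[R]_n * 'rV[R]_n) := (\1_(cube n a) p.2 * (f (p.1 + p.2) - f p.1) ^+ 2)%:E.
pose G (p : 'rV[R]_n * 'rV[R]_n) := (\1_(cube n a) p.2 * (dgrad f p.2 p.1) ^+ 2)%:E.
have mF : measurable_fun setT F.
  apply/measurable_EFinP; apply: measurable_funM => //.
  by apply: measurable_funX; apply: measurable_funB; [exact: mshift|exact: mfst].
have mG : measurable_fun setT G.
  apply/measurable_EFinP; apply: measurable_funM => //; apply: measurable_funX.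
  apply: measurable_sum => i; apply: measurable_funM.
    exact: (measurableT_comp (measurable_rV_coord i) measurable_snd).
  by apply: mfst; exact: measurable_partial.
have F0 p : (0 <= F p)%E by rewrite lee_fin mulr_ge0// sqr_ge0.
have G0 p : (0 <= G p)%E by rewrite lee_fin mulr_ge0// sqr_ge0.
rewrite (fubini_tonelli F mF F0)/=.
apply: (@le_trans _ _ (\int[leb]_h \int[leb]_x G (x, h))%E).
  apply: ge0_le_integral => //.
  - by move=> h _; exact: integral_ge0.
  - exact: (measurable_fun_fubini_tonelli_G F mF F0).
  - exact: (measurable_fun_fubini_tonelli_G G mG G0).
  move=> h _; rewrite /F /G /=.
  under eq_integral do rewrite EFinM.
  rewrite ge0_integralZl_EFin//; last 2 first.
  - by move=> x _; rewrite lee_fin sqr_ge0.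
  - apply/measurable_EFinP; apply: measurable_funX; apply: measurable_funB => //.
    by apply: (measurableT_comp mf); apply: measurable_rVD => //.
  under [leRHS]eq_integral do rewrite EFinM.
  rewrite [leRHS]ge0_integralZl_EFin//; last 2 first.
  - by move=> x _; rewrite lee_fin sqr_ge0.
  - by apply/measurable_EFinP; apply: measurable_funX; exact: measurable_dgrad.
  by apply: lee_wpmul2l; [rewrite lee_fin|exact: translation_le].
rewrite -(fubini_tonelli G mG G0)/=.
under eq_integral => x _.
  rewrite (_ : (fun h => _) = (fun h : 'rV[R]_n =>
    (\1_(cube n a) h * (0 + \sum_i h ord0 i * partial i f x) ^+ 2)%:E)); last first.
    by apply/funext => h; rewrite add0r.
  rewrite integral_cube_sqr// expr0n/= add0r mulrA EFinM.
  over.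
rewrite ge0_integralZl_EFin//.
- by move=> x _; rewrite lee_fin sumr_ge0// => i _; rewrite sqr_ge0.
- apply/measurable_EFinP; apply: measurable_sum => i; apply: measurable_funX.
  exact: measurable_partial.
- by rewrite mulr_ge0 ?divr_ge0 ?sqr_ge0// exprn_ge0// mulr_ge0// ltW.
Qed.

Lemma integral_indic_cube (a : R) : 0 < a ->
  (\int[leb]_h (\1_(cube n a) h)%:E = ((2 * a) ^+ n)%:E)%E.
Proof.
move=> a0; have := @integral_cube_sqr R n a 1 (fun=> 0) a0.
rewrite expr1n big1 ?mulr0 ?addr0 ?mulr1; last by move=> i _; rewrite expr0n.
move=> <-; apply: eq_integral => h _.
by rewrite big1 ?addr0 ?expr1n ?mulr1// => i _; rewrite mulr0.
Qed.

(* Averaging [|f(x + h) - f(x)|^2 >= f(x)^2 + f(x + h)^2 - 2 |f(x)| |f(x + h)|]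
   over x and over h in a cube of side 2a. *)
Lemma cube_translation_norm f (a : R) : C1 f -> 0 < a ->
  ((2 * (2 * a) ^+ n)%:E * \int[leb]_x (f x ^+ 2)%:E <=
   ((2 * a) ^+ n * (a ^+ 2 / 3))%:E * \int[leb]_x (\sum_i partial i f x ^+ 2)%:E +
   2%:E * (\int[leb]_x `|f x|%:E) * (\int[leb]_x `|f x|%:E))%E.
Proof.
move=> f1 a0; have mf := measurable_C1 f1.
have mnf : measurable_fun setT (fun x => `|f x|) by exact: measurableT_comp.
have mf2 : measurable_fun setT (fun x => (f x ^+ 2)%:E).
  by apply/measurable_EFinP; exact: measurable_funX.
have ca0 : 0 <= (2 * a) ^+ n by rewrite exprn_ge0// mulr_ge0// ltW.
pose A (p : 'rV[R]_n * 'rV[R]_n) := (\1_(cube n a) p.2 * f p.1 ^+ 2)%:E.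
pose B (p : 'rV[R]_n * 'rV[R]_n) := (\1_(cube n a) p.2 * f (p.1 + p.2) ^+ 2)%:E.
pose F (p : 'rV[R]_n * 'rV[R]_n) := (\1_(cube n a) p.2 * (f (p.1 + p.2) - f p.1) ^+ 2)%:E.
(* The cross term is taken without the indicator of the cube: h then runs over the whole space, and
   the double integral becomes the square of the L^1 norm. *)
pose G (p : 'rV[R]_n * 'rV[R]_n) := (2 * (`|f p.1| * `|f (p.1 + p.2)|))%:E.
have mA : measurable_fun setT A.
  apply/measurable_EFinP; apply: measurable_funM => //.
  by apply: measurable_funX; exact: mfst.
have mB : measurable_fun setT B.
  apply/measurable_EFinP; apply: measurable_funM => //.
  by apply: measurable_funX; exact: mshift.
have mF : measurable_fun setT F.
  apply/measurable_EFinP; apply: measurable_funM => //.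
  by apply: measurable_funX; apply: measurable_funB; [exact: mshift|exact: mfst].
have mG : measurable_fun setT G.
  apply/measurable_EFinP; apply: measurable_funM; first exact: measurable_cst.
  apply: measurable_funM; first exact: (mfst mnf).
  exact: (mshift mnf).
have A0 p : (0 <= A p)%E by rewrite lee_fin mulr_ge0// sqr_ge0.
have B0 p : (0 <= B p)%E by rewrite lee_fin mulr_ge0// sqr_ge0.
have F0 p : (0 <= F p)%E by rewrite lee_fin mulr_ge0// sqr_ge0.
have G0 p : (0 <= G p)%E by rewrite lee_fin !mulr_ge0.
have mA1 x : measurable_fun setT (fun h => A (x, h)).
  exact: (measurableT_comp mA (measurable_pair1 x)).
have mB1 x : measurable_fun setT (fun h => B (x, h)).
  exact: (measurableT_comp mB (measurable_pair1 x)).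
have mF1 x : measurable_fun setT (fun h => F (x, h)).
  exact: (measurableT_comp mF (measurable_pair1 x)).
have mG1 x : measurable_fun setT (fun h => G (x, h)).
  exact: (measurableT_comp mG (measurable_pair1 x)).
have IA : (\int[leb]_x \int[leb]_h A (x, h) = ((2 * a) ^+ n)%:E * \int[leb]_x (f x ^+ 2)%:E)%E.
  rewrite -ge0_integralZl_EFin//; last by move=> x _; rewrite lee_fin sqr_ge0.
  apply: eq_integral => x _; rewrite /A/=.
  under eq_integral do rewrite mulrC EFinM.
  rewrite ge0_integralZl_EFin ?sqr_ge0//; last first.
    by apply/measurable_EFinP; apply: measurable_indic; exact: measurable_cube.
  by rewrite integral_indic_cube// muleC.
have IB : (\int[leb]_x \int[leb]_h B (x, h) = ((2 * a) ^+ n)%:E * \int[leb]_x (f x ^+ 2)%:E)%E.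
  rewrite (fubini_tonelli B mB B0)/= -(integral_indic_cube a0) -ge0_integralZr//; last 2 first.
  - by apply/measurable_EFinP; apply: measurable_indic; exact: measurable_cube.
  - by apply: integral_ge0 => x _; rewrite lee_fin sqr_ge0.
  apply: eq_integral => h _; rewrite /B/=.
  under eq_integral do rewrite EFinM.
  rewrite ge0_integralZl_EFin//; last 2 first.
  - by move=> x _; rewrite lee_fin sqr_ge0.
  - apply/measurable_EFinP; apply: measurable_funX; apply: (measurableT_comp mf).
    by apply: measurable_rVD => //.
  congr (_ * _)%E.
  by rewrite (ge0_integral_rV_shift h (f := fun x => (f x ^+ 2)%:E))// => x; rewrite lee_fin sqr_ge0.
have IG : (\int[leb]_x \int[leb]_h G (x, h) =
    2%:E * (\int[leb]_x `|f x|%:E) * (\int[leb]_x `|f x|%:E))%E.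
  have mnE : measurable_fun setT (fun x : 'rV[R]_n => `|f x|%:E) by exact/measurable_EFinP.
  rewrite -muleA -ge0_integralZr//; last by apply: integral_ge0 => x _; rewrite lee_fin.
  rewrite -ge0_integralZl_EFin//; last 2 first.
  - by move=> x _; rewrite mule_ge0// ?lee_fin// integral_ge0// => y _; rewrite lee_fin.
  - by apply: emeasurable_funM => //; exact: measurable_cst.
  apply: eq_integral => x _; rewrite /G/=.
  under eq_integral do rewrite mulrA EFinM.
  rewrite ge0_integralZl_EFin ?mulr_ge0//; last first.
    apply/measurable_EFinP; apply: (measurableT_comp mnf).
    by apply: measurable_rVD => //.
  rewrite EFinM -muleA; congr (_ * (_ * _))%E.
  under eq_integral do rewrite addrC.
  by rewrite (ge0_integral_rV_shift x (f := fun x => `|f x|%:E)).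
rewrite EFinM -muleA mule_natl mule2n -{1}IA -IB.
rewrite [leLHS](_ : _ = \int[leb]_x \int[leb]_h (A (x, h) + B (x, h)))%E; last first.
  rewrite -ge0_integralD//.
  - by apply: eq_integral => x _; rewrite ge0_integralD.
  - by move=> x _; exact: integral_ge0.
  - exact: (measurable_fun_fubini_tonelli_F A mA A0).
  - by move=> x _; exact: integral_ge0.
  - exact: (measurable_fun_fubini_tonelli_F B mB B0).
apply: (@le_trans _ _ (\int[leb]_x \int[leb]_h (F (x, h) + G (x, h)))%E).
  have mAB : measurable_fun setT (A \+ B)%E by exact: emeasurable_funD.
  have mFG : measurable_fun setT (F \+ G)%E by exact: emeasurable_funD.
  have AB0 p : (0 <= (A \+ B) p)%E by rewrite adde_ge0.
  have FG0 p : (0 <= (F \+ G) p)%E by rewrite adde_ge0.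
  apply: ge0_le_integral => //.
  - by move=> x _; apply: integral_ge0 => h _; rewrite adde_ge0.
  - exact: (measurable_fun_fubini_tonelli_F _ mAB AB0).
  - exact: (measurable_fun_fubini_tonelli_F _ mFG FG0).
  move=> x _; apply: ge0_le_integral => //.
  - by apply: emeasurable_funD.
  - by apply: emeasurable_funD.
  move=> h _; rewrite /A /B /F /G/= -!EFinD lee_fin -normrM.
  set i := \1_(_) h; have : i = 0 \/ i = 1.
    by rewrite /i indicE; case: (_ \in _); [right|left].
  case=> ->; first by rewrite !mul0r !add0r mulr_ge0.
  rewrite !mul1r (_ : _ + _ = (f (x + h) - f x) ^+ 2 + 2 * (f x * f (x + h))); last by ring.
  by rewrite lerD2l ler_pM2l// ler_norm.
rewrite [leLHS](_ : _ = \int[leb]_x \int[leb]_h F (x, h) + \int[leb]_x \int[leb]_h G (x, h))%E; last first.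
  rewrite -ge0_integralD//.
  - by apply: eq_integral => x _; rewrite ge0_integralD.
  - by move=> x _; exact: integral_ge0.
  - exact: (measurable_fun_fubini_tonelli_F F mF F0).
  - by move=> x _; exact: integral_ge0.
  - exact: (measurable_fun_fubini_tonelli_F G mG G0).
by rewrite IG; apply: leeD2r; apply: (cube_translation f1 a0).
Qed.

End cube_translation.

(** * Test functions and integration by parts *)

Section test_functions.
Context {R : realType} {n : nat}.
Local Notation leb := (lebesgue_rV n).
Implicit Types (f phi psi : 'rV[R]_n -> R) (D : set 'rV[R]_n).

Lemma supp_out f x : ~ supp f x -> f x = 0.
Proof.
move=> nfx; apply/eqP; apply: contrapT => /negP fx.
by apply: nfx; exact: subset_closure.
Qed.

Lemma supp_sub f (K : set 'rV[R]_n) : closed K ->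
  (forall x, ~ K x -> f x = 0) -> supp f `<=` K.
Proof.
move=> cK fK; rewrite /supp closureE => x; apply; split=> // y /eqP fy.
by apply: contrapT => /fK.
Qed.

Lemma partial_out f i x : ~ supp f x -> partial i f x = 0.
Proof.
move=> nfx; rewrite /partial.
have oS : open (~` supp f) by apply: closed_openC; exact: closed_closure.
rewrite (@near_eq_derive R _ _ f (cst 0)) ?derive_cst//.
have : nbhs x (~` supp f) by exact: open_nbhs_nbhs.
by apply: filterS => y /supp_out.
Qed.

Lemma test_fun_out D phi x : test_fun D phi -> ~ D x -> phi x = 0.
Proof. by move=> [_ _ sD] nDx; apply: supp_out => /sD. Qed.

Lemma test_fun_partial_out D phi i x : test_fun D phi -> ~ D x -> partial i phi x = 0.
Proof. by move=> [_ _ sD] nDx; apply: partial_out => /sD. Qed.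

Lemma test_fun_sub D D' phi : D `<=` D' -> test_fun D phi -> test_fun D' phi.
Proof. by move=> DD' [sphi cphi Dphi]; split => //; exact: subset_trans DD'. Qed.

(** Sums, differences and multiples are all put in this form: c = 1, c = -1, or psi = phi with c - 1
    for the multiple by c. *)
Lemma test_fun_linear D phi psi (c : R) : test_fun D phi -> test_fun D psi ->
  test_fun D (fun x => phi x + c * psi x).
Proof.
move=> [s1 c1 d1] [s2 c2 d2].
have sU : supp (fun x => phi x + c * psi x) `<=` supp phi `|` supp psi.
  apply: supp_sub; first by apply: closedU; exact: closed_closure.
  by move=> x /not_orP[/supp_out -> /supp_out ->]; rewrite mulr0 addr0.
split; first exact: smooth_linear.
- apply: (subclosed_compact _ _ sU); first exact: closed_closure.
  exact: compactU.
- by move=> x /sU[/d1|/d2].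
Qed.

Lemma sqint_compact_supp D f (K : set 'rV[R]_n) : measurable D -> (leb D < +oo)%E ->
  continuous f -> compact K -> K `<=` D -> (forall x, ~ K x -> f x = 0) ->
  sqint leb setT f.
Proof.
move=> mD Doo cf cK KD fK.
have mf : measurable_fun setT f by exact: measurable_rV_continuous.
have [M fM] : exists M, forall x, `|f x| <= M.
  have [K0|/set0P K0] := eqVneq K set0.
    by exists 0 => x; rewrite fK ?normr0// K0.
  have [|c Kc cM] := @compact_EVT_max _ R (fun x => `|f x|) K K0 cK.
    apply: continuous_subspaceT => x.
    by apply: continuous_comp; [exact: cf|exact: norm_continuous].
  exists `|f c| => x; have [Kx|Kx] := pselect (K x); last by rewrite fK// normr0.
  by apply: cM; exact: mem_set.
apply: (@sqint_le _ _ _ _ _ measurableT _ (fun x => M * \1_D x)) => //.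
- move=> x _; rewrite exprMn; have [Dx|Dx] := pselect (D x).
    rewrite indicE mem_set// expr1n mulr1 -(real_normK (num_real (f x))).
    by rewrite lerXn2r ?nnegrE ?(le_trans _ (fM x)).
  rewrite fK; last by move=> /KD.
  by rewrite expr0n/= mulr_ge0// sqr_ge0.
apply: sqintZ => //; split; first exact: measurable_indic.
rewrite (_ : (fun x => _) = (fun x => (\1_D x)%:E)).
  by rewrite integral_indic// setIT.
by apply/funext => x; rewrite indicE; case: (_ \in _); rewrite ?expr1n ?expr0n.
Qed.

Lemma test_fun_sqint D phi : measurable D -> (leb D < +oo)%E ->
  test_fun D phi -> sqint leb setT phi.
Proof.
move=> mD Doo [sphi cphi dphi].
apply: (sqint_compact_supp mD Doo _ cphi dphi); last exact: supp_out.
exact/C1_continuous/smooth_C1.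
Qed.

Lemma test_fun_sqint_partial D phi i : measurable D -> (leb D < +oo)%E ->
  test_fun D phi -> sqint leb setT (partial i phi).
Proof.
move=> mD Doo [sphi cphi dphi].
apply: (sqint_compact_supp mD Doo _ cphi dphi).
  by have [_] := smooth_C1 sphi; exact.
by move=> x; exact: partial_out.
Qed.

Lemma ip_setT D f g : (forall x, ~ D x -> f x * g x = 0) ->
  ip leb D f g = ip leb setT f g.
Proof.
move=> fg; rewrite /ip Rintegral_mkcond; apply: eq_Rintegral => x _.
by rewrite patchE; case: ifPn => // /negP xD; rewrite fg// => Dx; apply: xD; exact: mem_set.
Qed.

Lemma sqint_setT D f : measurable D -> sqint leb setT f -> sqint leb D f.
Proof.
move=> mD [mf foo]; split; first exact: measurable_funTS.
apply: le_lt_trans foo; apply: ge0_subset_integral => //.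
  by apply/measurable_EFinP; exact: measurable_funX.
by move=> x _; rewrite lee_fin sqr_ge0.
Qed.

(* Over the whole space, so as not to depend on the domain of the test functions. *)
Definition sqn phi : R := ip leb setT phi phi.
Definition dir phi psi : R := \sum_i ip leb setT (partial i phi) (partial i psi).

Lemma integral_shift f (h : 'rV[R]_n) : measurable_fun setT f ->
  (\int[leb]_x (f (x + h))%:E = \int[leb]_x (f x)%:E)%E.
Proof.
move=> mf; rewrite integralE [RHS]integralE; congr (_ - _)%E.
  rewrite -[RHS](ge0_integral_rV_shift h)//.
    by apply: eq_integral => x _; rewrite !funeposE.
  by apply: measurable_funepos; exact/measurable_EFinP.
rewrite -[RHS](ge0_integral_rV_shift h)//.
  by apply: eq_integral => x _; rewrite !funenegE.
by apply: measurable_funeneg; exact/measurable_EFinP.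
Qed.

(** The integral of f (x + e) - f x is 0 by translation invariance. It is also the integral over t
    in [0, 1] and x of the derivative at x + t e, which by Fubini and invariance again is the
    integral of the partial derivative. *)
Lemma integral_partial0 f i : C1 f ->
  leb.-integrable setT (EFin \o f) -> leb.-integrable setT (EFin \o partial i f) ->
  \int[leb]_x partial i f x = 0.
Proof.
move=> f1 intf intd.
have mf := measurable_C1 f1; have md := measurable_partial i f1.
pose e : 'rV[R]_n := delta_mx ord0 i.
have dE x : dgrad f e x = partial i f x.
  rewrite /dgrad (bigD1 i)//= mxE !eqxx mul1r big1 ?addr0// => j ji.
  by rewrite mxE (negbTE ji) andbF mul0r.
pose I01 : set (measurableTypeR R) := `[0%R, 1%R]%classic.
have mI01 : measurable I01 by exact: measurable_itv.
pose F (p : measurableTypeR R * 'rV[R]_n) : \bar R :=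
  (\1_I01 p.1 * partial i f (p.2 + p.1 *: e))%:E.
have mF : measurable_fun setT F.
  apply/measurable_EFinP; apply: measurable_funM.
    have m1 : measurable_fun setT (\1_I01 : measurableTypeR R -> R).
      by apply: measurable_indic; exact: measurable_itv.
    exact: (measurableT_comp m1 measurable_fst).
  by apply: (measurableT_comp md); exact: measurable_line.
have mu01 : @lebesgue_measure R I01 = 1%E.
  by rewrite /I01 lebesgue_measure_itv/= lte_fin ltr01 sube0.
have shiftE t : (\int[leb]_x (partial i f (x + t *: e))%:E = \int[leb]_x (partial i f x)%:E)%E.
  by rewrite (integral_shift _ md).
have absshiftE t : (\int[leb]_x `|partial i f (x + t *: e)|%:E = \int[leb]_x `|partial i f x|%:E)%E.
  by rewrite (integral_shift (f := fun x => `|partial i f x|)) //; exact: measurableT_comp.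
have intF : ((@lebesgue_measure R) \x leb)%E.-integrable setT F.
  apply/(integrable12ltyP _ _ mF); rewrite /F/=.
  have -> : (\int[@lebesgue_measure R]_t \int[leb]_y `|\1_I01 t * partial i f (y + t *: e)|%:E
      = \int[@lebesgue_measure R]_(t in I01) \int[leb]_y `|partial i f y|%:E)%E.
    rewrite [RHS]integral_mkcond; apply: eq_integral => t _.
    rewrite patchE indicE; case: ifPn => _.
      by rewrite -(absshiftE t); apply: eq_integral => y _; rewrite mul1r.
    by under eq_integral do rewrite mul0r normr0; rewrite integral0.
  rewrite (integral_cst _ mI01) [X in (_ * X)%E](_ : _ = 1%E); last exact: mu01.
  by rewrite mule1; have /integrableP[] := intd.
have E1 : (\int[@lebesgue_measure R]_t \int[leb]_y F (t, y) = \int[leb]_y (partial i f y)%:E)%E.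
  transitivity (\int[@lebesgue_measure R]_(t in I01) \int[leb]_y (partial i f y)%:E)%E.
    rewrite [RHS]integral_mkcond; apply: eq_integral => t _.
    rewrite patchE /F/= indicE; case: ifPn => _.
      by rewrite -(shiftE t); apply: eq_integral => y _; rewrite mul1r.
    by under eq_integral do rewrite mul0r; rewrite integral0.
  rewrite (integral_cst _ mI01) [X in (_ * X)%E](_ : _ = 1%E); last exact: mu01.
  exact: mule1.
have E2 : (\int[leb]_x \int[@lebesgue_measure R]_t F (t, x) = \int[leb]_x (f (x + e) - f x)%:E)%E.
  apply: eq_integral => x _; rewrite -integral_line// [RHS]integral_mkcond.
  apply: eq_integral => t _; rewrite patchE /F/= indicE dE.
  by case: ifPn => _; rewrite ?mul1r ?mul0r.
have E := etrans (esym E1) (etrans (Fubini intF) E2).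
rewrite /Rintegral E.
have intfe : leb.-integrable setT (EFin \o (fun x => f (x + e))).
  apply/integrableP; split.
    apply/measurable_EFinP; apply: (measurableT_comp mf).
    by apply: measurable_rVD => //.
  have /integrableP[_] := intf; rewrite /=.
  rewrite (integral_shift (f := fun x => `|f x|)) //; exact: measurableT_comp.
rewrite integralB_EFin// integral_shift// subee//.
exact: integrable_fin_num.
Qed.

Lemma ip_partial f g i : C1 f -> C1 g ->
  sqint leb setT f -> sqint leb setT g ->
  sqint leb setT (partial i f) -> sqint leb setT (partial i g) ->
  ip leb setT f (partial i g) = - ip leb setT g (partial i f).
Proof.
move=> f1 g1 sf sg spf spg.
have [[df _] [dg _]] := (f1, g1).
have := @integral_partial0 (fun x => f x * g x) i (C1M f1 g1).
have i1 := sqint_integrable measurableT sf spg.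
have i2 := sqint_integrable measurableT sg spf.
rewrite partialM// => H.
have : \int[leb]_x (f x * partial i g x + g x * partial i f x) = 0.
  apply: H; first exact: sqint_integrable.
  exact: (integrableD measurableT i1 i2).
rewrite RintegralD// => /eqP.
by rewrite addr_eq0 => /eqP.
Qed.

Lemma test_fun_C1 D phi : test_fun D phi -> C1 phi.
Proof. by move=> [s _ _]; exact: smooth_C1. Qed.

End test_functions.

(** * Faber-Krahn and compactness estimates for test functions *)

Lemma int_shiftK (K : nat) (z : int) : - K%:Z <= z < K%:Z ->
  (absz (z + K%:Z)%R < K.*2)%N /\ (absz (z + K%:Z)%R)%:Z - K%:Z = z.
Proof. by rewrite -addnn => /andP[? ?]; split; lia. Qed.

Lemma int_succ_bound (K : nat) (k : int) : - K%:Z < k + 1 -> k + 1 <= K%:Z ->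
  - K%:Z <= k < K%:Z.
Proof. by move=> ? ?; apply/andP; split; lia. Qed.

Section test_estimates.
Context {R : realType} {n : nat}.
Local Notation leb := (lebesgue_rV n).
Variables (D : set 'rV[R]_n) (mD : measurable D) (Doo : (leb D < +oo)%E).
Implicit Types (phi psi : 'rV[R]_n -> R).

Lemma lebesgue_vol : (leb D = (vol D)%:E)%E.
Proof. by rewrite /vol fineK// ge0_fin_numE. Qed.

Lemma vol_ge0 : 0 <= vol D.
Proof. by rewrite /vol fine_ge0. Qed.

Lemma sqn_ge0 phi : 0 <= sqn phi.
Proof. exact: ip_ge0. Qed.

Lemma dir_ge0 phi : 0 <= dir phi phi.
Proof. by apply: sumr_ge0 => i _; exact: ip_ge0. Qed.

Lemma integral_sqr_test phi : test_fun D phi ->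
  (\int[leb]_x (phi x ^+ 2)%:E = (sqn phi)%:E)%E.
Proof. by move=> tphi; rewrite -ip_sqrE//; exact: test_fun_sqint tphi. Qed.

Lemma integral_grad_test phi : test_fun D phi ->
  (\int[leb]_x (\sum_i partial i phi x ^+ 2)%:E = (dir phi phi)%:E)%E.
Proof.
move=> tphi; under eq_integral do rewrite -sumEFin.
rewrite ge0_integral_sum//.
- rewrite /dir -sumEFin; apply: eq_bigr => i _.
  by rewrite ip_sqrE//; exact: test_fun_sqint_partial tphi.
- move=> i; apply/measurable_EFinP; apply: measurable_funX.
  by apply: measurable_partial; exact: test_fun_C1 tphi.
- by move=> i x _; rewrite lee_fin sqr_ge0.
Qed.

Lemma sqint_indic (B : set 'rV[R]_n) : measurable B -> (leb B < +oo)%E ->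
  sqint leb setT (\1_B : 'rV[R]_n -> R).
Proof.
move=> mB Boo; split; first exact: measurable_indic.
rewrite (_ : (fun x => _) = (fun x => (\1_B x)%:E)).
  by rewrite integral_indic// setIT.
by apply/funext => x; rewrite indicE; case: (_ \in _); rewrite ?expr1n ?expr0n.
Qed.

Lemma sqn_indic (B : set 'rV[R]_n) : measurable B -> (leb B < +oo)%E ->
  sqn (\1_B : 'rV[R]_n -> R) = fine (leb B).
Proof.
move=> mB Boo; rewrite /sqn /ip /Rintegral; congr fine.
rewrite -[X in leb X]setIT -integral_indic//; apply: eq_integral => x _.
by rewrite indicE; case: (_ \in _); rewrite ?mulr1 ?mulr0.
Qed.

Lemma test_mean_le phi (B : set 'rV[R]_n) : test_fun D phi -> measurable B ->
  `|\int[leb]_(x in B) phi x| <=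
  Num.sqrt (sqn phi) * Num.sqrt (fine (leb (B `&` D))).
Proof.
move=> tphi mB.
have mBD : measurable (B `&` D) by exact: measurableI.
have BDoo : (leb (B `&` D) < +oo)%E.
  by apply: le_lt_trans Doo; apply: le_measure; rewrite ?inE.
have -> : \int[leb]_(x in B) phi x = ip leb setT phi (\1_(B `&` D)).
  rewrite Rintegral_mkcond; apply: eq_Rintegral => x _.
  rewrite patchE indicE in_setI; case: ifPn => xB; last by rewrite mulr0.
  have [xD|xD] := boolP (x \in D); first by rewrite mulr1.
  rewrite mulr0; apply: (test_fun_out tphi) => Dx.
  by move: xD; rewrite mem_set.
rewrite -sqn_indic//; apply: cauchy_schwarz_abs => //.
  exact: test_fun_sqint tphi.
exact: sqint_indic.
Qed.

Lemma sqint_abs phi : sqint leb setT phi -> sqint leb setT (fun x => `|phi x|).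
Proof.
move=> [mphi phioo]; split; first exact: measurableT_comp.
by under eq_integral do rewrite (real_normK (num_real _)).
Qed.

Lemma sqn_abs phi : sqn (fun x => `|phi x|) = sqn phi.
Proof.
by apply: eq_Rintegral => x _; rewrite -!expr2 (real_normK (num_real _)).
Qed.

Lemma test_L1_le phi : test_fun D phi ->
  exists2 A : R, (\int[leb]_x `|phi x|%:E = A%:E)%E &
    0 <= A /\ A ^+ 2 <= vol D * sqn phi.
Proof.
move=> tphi; have sphi := test_fun_sqint mD Doo tphi.
have s1 := sqint_indic mD Doo.
exists (ip leb setT (fun x => `|phi x|) (\1_D)).
  rewrite /ip /Rintegral fineK; last first.
    apply: integrable_fin_num => //.
    by apply: sqint_integrable => //; exact: sqint_abs.
  apply: eq_integral => x _; rewrite indicE.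
  have [xD|xD] := boolP (x \in D); first by rewrite mulr1.
  rewrite mulr0 (test_fun_out tphi) ?normr0// => Dx.
  by move: xD; rewrite mem_set.
split; first by apply: Rintegral_ge0 => x _; rewrite mulr_ge0.
have := cauchy_schwarz measurableT (sqint_abs sphi) s1.
by rewrite -!/(sqn _) sqn_abs sqn_indic// mulrC.
Qed.

(** [cube_translation_norm] divided by 2, where Cauchy-Schwarz on D bounds the squared L^1 norm by
    the volume times the squared L^2 norm. *)
Lemma faber_krahn_test phi (a : R) : test_fun D phi -> 0 < a ->
  (2 * a) ^+ n * (sqn phi - a ^+ 2 / 6 * dir phi phi) <= vol D * sqn phi.
Proof.
move=> tphi a0; have phi1 := test_fun_C1 tphi.
have [A AE [A0 AD]] := test_L1_le tphi.
have := cube_translation_norm phi1 a0.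
rewrite (integral_sqr_test tphi) (integral_grad_test tphi) AE.
rewrite -!EFinM -EFinD lee_fin => H.
have : (2 * a) ^+ n * (2 * (sqn phi - a ^+ 2 / 6 * dir phi phi)) <= 2 * A ^+ 2.
  move: H; set c := (2 * a) ^+ n => H.
  rewrite (_ : c * _ = 2 * c * sqn phi - c * (a ^+ 2 / 3) * dir phi phi); last by field.
  by lra.
rewrite mulrCA ler_pM2l// => /le_trans; exact.
Qed.

Definition cell (s : R) (z : 'I_n -> int) : set 'rV[R]_n :=
  [set y | forall i, Num.floor (y ord0 i / s) = z i].

Let slab (s : R) (k : int) : 0 < s ->
  [set r : R | Num.floor (r / s) = k] = `[k%:~R * s, (k%:~R + 1) * s[%classic.
Proof.
move=> s0; apply/seteqP; split => r /=; rewrite in_itv/= -ler_pdivlMr// -ltr_pdivrMr//.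
  by move=> <-; rewrite -[1]/(1%:~R) -intrD ge_floor floorD1_gt.
by move=> H; apply: floor_def; rewrite intrD.
Qed.

Lemma measurable_cell s z : 0 < s -> measurable (cell s z).
Proof.
move=> s0; apply: (@measurable_box R n (fun i => [set r : R | Num.floor (r / s) = z i])).
by move=> i; rewrite slab.
Qed.

Lemma lebesgue_cell s z : 0 < s -> leb (cell s z) = (s ^+ n)%:E.
Proof.
move=> s0; apply: (@lebesgue_rV_box R n (fun i => [set r : R | Num.floor (r / s) = z i])).
  by move=> i; rewrite slab.
move=> i; rewrite slab// lebesgue_measure_itv/= lte_fin ltr_pM2r// ltrDl ltr01.
by rewrite -EFinB; congr EFin; ring.
Qed.

Lemma cell_cube s (x y : 'rV[R]_n) : 0 < s ->
  cell s (fun i => Num.floor (x ord0 i / s)) y -> cube n s (y - x).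
Proof.
move=> s0 H i; rewrite !mxE; have := H i.
have /andP[] := floor_itv (x ord0 i / s); have /andP[] := floor_itv (y ord0 i / s).
move=> y1 y2 x1 x2 E; rewrite E in y1 y2.
move: x1 x2 y1 y2; rewrite ler_pdivlMr// ltr_pdivrMr// ler_pdivlMr// ltr_pdivrMr//.
rewrite intrD mulrDl mul1r => x1 x2 y1 y2.
by rewrite ler_norml; apply/andP; split; lra.
Qed.

(** A Poincare inequality on a grid. For x in the cell Q, expand the integral of (phi y - phi x)^2
    over y in Q, drop the integral of phi^2, and bound the mean by b. Since Q - x lies in
    [cube n s], integrating over x leads back to [cube_translation]. *)
Lemma grid_estimate phi (s b : R) : test_fun D phi -> 0 < s ->
  (forall z, `|\int[leb]_(y in cell s z) phi y| <= b) ->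
  s ^+ n * sqn phi <= (2 * s) ^+ n * (s ^+ 2 / 3) * dir phi phi +
    2 * b * Num.sqrt (vol D * sqn phi).
Proof.
move=> tphi s0 phib; have phi1 := test_fun_C1 tphi.
have mphi := measurable_C1 phi1.
have sphi := test_fun_sqint mD Doo tphi.
have [A AE [A0 AD]] := test_L1_le tphi.
have b0 : 0 <= b by apply: le_trans (phib (fun=> 0)).
have sn0 : 0 <= s ^+ n by rewrite exprn_ge0// ltW.
have AS : A <= Num.sqrt (vol D * sqn phi).
  by rewrite -(ger0_norm A0) -sqrtr_sqr ler_wsqrtr.
suff : s ^+ n * sqn phi <= (2 * s) ^+ n * (s ^+ 2 / 3) * dir phi phi + 2 * b * A.
  move/le_trans; apply; rewrite lerD2l; apply: ler_wpM2l => //.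
  by rewrite mulr_ge0.
suff : ((s ^+ n)%:E * \int[leb]_x (phi x ^+ 2)%:E <=
    ((2 * s) ^+ n * (s ^+ 2 / 3))%:E * \int[leb]_x (\sum_i partial i phi x ^+ 2)%:E +
    (2 * b)%:E * \int[leb]_x `|phi x|%:E)%E.
  rewrite (integral_grad_test tphi) (integral_sqr_test tphi) AE.
  by rewrite -!EFinM -EFinD lee_fin.
pose C (x : 'rV[R]_n) : \bar R :=
  (\int[leb]_h (\1_(cube n s) h * (phi (x + h) - phi x) ^+ 2)%:E)%E.
have mC : measurable_fun setT C.
  pose F (p : 'rV[R]_n * 'rV[R]_n) := (\1_(cube n s) p.2 * (phi (p.1 + p.2) - phi p.1) ^+ 2)%:E.
  have mF : measurable_fun setT F.
    apply/measurable_EFinP; apply: measurable_funM.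
      have m1 : measurable_fun setT (\1_(cube n s) : 'rV[R]_n -> R).
        by apply: measurable_indic; exact: measurable_cube.
      exact: (measurableT_comp m1 measurable_snd).
    apply: measurable_funX; apply: measurable_funB.
      apply: (measurableT_comp mphi).
      by apply: measurable_rVD; [exact: measurable_fst|exact: measurable_snd].
    exact: (measurableT_comp mphi measurable_fst).
  have F0 p : (0 <= F p)%E by rewrite lee_fin mulr_ge0// sqr_ge0.
  exact: (measurable_fun_fubini_tonelli_F F mF F0).
have C0 x : (0 <= C x)%E.
  by apply: integral_ge0 => h _; rewrite lee_fin mulr_ge0// sqr_ge0.
apply: (@le_trans _ _ (\int[leb]_x (C x + (2 * b)%:E * `|phi x|%:E))%E); last first.
  have mnE : measurable_fun setT (fun x : 'rV[R]_n => `|phi x|%:E).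
    by apply/measurable_EFinP; exact: measurableT_comp.
  rewrite ge0_integralD//; last 2 first.
  - by move=> x _; rewrite mule_ge0// lee_fin// mulr_ge0.
  - by apply: measurable_funeM.
  rewrite ge0_integralZl_EFin//; last by rewrite mulr_ge0.
  by apply: leeD2r; exact: (cube_translation phi1 s0).
rewrite -ge0_integralZl_EFin//; last 2 first.
- by move=> x _; rewrite lee_fin sqr_ge0.
- by apply/measurable_EFinP; exact: measurable_funX.
apply: ge0_le_integral => //.
- by move=> x _; rewrite mule_ge0// lee_fin// sqr_ge0.
- by apply: measurable_funeM; apply/measurable_EFinP; exact: measurable_funX.
- apply: emeasurable_funD => //; apply: measurable_funeM.
  by apply/measurable_EFinP; exact: measurableT_comp.
move=> x _.
pose Q := cell s (fun i => Num.floor (x ord0 i / s)).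
have mQ : measurable Q by exact: measurable_cell.
have lQ : leb Q = (s ^+ n)%:E by exact: lebesgue_cell.
have Qoo : (leb Q < +oo)%E by rewrite lQ ltry.
have sQ : sqint leb Q phi by exact: sqint_setT.
have s1 : sqint leb Q (cst (phi x)).
  exact: (@sqint_bounded _ _ _ _ _ _ _ `|phi x|).
apply: (@le_trans _ _ (\int[leb]_(y in Q) ((phi y - phi x) ^+ 2)%:E + (2 * b * `|phi x|)%:E)%E).
  have sB := sqintB mQ sQ s1.
  rewrite (ip_sqrE mQ sB) -EFinM -EFinD lee_fin.
  have -> : ip leb Q (fun y => phi y - phi x) (fun y => phi y - phi x) =
      ip leb Q phi phi - 2 * phi x * (\int[leb]_(y in Q) phi y) + s ^+ n * phi x ^+ 2.
    rewrite (ip_sqrB mQ sQ s1); congr (_ - _ + _).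
      rewrite -mulrA; congr (2 * _); rewrite /ip -RintegralZl//; last first.
        have s11 : sqint leb Q (cst 1).
          by apply: (@sqint_bounded _ _ _ _ _ _ _ 1) => // y _; rewrite normr1.
        have := sqint_integrable mQ sQ s11.
        by apply: eq_integrable => // y _; rewrite /= mulr1.
      by apply: eq_Rintegral => y _; rewrite mulrC.
    transitivity (\int[leb]_(y in Q) (phi x ^+ 2)); first exact: eq_Rintegral.
    rewrite Rintegral_cst// mulrC; congr (_ * _).
    exact: (congr1 fine lQ).
  have q0 := ip_ge0 leb Q phi.
  have : 2 * phi x * (\int[leb]_(y in Q) phi y) <= 2 * b * `|phi x|.
    rewrite (le_trans (ler_norm _))// !normrM (ger0_norm (_ : 0 <= 2))//.
    rewrite -!mulrA; apply: ler_wpM2l => //; rewrite mulrC.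
    by apply: ler_wpM2r => //; exact: phib.
  set I := \int[leb]_(y in Q) _; set J := ip _ _ _ _ in q0 *.
  by move=> ?; lra.
rewrite EFinM; apply: leeD2r.
pose F1 (y : 'rV[R]_n) := (\1_Q y * (phi y - phi x) ^+ 2)%:E.
have mF1 : measurable_fun setT F1.
  apply/measurable_EFinP; apply: measurable_funM; first exact: measurable_indic.
  by apply: measurable_funX; apply: measurable_funB => //; exact: measurable_cst.
have F10 y : (0 <= F1 y)%E by rewrite lee_fin mulr_ge0// sqr_ge0.
have -> : (\int[leb]_(y in Q) ((phi y - phi x) ^+ 2)%:E = \int[leb]_y F1 y)%E.
  rewrite integral_mkcond; apply: eq_integral => y _.
  by rewrite patchE /F1 indicE; case: ifPn; rewrite ?mul1r ?mul0r.
rewrite -(ge0_integral_rV_shift x mF1 F10); apply: ge0_le_integral => //.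
- by apply: (measurableT_comp mF1); apply: measurable_rVD => //.
- apply/measurable_EFinP; apply: measurable_funM.
    by apply: measurable_indic; exact: measurable_cube.
  apply: measurable_funX; apply: measurable_funB; last exact: measurable_cst.
  by apply: (measurableT_comp mphi); apply: measurable_rVD => //.
move=> h _; rewrite /F1 lee_fin (addrC h); apply: ler_wpM2r; first exact: sqr_ge0.
rewrite !indicE; have [/set_mem Qh|//] := boolP (x + h \in Q).
by rewrite mem_set// -[h](addKr x) addrC; exact: cell_cube.
Qed.

(* This replaces the compactness of the embedding of H^1_0(D) in L^2(D). *)
Lemma finitely_many_means (M e : R) : 0 <= M -> 0 < e ->
  exists (s : R) (K : nat) (b : R), [/\ 0 < s, 0 < b &
    forall phi, test_fun D phi -> sqn phi <= M -> dir phi phi <= M ->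
      (forall z : {ffun 'I_n -> 'I_K.*2},
        `|\int[leb]_(y in cell s (fun i => (z i)%:Z - K%:Z)) phi y| <= b) ->
      sqn phi <= e].
Proof.
move=> M0 e0.
have [s s0 sM] : exists2 s : R, 0 < s & 2 ^+ n * (s ^+ 2 / 3) * M <= e / 2.
  (* The gradient term gets one half of e. The minimum with 1 gives s^2 <= s, so a bound linear in s
     suffices, and M + 1 keeps the denominator positive. *)
  exists (Num.min 1 (e / 2 / (2 ^+ n * (M + 1)))).
    by rewrite lt_min ltr01/= divr_gt0 ?mulr_gt0 ?exprn_gt0// ?divr_gt0// ltr_wpDl.
  set s := Num.min _ _.
  have s0 : 0 < s.
    by rewrite lt_min ltr01/= divr_gt0 ?mulr_gt0 ?exprn_gt0// ?divr_gt0// ltr_wpDl.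
  have s1 : s <= 1 by rewrite ge_min lexx.
  have s2 : s <= e / 2 / (2 ^+ n * (M + 1)) by rewrite ge_min lexx orbT.
  have cp : 0 < 2 ^+ n * (M + 1) :> R by rewrite mulr_gt0 ?exprn_gt0// ltr_wpDl.
  rewrite ler_pdivlMr// in s2; apply: le_trans s2.
  have c0 : 0 <= 2 ^+ n :> R by rewrite exprn_ge0.
  rewrite (_ : _ * M = 2 ^+ n * (s ^+ 2 / 3 * M)); last by ring.
  rewrite (_ : s * _ = 2 ^+ n * (s * (M + 1))); last by ring.
  apply: ler_wpM2l => //.
  have : s ^+ 2 <= s by rewrite expr2 ger_pMl.
  have : 0 <= s ^+ 2 by rewrite sqr_ge0.
  set t := s ^+ 2 => t0 ts.
  have : t * M <= s * M by apply: ler_wpM2r.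
  have : 0 <= t * M by rewrite mulr_ge0.
  lra.
have sn0 : 0 < s ^+ n by rewrite exprn_gt0.
pose W := Num.sqrt (vol D * M).
have W0 : 0 <= W by rewrite sqrtr_ge0.
have [b b0 bW] : exists2 b : R, 0 < b & 2 * b * W <= s ^+ n * (e / 2).
  exists (s ^+ n * (e / 2) / (2 * (W + 1))).
    by rewrite divr_gt0 ?mulr_gt0 ?divr_gt0// ltr_wpDl.
  rewrite (_ : 2 * _ * W = s ^+ n * (e / 2) * (W / (W + 1))); last first.
    by field; rewrite gt_eqF// ltr_wpDl.
  rewrite ger_pMr ?mulr_gt0 ?divr_gt0// ler_pdivrMr ?ltr_wpDl// mul1r.
  by rewrite lerDl.
(* The part of D outside a large cube has small measure, so cells meeting D only there have small
   means by [test_mean_le]. With radius (K - 1) s, a cell with an index outside [-K, K) does not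
   meet the cube. *)
pose B (K : nat) : set 'rV[R]_n := D `&`
  ~` cube n (K%:R * s - s).
have mB K : measurable (B K).
  by apply: measurableI => //; apply: measurableC; exact: measurable_cube.
have B0 : \bigcap_K B K = set0.
  apply/seteqP; split => // x Bx.
  have [K Kx] : exists K : nat, forall i, `|x ord0 i| <= K%:R * s - s.
    pose N := \sum_j `|x ord0 j|.
    (* One successor to exceed N / s, a second because the radius is (K - 1) s. *)
    exists (Num.truncn (N / s)).+2 => i.
    have := Num.Theory.truncnS_gt (N / s); set k := Num.truncn _ => kx.
    have : `|x ord0 i| <= N by rewrite /N (bigD1 i)//= lerDl sumr_ge0.
    move/le_trans; apply; move: kx; rewrite ltr_pdivrMr// => /ltW/le_trans; apply.
    by rewrite -(natr1 k.+1) mulrDl mul1r addrK.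
  by have [_] := Bx K I; apply.
have [K BK] : exists K, (leb (B K) <= (b ^+ 2 / (M + 1))%:E)%E.
  have := @nonincreasing_cvg_mu _ _ _ leb B.
  rewrite B0 measure0 => H.
  have {}H : leb (B k) @[k --> \oo] --> 0%E.
    apply: H => //.
    - by apply: le_lt_trans Doo; apply: le_measure; rewrite ?inE//; exact: subIsetl.
    - move=> k l kl; apply/subsetPset => x [Dx nx]; split=> // xk; apply: nx => i.
      apply: (le_trans (xk i)); apply: lerB => //.
      by apply: ler_wpM2r; [exact: ltW|rewrite ler_nat].
  have c0 : 0 < b ^+ 2 / (M + 1) by rewrite divr_gt0 ?exprn_gt0// ltr_wpDl.
  have : nbhs 0%E [set y : \bar R | (y < (b ^+ 2 / (M + 1))%:E)%E].
    apply: open_nbhs_nbhs; split; first exact: open_ereal_lt_ereal.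
    by rewrite /= lte_fin.
  by move=> /H[K _ /(_ K (leqnn K))/= BK]; exists K; exact: ltW.
exists s, K, b; split => // phi tphi phiM dphiM phiz.
have phi0 := sqn_ge0 phi.
have means z : `|\int[leb]_(y in cell s z) phi y| <= b.
  (* Cells with all indices in [-K, K) are the finitely many coded by ['I_K.*2] after a shift by K;
     every other cell meets D only inside [B K]. *)
  have [zK|zK] := pselect (forall i, - K%:Z <= z i < K%:Z).
    have zlt i : (absz (z i + K%:Z)%R < K.*2)%N.
      by have [] := int_shiftK (zK i).
    have := phiz [ffun i => Ordinal (zlt i)].
    rewrite (_ : (fun i => _) = z)//; apply/funext => i; rewrite ffunE/=.
    by have [] := int_shiftK (zK i).
  have zB : cell s z `&` D `<=` B K.
    move=> y [yz Dy]; split=> // yK; apply: zK => i.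
    have := yK i; have := yz i => <-.
    have /andP[] := floor_itv (y ord0 i / s); set k := Num.floor _.
    rewrite ler_pdivlMr// ltr_pdivrMr// ler_norml => y1 y2 /andP[y3 y4].
    have k1 : (- K%:Z)%:~R < (k + 1)%:~R :> R.
      rewrite -(ltr_pM2r s0) (le_lt_trans _ y2)// (le_trans _ y3)//.
      by rewrite opprB rmorphN/= mulNr lerDr ltW.
    have k2 : (k + 1)%:~R <= K%:~R :> R.
      rewrite -(ler_pM2r s0) intrD mulrDl mul1r.
      have : K%:R * s = K%:~R * s by rewrite pmulrn.
      lra.
    by rewrite ltr_int in k1; rewrite ler_int in k2; exact: int_succ_bound.
  have mc := measurable_cell z s0.
  rewrite (le_trans (test_mean_le tphi mc))//.
  apply: (@le_trans _ _ (Num.sqrt M * Num.sqrt (b ^+ 2 / (M + 1)))).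
    apply: ler_pM; rewrite ?sqrtr_ge0//; first exact: ler_wsqrtr.
    apply: ler_wsqrtr; rewrite -lee_fin fineK; last first.
      rewrite ge0_fin_numE//; apply: le_lt_trans Doo.
      by apply: le_measure; rewrite ?inE//; exact: measurableI.
    apply: le_trans BK; apply: le_measure; rewrite ?inE//.
    exact: measurableI.
  rewrite -sqrtrM// -[leRHS](ger0_norm (ltW b0)) -sqrtr_sqr ler_wsqrtr//.
  rewrite mulrA ler_pdivrMr ?ltr_wpDl// mulrDr mulr1 mulrC lerDl sqr_ge0//.
have := grid_estimate tphi s0 means.
have H1 : (2 * s) ^+ n * (s ^+ 2 / 3) * dir phi phi <= s ^+ n * (e / 2).
  rewrite exprMn (_ : _ * _ * _ = s ^+ n * (2 ^+ n * (s ^+ 2 / 3) * dir phi phi)); last by ring.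
  rewrite ler_pM2l//; apply: le_trans sM; apply: ler_wpM2l => //.
  by rewrite mulr_ge0 ?exprn_ge0// divr_ge0// sqr_ge0.
have H2 : 2 * b * Num.sqrt (vol D * sqn phi) <= s ^+ n * (e / 2).
  apply: le_trans bW; apply: ler_wpM2l; first by rewrite mulr_ge0// ltW.
  by apply: ler_wsqrtr; apply: ler_wpM2l => //; exact: vol_ge0.
move=> /le_trans/(_ (lerD H1 H2)).
by rewrite -mulrDr -splitr ler_pM2l.
Qed.

End test_estimates.

(** * Approximation of eigenfunctions by test functions *)

Section H10_functions.
Context {R : realType} {n : nat}.
Local Notation leb := (lebesgue_rV n).
Variables (D : set 'rV[R]_n) (mD : measurable D) (Doo : (leb D < +oo)%E).
Implicit Types (phi psi u : 'rV[R]_n -> R) (g : 'I_n -> 'rV[R]_n -> R).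

Let ipD := ip leb D.

Lemma test_sqint phi : test_fun D phi -> sqint leb D phi.
Proof. by move=> t; apply: sqint_setT => //; exact: test_fun_sqint t. Qed.

Lemma test_sqint_partial phi i : test_fun D phi -> sqint leb D (partial i phi).
Proof. by move=> t; apply: sqint_setT => //; exact: test_fun_sqint_partial t. Qed.

Lemma ip_test u phi : test_fun D phi -> ip leb setT u phi = ipD u phi.
Proof.
by move=> t; apply/esym/ip_setT => x Dx; rewrite (test_fun_out t Dx) mulr0.
Qed.

Lemma ip_test_partial u phi i : test_fun D phi ->
  ip leb setT u (partial i phi) = ipD u (partial i phi).
Proof.
by move=> t; apply/esym/ip_setT => x Dx; rewrite (test_fun_partial_out i t Dx) mulr0.
Qed.

Lemma Rintegral_sum (F G : 'I_n -> 'rV[R]_n -> R) :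
  (forall i, sqint leb D (F i)) -> (forall i, sqint leb D (G i)) ->
  \int[leb]_(x in D) (\sum_i F i x * G i x) = \sum_i ipD (F i) (G i).
Proof.
move=> sF sG.
have H (r : seq 'I_n) :
    leb.-integrable D (EFin \o (fun x => \sum_(i <- r) F i x * G i x)) /\
    \int[leb]_(x in D) (\sum_(i <- r) F i x * G i x) = \sum_(i <- r) ipD (F i) (G i).
  elim: r => [|i r [IH1 IH2]].
    split.
      rewrite (_ : EFin \o _ = cst 0%E); first exact: integrable0.
      by apply/funext => x; rewrite /= big_nil.
    by rewrite big_nil; under eq_Rintegral do rewrite big_nil; rewrite Rintegral_cst// mul0r.
  have i1 := sqint_integrable mD (sF i) (sG i).
  split.
    have := integrableD mD i1 IH1; apply: eq_integrable => // x _.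
    by rewrite /= big_cons EFinD.
  rewrite big_cons -IH2 -RintegralD//.
  by under eq_Rintegral do rewrite big_cons.
exact: (H _).2.
Qed.

Lemma H10_approx u g : H10 D u g -> exists phi : (('rV[R]_n -> R)^nat),
  [/\ forall k, test_fun D (phi k),
      ipD (fun x => phi k x - u x) (fun x => phi k x - u x) @[k --> \oo] --> 0 &
      forall i, ipD (fun x => partial i (phi k) x - g i x)
        (fun x => partial i (phi k) x - g i x) @[k --> \oo] --> 0].
Proof.
move=> [Lu Lg _ H].
have H' (k : nat) : exists phi, test_fun D phi /\
    (\int[leb]_(x in D)
       ((u x - phi x) ^+ 2 + \sum_i (g i x - partial i phi x) ^+ 2)%:E
         < (k.+1%:R^-1)%:E)%E.
  have k0 : 0 < k.+1%:R^-1 :> R by rewrite invr_gt0.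
  by have [phi tphi lt] := H _ k0; exists phi.
have [phi phiP] := choice H'.
exists phi.
have t k : test_fun D (phi k) by have [] := phiP k.
have msum k : measurable_fun D (fun x =>
    ((u x - phi k x) ^+ 2 + \sum_i (g i x - partial i (phi k) x) ^+ 2)%:E).
  apply/measurable_EFinP; apply: measurable_funD.
    by apply: measurable_funX; have [] := sqintB mD Lu (test_sqint (t k)).
  apply: measurable_sum => i; apply: measurable_funX.
  by have [] := sqintB mD (Lg i) (test_sqint_partial i (t k)).
have c0 : (fun k => k.+1%:R^-1 : R) @ \oo --> 0 by exact: cvg_harmonic.
split => // [|i].
  apply: (squeeze_cvgr _ (cvg_cst 0) c0); apply: nearW => k.
  have sB := sqintB mD (test_sqint (t k)) Lu.
  rewrite ip_ge0/= -lee_fin -ip_sqrE//.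
  have [_ /ltW] := phiP k; apply: le_trans; apply: ge0_le_integral => //.
  - by move=> x _; rewrite lee_fin sqr_ge0.
  - by apply/measurable_EFinP; apply: measurable_funX; case: sB.
  - move=> x _; rewrite lee_fin -sqrrN opprB lerDl sumr_ge0// => i _.
    by rewrite sqr_ge0.
apply: (squeeze_cvgr _ (cvg_cst 0) c0); apply: nearW => k.
have sB := sqintB mD (test_sqint_partial i (t k)) (Lg i).
rewrite ip_ge0/= -lee_fin -ip_sqrE//.
have [_ /ltW] := phiP k; apply: le_trans; apply: ge0_le_integral => //.
- by move=> x _; rewrite lee_fin sqr_ge0.
- by apply/measurable_EFinP; apply: measurable_funX; case: sB.
- move=> x _; rewrite lee_fin -sqrrN opprB (bigD1 i)//= addrCA lerDl.
  by rewrite addr_ge0 ?sqr_ge0// sumr_ge0// => j _; rewrite sqr_ge0.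
Qed.

Let cvg_ip0 u : ipD (fun x => u x - u x) (fun x => u x - u x) @[_ --> \oo] --> 0.
Proof.
rewrite (_ : ipD _ _ = 0); first exact: cvg_cst.
rewrite /ipD /ip; under eq_Rintegral do rewrite subrr mul0r.
by rewrite Rintegral_cst// mul0r.
Qed.

Lemma cvg_ipl (f : ('rV[R]_n -> R)^nat) f0 h : (forall k, sqint leb D (f k)) ->
  sqint leb D f0 -> sqint leb D h ->
  ipD (fun x => f k x - f0 x) (fun x => f k x - f0 x) @[k --> \oo] --> 0 ->
  ipD (f k) h @[k --> \oo] --> ipD f0 h.
Proof.
by move=> sf sf0 sh cf; apply: (cvg_ip mD (g := fun=> h)) => //; exact: cvg_ip0.
Qed.

(* The test functions phi k satisfy the eigenvalue equation of u only in the
   limit, and against bounded sequences of test functions. *)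
Definition eigen_approx (l : R) u (phi : ('rV[R]_n -> R)^nat) : Prop :=
  [/\ forall k, test_fun D (phi k),
      ipD (fun x => phi k x - u x) (fun x => phi k x - u x) @[k --> \oo] --> 0,
      sqn (phi k) @[k --> \oo] --> ipD u u,
      dir (phi k) (phi k) @[k --> \oo] --> l * ipD u u &
      forall M (psi : ('rV[R]_n -> R)^nat), (forall k, test_fun D (psi k)) ->
        (forall k, sqn (psi k) <= M) -> (forall k, dir (psi k) (psi k) <= M) ->
        dir (phi k) (psi k) - l * ip leb setT (phi k) (psi k) @[k --> \oo] --> 0].

Lemma cvg_sum_seq (I : Type) (r : seq I) (F : I -> R^nat) (c : I -> R) :
  (forall i, F i @ \oo --> c i) -> \sum_(i <- r) F i k @[k --> \oo] --> \sum_(i <- r) c i.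
Proof.
move=> Fc; elim: r => [|i r IH].
  by rewrite big_nil; under eq_fun do rewrite big_nil; exact: cvg_cst.
by rewrite big_cons; under eq_fun do rewrite big_cons; exact: cvgD.
Qed.

Lemma cvg_bounded_mul0 (a b : R^nat) (M : R) : a @ \oo --> 0 ->
  (forall k, b k ^+ 2 <= a k * M) -> b @ \oo --> 0.
Proof.
move=> a0 ab; apply/norm_cvg0P.
have c : Num.sqrt (a k * M) @[k --> \oo] --> 0.
  rewrite -[X in _ --> X]sqrtr0; apply: continuous_cvg; first exact: sqrt_continuous.
  by rewrite -(mul0r M); exact: cvgMl.
apply: (squeeze_cvgr _ (cvg_cst 0) c); apply: nearW => k.
by rewrite normr_ge0/= -sqrtr_sqr ler_wsqrtr.
Qed.

Lemma eigenfunction_approx l u : dirichlet_laplacian D u (fun x => l * u x) ->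
  exists Phi : ('rV[R]_n -> R)^nat, eigen_approx l u Phi.
Proof.
move=> [Llu [g Hug ug]].
have [Lu Lg _ _] := Hug.
have [phi [t cu cg]] := H10_approx Hug.
have sphi k := test_sqint (t k); have spart k i := test_sqint_partial i (t k).
have weak psi : test_fun D psi ->
    \sum_i ipD (g i) (partial i psi) = l * ipD u psi.
  move=> tpsi; rewrite -Rintegral_sum//; last first.
    by move=> i; exact: test_sqint_partial.
  rewrite ug// -ipZl//; last exact: test_sqint.
have dirE k psi : test_fun D psi ->
    dir (phi k) psi = \sum_i ipD (partial i (phi k)) (partial i psi).
  by move=> tpsi; apply: eq_bigr => i _; exact: ip_test_partial.
(* As u is not a test function, the equation is tested with phi k and k tends to infinity. *)
have E : \sum_i ipD (g i) (g i) = l * ipD u u.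
  have c1 : \sum_i ipD (g i) (partial i (phi k)) @[k --> \oo] --> \sum_i ipD (g i) (g i).
    apply: cvg_sum_seq => i.
    rewrite (_ : (fun k => _) = fun k => ipD (partial i (phi k)) (g i)); last first.
      by apply/funext => k; exact: ipC.
    exact: (cvg_ipl (fun k => spart k i) (Lg i) (Lg i) (cg i)).
  have c2 : l * ipD u (phi k) @[k --> \oo] --> l * ipD u u.
    apply: cvgMr.
    rewrite (_ : (fun k => _) = fun k => ipD (phi k) u); last first.
      by apply/funext => k; exact: ipC.
    exact: (cvg_ipl sphi Lu Lu cu).
  rewrite -(cvg_lim _ c1)// -(cvg_lim _ c2)//.
  by congr (lim (_ @ \oo)); apply/funext => k; rewrite weak.
exists phi; split => //.
- under eq_fun do rewrite /sqn ip_test//.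
  exact: (cvg_ip mD sphi sphi Lu Lu cu cu).
- under eq_fun do rewrite dirE//.
  rewrite -E; apply: cvg_sum_seq => i; pose si k := spart k i.
  exact: (cvg_ip mD si si (Lg i) (Lg i) (cg i) (cg i)).
move=> M psi tpsi psiM dpsiM.
have M0 : 0 <= M by apply: le_trans (psiM 0%N); exact: sqn_ge0.
(* u satisfies the equation exactly, so the residual only pairs psi k with the H^1 error of phi k;
   Cauchy-Schwarz then works uniformly over bounded psi. *)
have -> : (fun k => dir (phi k) (psi k) - l * ip leb setT (phi k) (psi k)) =
    (fun k => \sum_i ipD (fun x => partial i (phi k) x - g i x) (partial i (psi k)) -
      l * ipD (fun x => phi k x - u x) (psi k)).
  apply/funext => k; rewrite dirE// ip_test//.
  have -> : \sum_i ipD (fun x => partial i (phi k) x - g i x) (partial i (psi k)) =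
      \sum_i ipD (partial i (phi k)) (partial i (psi k)) - l * ipD u (psi k).
    rewrite -weak// -sumrB; apply: eq_bigr => i _.
    exact: (ipBl mD (spart k i) (Lg i) (test_sqint_partial i (tpsi k))).
  have -> : ipD (fun x => phi k x - u x) (psi k) = ipD (phi k) (psi k) - ipD u (psi k).
    exact: (ipBl mD (sphi k) Lu (test_sqint (tpsi k))).
  by ring.
rewrite [X in _ --> X](_ : _ = \sum_(i < n) 0 - l * 0); last first.
  by rewrite big1// mulr0 subrr.
apply: cvgB.
  apply: cvg_sum_seq => i.
  apply: (@cvg_bounded_mul0 _ _ M (cg i)) => k.
  apply: (le_trans (cauchy_schwarz mD (sqintB mD (spart k i) (Lg i)) (test_sqint_partial i (tpsi k)))).
  apply: ler_wpM2l; first exact: ip_ge0.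
  rewrite -/(ipD _ _) -ip_test_partial//; apply: le_trans (dpsiM k).
  by rewrite /dir (bigD1 i)//= lerDl sumr_ge0// => j _; exact: ip_ge0.
apply: cvgMr; apply: (@cvg_bounded_mul0 _ _ M cu) => k.
apply: (le_trans (cauchy_schwarz mD (sqintB mD (sphi k) Lu) (test_sqint (tpsi k)))).
apply: ler_wpM2l; first exact: ip_ge0.
by rewrite -/(ipD _ _) -ip_test//; exact: psiM.
Qed.

Lemma ip_eq0 u : sqint leb D u -> ipD u u = 0 -> {ae leb, forall x, D x -> u x = 0}.
Proof.
move=> su u0; have [mu _] := su.
have mu2 : measurable_fun D (fun x => (u x ^+ 2)%:E).
  by apply/measurable_EFinP; exact: measurable_funX.
have /(ae_eq_integral_abs leb mD mu2) : (\int[leb]_(x in D) `|(u x ^+ 2)%:E| = 0)%E.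
  under eq_integral do rewrite gee0_abs ?lee_fin ?sqr_ge0//.
  by rewrite ip_sqrE// -/(ipD _ _) u0.
apply: filterS => x ux Dx; have [] := ux Dx.
by move/eqP; rewrite sqrf_eq0 => /eqP.
Qed.

Lemma eigenfunction_ip_gt0 l u : eigenfunction D l u -> 0 < ipD u u.
Proof.
move=> [[_ [g [Lu _ _ _] _]] nu].
by rewrite lt_def ip_ge0 andbT; apply/eqP => /(ip_eq0 Lu).
Qed.

(** The bound holds along the approximating test functions, and both sides converge to multiples of
    the squared norm of u. *)
Lemma eigenvalue_ge rho l : (forall phi, test_fun D phi -> rho * sqn phi <= dir phi phi) ->
  eigenvalues D l -> rho <= l.
Proof.
move=> Rayleigh [u eu].
have u0 := eigenfunction_ip_gt0 eu.
have [phi [t _ c1 c2 _]] := eigenfunction_approx eu.1.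
rewrite -(ler_pM2r u0).
have c3 : rho * sqn (phi k) @[k --> \oo] --> rho * ipD u u by exact: cvgMr.
rewrite -(cvg_lim _ c2)// -(cvg_lim _ c3)//; apply: ler_lim.
- by apply/cvg_ex; eexists; exact: c3.
- by apply/cvg_ex; eexists; exact: c2.
- by apply: nearW => k; exact: Rayleigh.
Qed.

(** The side 2 a is left free: a^2 of order 1 / l gives a volume of order l^(-n/2). *)
Lemma faber_krahn l u (a : R) : eigenfunction D l u -> 0 < a ->
  (2 * a) ^+ n * (1 - a ^+ 2 / 6 * l) <= vol D.
Proof.
move=> eu a0; have u0 := eigenfunction_ip_gt0 eu.
have [phi [t _ c1 c2 _]] := eigenfunction_approx eu.1.
rewrite -(ler_pM2r u0).
have c3 : (2 * a) ^+ n * (sqn (phi k) - a ^+ 2 / 6 * dir (phi k) (phi k)) @[k --> \oo] -->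
    (2 * a) ^+ n * (ipD u u - a ^+ 2 / 6 * (l * ipD u u)).
  by apply: cvgMr; apply: cvgB => //; exact: cvgMr.
have c4 : vol D * sqn (phi k) @[k --> \oo] --> vol D * ipD u u by exact: cvgMr.
rewrite [leLHS](_ : _ = (2 * a) ^+ n * (ipD u u - a ^+ 2 / 6 * (l * ipD u u))); last by ring.
rewrite -(cvg_lim _ c3)// -(cvg_lim _ c4)//; apply: ler_lim.
- by apply/cvg_ex; eexists; exact: c3.
- by apply/cvg_ex; eexists; exact: c4.
- by apply: nearW => k; exact: faber_krahn_test.
Qed.

End H10_functions.

(** * Minimizing sequences of the Rayleigh quotient *)

Section minimizer.
Context {R : realType} {n : nat}.
Local Notation leb := (lebesgue_rV n).
Variables (D : set 'rV[R]_n) (mD : measurable D) (Doo : (leb D < +oo)%E).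
Implicit Types (phi psi u : 'rV[R]_n -> R).

Let stest phi := @test_fun_sqint R n D phi mD Doo.
Let spartial phi i := @test_fun_sqint_partial R n D phi i mD Doo.

Lemma test_differentiable phi : test_fun D phi -> forall x, differentiable phi x.
Proof. by move=> /test_fun_C1[]. Qed.

Lemma partial_linear phi psi (c : R) i : test_fun D phi -> test_fun D psi ->
  partial i (fun x => phi x + c * psi x) = (fun x => partial i phi x + c * partial i psi x).
Proof.
move=> t1 t2; have [d1 d2] := (test_differentiable t1, test_differentiable t2).
by rewrite partialD ?partialZ// => x; exact: differentiableZ.
Qed.

Lemma sqn_linear phi psi (c : R) : test_fun D phi -> test_fun D psi ->
  sqn (fun x => phi x + c * psi x) = sqn phi + 2 * c * ip leb setT phi psi + c ^+ 2 * sqn psi.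
Proof.
by move=> /stest s1 /stest s2; exact: ip_sqr_linear.
Qed.

Lemma dir_linear phi psi (c : R) : test_fun D phi -> test_fun D psi ->
  dir (fun x => phi x + c * psi x) (fun x => phi x + c * psi x) =
  dir phi phi + 2 * c * dir phi psi + c ^+ 2 * dir psi psi.
Proof.
move=> t1 t2; rewrite /dir !mulr_sumr -!big_split/=; apply: eq_bigr => i _.
rewrite partial_linear//.
exact: (ip_sqr_linear measurableT c (spartial i t1) (spartial i t2)).
Qed.

Section rayleigh.
Variable rho : R.
Hypothesis Rayleigh : forall phi, test_fun D phi -> rho * sqn phi <= dir phi phi.

Let q phi := dir phi phi - rho * sqn phi.

(** The parallelogram law for the quadratic form q, with q >= 0 at the sum. Near-minimizers that are
    close in L^2 are thereby close in H^1. *)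
Lemma rayleigh_parallelogram phi psi : test_fun D phi -> test_fun D psi ->
  q (fun x => phi x + -1 * psi x) <= 2 * q phi + 2 * q psi.
Proof.
move=> t1 t2; have := Rayleigh (test_fun_linear 1 t1 t2).
rewrite /q (dir_linear 1 t1 t2) (dir_linear (-1) t1 t2).
rewrite (sqn_linear 1 t1 t2) (sqn_linear (-1) t1 t2).
move: (dir phi phi) (dir phi psi) (dir psi psi) => a b c.
by move: (sqn phi) (ip _ _ phi psi) (sqn psi) => d e f; lra.
Qed.

(** This yields the eigenvalue equation of the minimizer: along a minimizing sequence of unit norm q
    tends to 0, hence so does the residual against every fixed psi. *)
Lemma rayleigh_cauchy_schwarz phi psi : test_fun D phi -> test_fun D psi ->
  (dir phi psi - rho * ip leb setT phi psi) ^+ 2 <= q phi * q psi.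
Proof.
move=> t1 t2; apply: quadratic_discr => [|c].
  by rewrite subr_ge0; exact: Rayleigh.
have := Rayleigh (test_fun_linear c t1 t2).
rewrite -subr_ge0 (dir_linear c t1 t2) (sqn_linear c t1 t2).
rewrite /q; move: (dir phi phi) (dir phi psi) (dir psi psi) => x y z.
by move: (sqn phi) (ip _ _ phi psi) (sqn psi) => d e f; congr (0 <= _); ring.
Qed.

End rayleigh.

Lemma sqnB_le phi psi : test_fun D phi -> test_fun D psi ->
  sqn (fun x => phi x + -1 * psi x) <= 2 * sqn phi + 2 * sqn psi.
Proof.
move=> t1 t2; have := sqn_ge0 (fun x => phi x + 1 * psi x).
rewrite (sqn_linear 1 t1 t2) (sqn_linear (-1) t1 t2).
by move: (sqn phi) (ip _ _ phi psi) (sqn psi) => d e f; lra.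
Qed.

Lemma dirB_le phi psi : test_fun D phi -> test_fun D psi ->
  dir (fun x => phi x + -1 * psi x) (fun x => phi x + -1 * psi x) <=
  2 * dir phi phi + 2 * dir psi psi.
Proof.
move=> t1 t2; have := dir_ge0 (fun x => phi x + 1 * psi x).
rewrite (dir_linear 1 t1 t2) (dir_linear (-1) t1 t2).
by move: (dir phi phi) (dir phi psi) (dir psi psi) => a b c; lra.
Qed.

(** Without a nonzero test function this is [inf set0], that is 0; results that depend on attainment
    assume such a function. *)
Definition rayleigh_inf : R :=
  inf [set r | exists phi, [/\ test_fun D phi, sqn phi = 1 & r = dir phi phi]].

Lemma normalize_test phi : test_fun D phi -> 0 < sqn phi ->
  exists psi, [/\ test_fun D psi, sqn psi = 1 & dir psi psi = dir phi phi / sqn phi].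
Proof.
move=> t p0; pose c := (Num.sqrt (sqn phi))^-1.
have c2 : c ^+ 2 = (sqn phi)^-1 by rewrite exprVn sqr_sqrtr// ltW.
exists (fun x => phi x + (c - 1) * phi x); split.
- exact: test_fun_linear.
- rewrite (sqn_linear (c - 1) t t) -/(sqn phi).
  rewrite [LHS](_ : _ = c ^+ 2 * sqn phi); last by move: (sqn phi) => x; ring.
  by rewrite c2 mulVf// gt_eqF.
- rewrite (dir_linear (c - 1) t t).
  rewrite [LHS](_ : _ = c ^+ 2 * dir phi phi); last by move: (dir phi phi) => x; ring.
  by rewrite c2 mulrC.
Qed.

Lemma rayleigh_inf_le phi : test_fun D phi -> rayleigh_inf * sqn phi <= dir phi phi.
Proof.
move=> t; have [p0|p0] := eqVneq (sqn phi) 0; first by rewrite p0 mulr0 dir_ge0.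
have pp : 0 < sqn phi by rewrite lt_def p0 sqn_ge0.
have [psi [tpsi psi1 dpsi]] := normalize_test t pp.
rewrite -ler_pdivlMr// -dpsi; apply: ge_inf; last by exists psi.
by exists 0 => _ [f [_ _ ->]]; exact: dir_ge0.
Qed.

Lemma mean_linear phi psi (B : set 'rV[R]_n) : test_fun D phi -> test_fun D psi ->
  measurable B -> (leb B < +oo)%E ->
  \int[leb]_(x in B) (phi x + -1 * psi x) =
  \int[leb]_(x in B) phi x - \int[leb]_(x in B) psi x.
Proof.
move=> /stest s1 /stest s2 mB Boo.
have s : sqint leb B (cst 1).
  by apply: (@sqint_bounded _ _ _ _ _ _ _ 1) => // y _; rewrite normr1.
have E f : \int[leb]_(x in B) f x = ip leb B f (cst 1).
  by apply: eq_Rintegral => x _; rewrite mulr1.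
have sB1 := sqint_setT mB s1; have sB2 := sqint_setT mB s2.
rewrite !E ipDl//; last exact: sqintZ.
by rewrite ipZl// mulN1r.
Qed.

(* Limits along an ultrafilter replace the extraction of subsequences. *)
Lemma ultrafilter_cauchy (U : set_system nat) (phi : ('rV[R]_n -> R)^nat) (M e : R) :
  UltraFilter U -> 0 < e -> (forall k, test_fun D (phi k)) ->
  (forall k, sqn (phi k) <= M) -> (forall k, dir (phi k) (phi k) <= M) ->
  exists2 A, U A & forall k l, A k -> A l ->
    sqn (fun x => phi k x + -1 * phi l x) <= e.
Proof.
move=> UU e0 t sM dM.
have UP : ProperFilter U by case: UU.
have M0 : 0 <= M by apply: le_trans (sM 0%N); exact: sqn_ge0.
(* 4 M bounds both forms at a difference of two members, each being at most 2 M + 2 M. *)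
have M40 : 0 <= 4 * M by rewrite mulr_ge0.
have [s [K [b [s0 b0 H]]]] := finitely_many_means mD Doo M40 e0.
pose Q (z : {ffun 'I_n -> 'I_K.*2}) := @cell R n s (fun i => (z i)%:Z - K%:Z).
pose m z k := \int[leb]_(y in Q z) phi k y.
have mQ z : measurable (Q z) by exact: measurable_cell.
have Qoo z : (leb (Q z) < +oo)%E by rewrite /Q lebesgue_cell// ltry.
pose C := Num.sqrt M * Num.sqrt (vol D).
have mC z k : `|m z k| <= C.
  apply: (le_trans (test_mean_le mD Doo (t k) (mQ z))).
  apply: ler_pM; rewrite ?sqrtr_ge0//; first exact: ler_wsqrtr.
  apply: ler_wsqrtr; rewrite -lee_fin -(lebesgue_vol Doo) fineK.
    by apply: le_measure; rewrite ?inE//; exact: measurableI.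
  rewrite ge0_fin_numE//; apply: le_lt_trans Doo.
  by apply: le_measure; rewrite ?inE//; exact: measurableI.
(* The means over the cell z lie in the compact [-C, C], so they cluster at some p along U, and an
   ultrafilter contains the preimage of a ball or of its complement. Only finitely many z occur, so
   one member of U serves them all. *)
have lim z : exists p, U [set k | `|m z k - p| < b / 2].
  have cpt : compact `[- C, C]%classic by exact: segment_compact.
  have FC : (m z @ U) `[- C, C]%classic.
    apply: (@filterS _ U _ setT); last exact: filterT.
    by move=> k _; rewrite /= in_itv/= -ler_norml mC.
  have [p [_ clp]] := cpt _ _ FC.
  exists p; have b20 : 0 < b / 2 by rewrite divr_gt0.
  have nb : nbhs p (ball p (b / 2)) by exact: nbhsx_ballx.
  have [//|Uc] := in_ultra_setVsetC [set k | `|m z k - p| < b / 2] UU.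
  have Uc' : U (m z @^-1` (~` ball p (b / 2))).
    apply: (@filterS _ U _ _ _ _ Uc) => k /= nk pk; apply: nk.
    by rewrite distrC.
  by have [x []] := clp _ _ (Uc' : (m z @ U) (~` ball p (b / 2))) nb.
have [p pP] := choice lim.
exists [set k | forall z, `|m z k - p z| < b / 2].
  by apply: filter_forall.
move=> k l /= Ak Al; apply: H.
- exact: test_fun_linear.
- apply: (le_trans (sqnB_le (t k) (t l))).
  by have := sM k; have := sM l; move: (sqn _) (sqn _) => x y; lra.
- apply: (le_trans (dirB_le (t k) (t l))).
  by have := dM k; have := dM l; move: (dir _ _) (dir _ _) => x y; lra.
move=> z; rewrite -/(Q z) mean_linear// -/(m z k) -/(m z l).
have := Ak z; have := Al z; rewrite distrC => h1 h2.
rewrite [leRHS]splitr (le_trans (ler_distD (p z) _ _))// lerD// ltW//.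
Qed.

(** Both tolerances are tuned so that, after the parallelogram law, consecutive differences have
    Dirichlet form at most 16^-k, the rate required by [sqint_complete]. *)
Lemma minimizing_sequence phi0 : test_fun D phi0 -> 0 < sqn phi0 ->
  exists psi : ('rV[R]_n -> R)^nat, [/\ forall k, test_fun D (psi k),
    forall k, sqn (psi k) = 1,
    forall k, dir (psi k) (psi k) <= rayleigh_inf + 16^-1 ^+ k / 8 &
    forall k, sqn (fun x => psi k.+1 x + -1 * psi k x) <= 16^-1 ^+ k / (2 * (rayleigh_inf + 1))].
Proof.
move=> t0 p0; set rho := rayleigh_inf.
have p16 k : 0 < (16^-1 : R) ^+ k by rewrite exprn_gt0// invr_gt0.
have hinf : has_inf [set r | exists phi, [/\ test_fun D phi, sqn phi = 1 & r = dir phi phi]].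
  split; last by exists 0 => _ [f [_ _ ->]]; exact: dir_ge0.
  have [psi [tpsi psi1 _]] := normalize_test t0 p0.
  by exists (dir psi psi), psi.
have rho0 : 0 <= rho.
  apply: lb_le_inf; first by case: hinf.
  by move=> _ [f [_ _ ->]]; exact: dir_ge0.
have ex (k : nat) : exists phi, [/\ test_fun D phi, sqn phi = 1 &
    dir phi phi <= rho + 16^-1 ^+ k / 8].
  have d0 : 0 < (16^-1 : R) ^+ k / 8 by rewrite divr_gt0.
  have [_ [phi [tphi phi1 ->]] lt] := inf_adherent d0 hinf.
  by exists phi; split => //; exact: ltW.
have [phi phiP] := choice ex.
have tphi k : test_fun D (phi k) by have [] := phiP k.
have sphi k : sqn (phi k) <= rho + 1 by have [_ -> _] := phiP k; rewrite lerDr.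
have mono k l : (k <= l)%N -> (16^-1 : R) ^+ l <= 16^-1 ^+ k.
  by move=> kl; apply: ler_wiXn2l => //; rewrite ?invr_ge0// invf_le1// ler1n.
have dphi k : dir (phi k) (phi k) <= rho + 1.
  have [_ _ /le_trans] := phiP k; apply; rewrite lerD2l.
  have := mono 0%N k (leq0n k); rewrite expr0; lra.
have [U [UU sub]] := @ultraFilterLemma nat \oo _.
have UP : ProperFilter U by case: UU.
have e0 k : 0 < 16^-1 ^+ k / (2 * (rho + 1)).
  by rewrite divr_gt0// mulr_gt0// ltr_wpDl.
have exA k : exists A, U A /\ forall i j, A i -> A j ->
    sqn (fun x => phi i x + -1 * phi j x) <= 16^-1 ^+ k / (2 * (rho + 1)).
  by have [A UA HA] := ultrafilter_cauchy UU (e0 k) tphi sphi dphi; exists A.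
have [A AP] := choice exA.
(* A diagonal choice: N k and N k.+1 both lie in A k, and N k >= k keeps the Dirichlet form within
   the k-th tolerance of the infimum. *)
have exN j : exists N, (forall i : 'I_j.+1, A i N) /\ (j <= N)%N.
  have : U [set N | (forall i : 'I_j.+1, A i N) /\ (j <= N)%N].
    apply: filterI.
      by apply: filter_forall => i; have [] := AP i.
    by apply: sub; exists j.
  by move=> /filter_ex.
have [N NP] := choice exN.
exists (fun j => phi (N j)); split => [k|k|k|k].
- exact: tphi.
- by have [] := phiP (N k).
- have [_ _ /le_trans] := phiP (N k); apply; rewrite lerD2l ler_wpM2r//.
  by apply: mono; have [] := NP k.
- have [_ HA] := AP k; apply: HA.
    by have [/(_ (inord k))] := NP k.+1; rewrite inordK// ltnS ltnW.
  by have [/(_ ord_max)] := NP k.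
Qed.

End minimizer.

(** * The first eigenvalue as the infimum of the Rayleigh quotient *)

Section first_eigenvalue.
Context {R : realType} {n : nat}.
Local Notation leb := (lebesgue_rV n).
Variables (D : set 'rV[R]_n) (mD : measurable D) (Doo : (leb D < +oo)%E).
Implicit Types (phi psi u : 'rV[R]_n -> R).

Let ipD := ip leb D.

Lemma ipDB_test phi psi : test_fun D phi -> test_fun D psi ->
  ipD (fun x => phi x - psi x) (fun x => phi x - psi x) =
  sqn (fun x => phi x + -1 * psi x).
Proof.
move=> t1 t2.
have E : (fun x => phi x - psi x) = (fun x => phi x + -1 * psi x).
  by apply/funext => x; rewrite mulN1r.
by rewrite E /sqn (ip_test _ (test_fun_linear _ t1 t2)).
Qed.

Lemma ipDB_test_partial phi psi i : test_fun D phi -> test_fun D psi ->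
  ipD (fun x => partial i phi x - partial i psi x) (fun x => partial i phi x - partial i psi x)
  <= dir (fun x => phi x + -1 * psi x) (fun x => phi x + -1 * psi x).
Proof.
move=> t1 t2.
have E : (fun x => partial i phi x - partial i psi x) = partial i (fun x => phi x + -1 * psi x).
  by rewrite (partial_linear (-1) i t1 t2); apply/funext => x; rewrite mulN1r.
rewrite E /ipD -(ip_test_partial _ i (test_fun_linear _ t1 t2)).
by rewrite /dir (bigD1 i)//= lerDl sumr_ge0// => j _; exact: ip_ge0.
Qed.

(** [phi0] ensures that there is something to minimize over. The minimizing sequence and its partial
    derivatives converge in L^2; the limit has norm 1, so it is not null, and it lies in H^1_0 as a
    limit of test functions. *)
Lemma rayleigh_inf_eigenvalue phi0 : test_fun D phi0 -> 0 < sqn phi0 ->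
  eigenvalues D (rayleigh_inf D).
Proof.
move=> t0 p0; have [psi [t psi1 dpsi cpsi]] := minimizing_sequence mD Doo t0 p0.
set rho := rayleigh_inf D in dpsi cpsi *.
have Rayleigh phi : test_fun D phi -> rho * sqn phi <= dir phi phi.
  exact: rayleigh_inf_le.
have p16 k : 0 < (16^-1 : R) ^+ k by rewrite exprn_gt0// invr_gt0.
have rho0 : 0 <= rho.
  have [psi' [tpsi' psi1' _]] := normalize_test mD Doo t0 p0.
  apply: lb_le_inf; first by exists (dir psi' psi'), psi'.
  by move=> _ [f [_ _ ->]]; exact: dir_ge0.
have rho10 : 0 < rho + 1 by rewrite ltr_wpDl.
have spsi k := test_sqint mD Doo (t k).
have sppsi k i := test_sqint_partial mD Doo i (t k).
have qpsi k : dir (psi k) (psi k) - rho * sqn (psi k) <= 16^-1 ^+ k / 8.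
  by rewrite psi1 mulr1 lerBlDl.
have [u su cu] : exists2 u, sqint leb D u &
    ipD (fun x => psi k x - u x) (fun x => psi k x - u x) @[k --> \oo] --> 0.
  apply: (sqint_complete mD spsi) => k; rewrite -/(ipD _ _) ipDB_test//.
  apply: (le_trans (cpsi k)); rewrite ler_pdivrMr ?mulr_gt0// ler_peMr ?ltW//.
  by clear -rho0; lra.
(* At the difference, [dir - rho * sqn] is at most 2 (1/8 + 1/128) = 17/64 times 16^-k, and
   [rho * sqn] at most half of 16^-k. *)
have bound k : dir (fun x => psi k.+1 x + -1 * psi k x) (fun x => psi k.+1 x + -1 * psi k x)
    <= 16^-1 ^+ k.
  pose chi x := psi k.+1 x + -1 * psi k x; rewrite -/chi.
  have := rayleigh_parallelogram mD Doo Rayleigh (t k.+1) (t k); rewrite -/chi.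
  have := qpsi k; have := qpsi k.+1; rewrite exprS.
  have : rho * sqn chi <= 16^-1 ^+ k / 2.
    apply: (le_trans (ler_wpM2l rho0 (cpsi k))).
    rewrite (_ : rho * _ = 16^-1 ^+ k / 2 * (rho / (rho + 1))); last by field; rewrite gt_eqF.
    rewrite ger_pMr ?divr_gt0// ler_pdivrMr// mul1r lerDl//.
  have := p16 k.
  move: (dir chi chi) (sqn chi) => a b; move: (16^-1 ^+ k) => c.
  move: (dir (psi k) (psi k)) (dir (psi k.+1) (psi k.+1)) (sqn (psi k)) (sqn (psi k.+1)) => d e f h.
  by clear -rho0; lra.
have exg i : exists g, sqint leb D g /\
    ipD (fun x => partial i (psi k) x - g x) (fun x => partial i (psi k) x - g x) @[k --> \oo] --> 0.
  have [|g sg cg] := sqint_complete mD (fun k => sppsi k i); last by exists g.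
  by move=> k; apply: (le_trans (ipDB_test_partial i (t k.+1) (t k))).
have [g gP] := choice exg.
have sg i : sqint leb D (g i) by have [] := gP i.
have cg i : ipD (fun x => partial i (psi k) x - g i x)
    (fun x => partial i (psi k) x - g i x) @[k --> \oo] --> 0 by have [] := gP i.
have u1 : ipD u u = 1.
  have c1 : sqn (psi k) @[k --> \oo] --> ipD u u.
    under eq_fun do rewrite /sqn (ip_test _ (t _)).
    exact: (cvg_ip mD spsi spsi su su cu cu).
  rewrite -(cvg_lim _ c1)//; under eq_fun do rewrite psi1.
  by rewrite lim_cst.
(* Classical integration by parts for psi k, over the whole space, then the limit on both sides. *)
have wg : weak_grad D u g.
  move=> i phi tphi.
  have c1 : ipD (psi k) (partial i phi) @[k --> \oo] --> ipD u (partial i phi).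
    exact: (cvg_ipl mD spsi su (test_sqint_partial mD Doo i tphi) cu).
  have c2 : ipD (partial i (psi k)) phi @[k --> \oo] --> ipD (g i) phi.
    exact: (cvg_ipl mD (fun k => sppsi k i) (sg i) (test_sqint mD Doo tphi) (cg i)).
  have E k : ipD (psi k) (partial i phi) = - ipD (partial i (psi k)) phi.
    rewrite /ipD -(ip_test_partial _ i tphi) -(ip_test _ tphi) (ipC leb setT (partial i _)).
    apply: ip_partial.
    - exact: test_fun_C1 (t k).
    - exact: test_fun_C1 tphi.
    - exact: (test_fun_sqint mD Doo (t k)).
    - exact: (test_fun_sqint mD Doo tphi).
    - exact: (test_fun_sqint_partial i mD Doo (t k)).
    - exact: (test_fun_sqint_partial i mD Doo tphi).
  have c3 : - ipD (partial i (psi k)) phi @[k --> \oo] --> - ipD (g i) phi by exact: cvgN.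
  rewrite -/(ip leb D u (partial i phi)) -/(ip leb D (g i) phi) -!/(ipD _ _).
  rewrite -(cvg_lim _ c1)// -(cvg_lim _ c3)//.
  by congr (lim (_ @ \oo)); apply/funext => k; exact: E.
have H : H10 D u g.
  split=> // e e0.
  have c : ipD (fun x => psi k x - u x) (fun x => psi k x - u x) +
      \sum_i ipD (fun x => partial i (psi k) x - g i x) (fun x => partial i (psi k) x - g i x)
      @[k --> \oo] --> 0.
    rewrite [X in _ --> X](_ : _ = 0 + \sum_(i < n) 0); last by rewrite big1// addr0.
    by apply: cvgD => //; apply: cvg_sum_seq => i.
  move/cvgrPdist_lt : c => /(_ e e0) [k _ /(_ k (leqnn k))/= ck].
  exists (psi k) => //.
  have sB := sqintB mD (spsi k) su.
  have sBi i := sqintB mD (sppsi k i) (sg i).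
  have mB : measurable_fun D (fun x => ((u x - psi k x) ^+ 2)%:E).
    by apply/measurable_EFinP; apply: measurable_funX; case: (sqintB mD su (spsi k)).
  have mBi i : measurable_fun D (fun x => ((g i x - partial i (psi k) x) ^+ 2)%:E).
    by apply/measurable_EFinP; apply: measurable_funX; case: (sqintB mD (sg i) (sppsi k i)).
  under eq_integral do rewrite EFinD -sumEFin.
  rewrite ge0_integralD//; last 3 first.
  - by move=> x _; rewrite lee_fin sqr_ge0.
  - by move=> x _; apply: sume_ge0 => i _; rewrite lee_fin sqr_ge0.
  - by apply: emeasurable_sum => i.
  rewrite ge0_integral_sum//; last by move=> i x _; rewrite lee_fin sqr_ge0.
  under eq_integral do rewrite -sqrrN opprB.
  rewrite (ip_sqrE mD sB).
  have -> : (\sum_(i < n) \int[leb]_(x in D) ((g i x - partial i (psi k) x) ^+ 2)%:E =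
      \sum_(i < n) (ipD (fun x => partial i (psi k) x - g i x)
        (fun x => partial i (psi k) x - g i x))%:E)%E.
    apply: eq_bigr => i _; rewrite -(ip_sqrE mD (sBi i)).
    by apply: eq_integral => x _; rewrite -sqrrN opprB.
  rewrite sumEFin -EFinD lte_fin; apply: le_lt_trans ck.
  by rewrite sub0r normrN; exact: ler_norm.
exists u; split; last first.
  move=> u0; have mu2 : measurable_fun D (fun x => (u x ^+ 2)%:E).
    by apply/measurable_EFinP; apply: measurable_funX; case: su.
  have : (\int[leb]_(x in D) `|(u x ^+ 2)%:E| = 0)%E.
    apply/(ae_eq_integral_abs leb mD mu2).
    by apply: filterS u0 => x ux Dx; rewrite ux// expr0n.
  under eq_integral do rewrite gee0_abs ?lee_fin ?sqr_ge0//.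
  rewrite (ip_sqrE mD su) -/(ipD _ _) u1 => /eqP.
  by rewrite eqe oner_eq0.
split; first exact: (sqintZ mD rho su).
exists g => // phi tphi.
have sphi := test_sqint mD Doo tphi.
rewrite (Rintegral_sum mD sg (fun i => test_sqint_partial mD Doo i tphi)).
rewrite -/(ip leb D (fun x => rho * u x) phi) ipZl//.
have c1 : dir (psi k) phi @[k --> \oo] --> \sum_i ipD (g i) (partial i phi).
  rewrite (_ : (fun k => _) = fun k => \sum_i ipD (partial i (psi k)) (partial i phi)); last first.
    by apply/funext => k; apply: eq_bigr => i _; exact: (ip_test_partial _ i tphi).
  apply: cvg_sum_seq => i.
  exact: (cvg_ipl mD (fun k => sppsi k i) (sg i) (test_sqint_partial mD Doo i tphi) (cg i)).
have c2 : rho * ip leb setT (psi k) phi @[k --> \oo] --> rho * ipD u phi.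
  apply: cvgMr.
  rewrite (_ : (fun k => _) = fun k => ipD (psi k) phi); last first.
    by apply/funext => k; exact: (ip_test _ tphi).
  exact: (cvg_ipl mD spsi su sphi cu).
(* The square of this residual is at most q (psi k) * q phi, and q (psi k) <= 16^-k / 8. *)
have c3 : dir (psi k) phi - rho * ip leb setT (psi k) phi @[k --> \oo] --> 0.
  have c8 : (fun k => (16^-1 : R) ^+ k / 8) @ \oo --> 0.
    rewrite -(mul0r (8^-1)); apply: cvgMl; apply: cvg_expr.
    by rewrite ger0_norm ?invr_ge0// invf_lt1// ltr1n.
  apply: (cvg_bounded_mul0 (M := dir phi phi - rho * sqn phi) c8) => k.
  apply: (le_trans (rayleigh_cauchy_schwarz mD Doo Rayleigh (t k) tphi)).
  by apply: ler_wpM2r => //; rewrite subr_ge0; exact: Rayleigh.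
apply/eqP; rewrite -subr_eq0; apply/eqP.
rewrite -[RHS](cvg_lim _ c3)//; apply/esym/cvg_lim => //.
exact: (cvgB c1 c2).
Qed.

Lemma first_eigenvalue_rayleigh phi0 : test_fun D phi0 -> 0 < sqn phi0 ->
  first_eigenvalue D = rayleigh_inf D.
Proof.
move=> t0 p0; have ev := rayleigh_inf_eigenvalue t0 p0.
have lb : lbound (eigenvalues D) (rayleigh_inf D).
  move=> l; apply: (eigenvalue_ge mD Doo) => phi; exact: rayleigh_inf_le.
apply/le_anti/andP; split.
  by apply: ge_inf => //; exists (rayleigh_inf D).
by apply: lb_le_inf => //; exists (rayleigh_inf D).
Qed.

Lemma first_eigenvalue_le phi : test_fun D phi ->
  first_eigenvalue D * sqn phi <= dir phi phi.
Proof.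
move=> t; have [p0|p0] := eqVneq (sqn phi) 0; first by rewrite p0 mulr0 dir_ge0.
rewrite (first_eigenvalue_rayleigh t); first exact: rayleigh_inf_le.
by rewrite lt_def p0 sqn_ge0.
Qed.

Lemma first_eigenvalue_ge (rho : R) phi0 : test_fun D phi0 -> 0 < sqn phi0 ->
  (forall phi, test_fun D phi -> rho * sqn phi <= dir phi phi) ->
  rho <= first_eigenvalue D.
Proof.
move=> t0 p0 H; have ev := rayleigh_inf_eigenvalue t0 p0.
rewrite (first_eigenvalue_rayleigh t0 p0).
exact: (eigenvalue_ge mD Doo H ev).
Qed.

Lemma first_eigenvalue_ge0 : 0 <= first_eigenvalue D.
Proof.
rewrite /first_eigenvalue.
have [->|/set0P ne] := eqVneq (eigenvalues D) set0; first by rewrite inf0.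
apply: lb_le_inf => // l; apply: (eigenvalue_ge mD Doo) => phi _.
by rewrite mul0r dir_ge0.
Qed.

End first_eigenvalue.

(** * Slices of sets and of test functions *)

Section slices.
Context {R : realType}.

Lemma differentiable_rV (m k : nat) (F : 'rV[R]_m -> 'rV[R]_k) x :
  (forall j, differentiable (fun y => F y ord0 j : R) x) -> differentiable F x.
Proof.
move=> dF.
have -> : F = \sum_(j < k) (fun y => F y ord0 j *: (delta_mx ord0 j : 'rV[R]_k)).
  by apply/funext => y; rewrite fct_sumE; exact: rV_delta_sum.
by apply: differentiable_sum => j; exact: differentiableZl.
Qed.

Lemma differentiable_rV_cons (n : nat) (t : R) (y : 'rV[R]_n) :
  differentiable (fun z => rV_cons t z) y.
Proof.
apply: differentiable_rV => i; case: (unliftP ord0 i) => [j|] ->.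
  rewrite (_ : (fun _ => _) = fun z : 'rV[R]_n => z ord0 j); first exact: differentiable_coord.
  by apply/funext => z; rewrite rV_consS.
rewrite (_ : (fun _ => _) = cst t); first exact: differentiable_cst.
by apply/funext => z; rewrite rV_cons0.
Qed.

Lemma continuous_rV_cons (n : nat) (t : R) : continuous (fun y : 'rV[R]_n => rV_cons t y).
Proof. by move=> y; exact/differentiable_continuous/differentiable_rV_cons. Qed.

Lemma continuous_rV_behead (n : nat) : continuous (@rV_behead R n).
Proof.
move=> x; apply: differentiable_continuous; apply: differentiable_rV => j.
rewrite (_ : (fun _ => _) = fun z : 'rV[R]_n.+1 => z ord0 (lift ord0 j)).
  exact: differentiable_coord.
by apply/funext => z; rewrite mxE.
Qed.

Lemma open_slice (n : nat) (Omega : set 'rV[R]_n.+1) (t : R) :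
  open Omega -> open (slice Omega t).
Proof. by move=> oO; apply: open_comp => // y _; exact: continuous_rV_cons. Qed.

Lemma slice_sub_shadow (n : nat) (Omega : set 'rV[R]_n.+1) (t : R) :
  slice Omega t `<=` shadow Omega.
Proof. by move=> y Oy; exists t. Qed.

Lemma open_shadow (n : nat) (Omega : set 'rV[R]_n.+1) : open Omega -> open (shadow Omega).
Proof. by move=> oO; apply: bigcup_open => t _; exact: open_slice. Qed.

Definition slice_fun (n : nat) (f : 'rV[R]_n.+1 -> R) (t : R) (y : 'rV[R]_n) : R :=
  f (rV_cons t y).

Lemma partial_slice (n : nat) (f : 'rV[R]_n.+1 -> R) (t : R) (i : 'I_n) :
  partial i (slice_fun f t) = slice_fun (partial (lift ord0 i) f) t.
Proof.
apply/funext => y; rewrite /partial /slice_fun /derive.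
congr (lim (_ @ 0^')); apply/funext => h /=; congr (_ *: (f _ - _)).
apply/rowP => k; rewrite [RHS]mxE [X in _ = X + _]mxE.
case: (unliftP ord0 k) => [j|] ->.
  by rewrite !rV_consS !mxE (inj_eq (@lift_inj _ ord0)).
by rewrite !rV_cons0 mxE -(inj_eq val_inj (ord0 : 'I_n.+1))/= mulr0 add0r.
Qed.

Lemma smooth_slice (n : nat) (f : 'rV[R]_n.+1 -> R) (t : R) :
  smooth f -> smooth (slice_fun f t).
Proof.
move=> sf s.
have -> : foldr partial (slice_fun f t) s =
    slice_fun (foldr partial f (map (lift ord0) s)) t.
  by elim: s => //= i s ->; rewrite partial_slice.
move=> y; apply: (@differentiable_comp _ _ _ _ (fun z => rV_cons t z)).
  exact: differentiable_rV_cons.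
exact: sf.
Qed.

Lemma test_fun_slice (n : nat) (Omega : set 'rV[R]_n.+1) (f : 'rV[R]_n.+1 -> R) (t : R) :
  test_fun Omega f -> test_fun (slice Omega t) (slice_fun f t).
Proof.
move=> [sf cf sO].
pose K := (fun y : 'rV[R]_n => rV_cons t y) @^-1` supp f.
have cK : closed K.
  by apply: closed_comp => [y _|]; [exact: continuous_rV_cons|exact: closed_closure].
have sK : supp (slice_fun f t) `<=` K.
  by apply: supp_sub => // y Ky; exact: (supp_out Ky).
split; first exact: smooth_slice.
(* The support of the slice is a closed subset of the projection of [supp f], a continuous image of
   a compact set. *)
- apply: (@subclosed_compact _ _ ((@rV_behead R n) @` supp f)).
  + exact: closed_closure.
  + apply: continuous_compact => //; apply: continuous_subspaceT.
    exact: continuous_rV_behead.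
  + by move=> y /sK Ky; exists (rV_cons t y) => //; exact: rV_behead_cons.
- by move=> y /sK/sO.
Qed.

End slices.

(** * The logistic weight *)

Section logistic.
Context {R : realType}.
Variables (b d : R).

(** The solution of w' = b w (1 - w) with w = 1/2 where b t = d: it is below exp (b t - d) and
    saturates at 1. *)
Definition logistic (t : R) : R := (1 + expR (d - b * t))^-1.

Lemma logistic_gt0 t : 0 < logistic t.
Proof. by rewrite invr_gt0 addr_gt0// expR_gt0. Qed.

Lemma logistic_lt1 t : logistic t < 1.
Proof. by rewrite invf_lt1 ?addr_gt0 ?expR_gt0// ltrDl expR_gt0. Qed.

Lemma logistic_le_exp t : logistic t <= expR (b * t - d).
Proof.
rewrite -[b * t - d]opprB expRN lef_pV2 ?posrE ?expR_gt0 ?addr_gt0 ?expR_gt0//.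
by rewrite lerDr.
Qed.

Lemma logistic_ge2V t : d <= b * t -> 2^-1 <= logistic t.
Proof.
move=> h; rewrite lef_pV2 ?posrE ?addr_gt0 ?expR_gt0//.
have : expR (d - b * t) <= 1 by rewrite -expR0 ler_expR subr_le0.
lra.
Qed.

Lemma is_derive_logistic t :
  is_derive t (1 : R) logistic (b * logistic t * (1 - logistic t)).
Proof.
have e0 : 1 + expR (d - b * t) != 0 by rewrite gt_eqF// addr_gt0// expR_gt0.
have d1 : is_derive t (1 : R) (fun t => d - b * t) (- b).
  have h : is_derive t (1 : R) (cst d - b *: id) (0 - b *: 1).
    by apply: is_deriveB; apply: is_deriveZ.
  by apply: (is_derive_eq h); rewrite sub0r [_ *: _]mulr1.
have d2 : is_derive t (1 : R) (fun t => expR (d - b * t)) (expR (d - b * t) * - b).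
  exact: is_derive1_comp.
have d3 : is_derive t (1 : R) (fun t => 1 + expR (d - b * t)) (expR (d - b * t) * - b).
  have h : is_derive t (1 : R) (cst 1 + (fun t => expR (d - b * t))) (0 + (expR (d - b * t) * - b)).
    exact: is_deriveD.
  by apply: (is_derive_eq h); rewrite add0r.
have -> : b * logistic t * (1 - logistic t) =
    - (1 + expR (d - b * t)) ^- 2 *: (expR (d - b * t) * - b).
  rewrite /logistic [RHS](_ : _ =
    (- (1 + expR (d - b * t)) ^- 2) * (expR (d - b * t) * - b)) //.
  by move: (expR _) e0 => e e0; field.
exact: is_deriveV.
Qed.

Variable n : nat.
Definition weight (x : 'rV[R]_n.+1) : R := logistic (x ord0 ord0).

Lemma differentiable_weight x : differentiable weight x.
Proof.
apply: (@differentiable_comp _ _ _ _ (fun z : 'rV[R]_n.+1 => z ord0 ord0)).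
  exact: differentiable_coord.
by apply/derivable1_diffP; have [] := is_derive_logistic (x ord0 ord0).
Qed.

Lemma partial_weight i : partial i weight =
  (fun x => (i == ord0)%:R * b * (weight x - weight x * weight x)).
Proof.
apply/funext => x; rewrite /partial.
have -> : 'D_(delta_mx ord0 i) weight x = 'D_((i == ord0)%:R : R) logistic (x ord0 ord0).
  rewrite /derive; congr (lim (_ @ 0^')); apply/funext => h /=.
  by rewrite /weight !mxE eqxx/= eq_sym.
have [i0|i0] := eqVneq i ord0.
  have [_ ->] := is_derive_logistic (x ord0 ord0).
  by rewrite mul1r mulrBr mulr1 mulrBr mulrA /weight.
by rewrite derive0 !mul0r.
Qed.

Lemma measurable_weight : measurable_fun setT weight.
Proof.
apply: measurable_rV_continuous => x.
exact/differentiable_continuous/differentiable_weight.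
Qed.

(* Since the weight w satisfies w' = b * (w - w ^ 2), this class is stable under
   partial derivatives. *)
Inductive weighted : ('rV[R]_n.+1 -> R) -> Prop :=
| weighted_smooth f : smooth f -> weighted f
| weightedM f : weighted f -> weighted (fun x => weight x * f x)
| weightedD f g : weighted f -> weighted g -> weighted (fun x => f x + g x)
| weightedZ (c : R) f : weighted f -> weighted (fun x => c * f x).

Lemma weighted_differentiable f : weighted f -> forall x, differentiable f x.
Proof.
elim=> [g sg x|g _ dg x|g h _ dg _ dh x|c g _ dg x].
- exact: smooth_differentiable.
- by apply: differentiableM => //; exact: differentiable_weight.
- exact: differentiableD.
- exact: differentiableZ.
Qed.

Lemma partial_weightM f i x : (forall x, differentiable f x) ->
  partial i (fun x => weight x * f x) x =
  weight x * partial i f x +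
    (i == ord0)%:R * b * (weight x - weight x * weight x) * f x.
Proof.
move=> df; rewrite (partialM i differentiable_weight df) partial_weight.
by congr (_ + _); rewrite mulrC.
Qed.

Lemma weighted_partial f i : weighted f -> weighted (partial i f).
Proof.
elim=> [g sg|g wg wpg|g h wg wpg wh wph|c g wg wpg].
- exact/weighted_smooth/smooth_partial.
- have dg := weighted_differentiable wg.
  rewrite (_ : partial i _ = fun x => weight x * partial i g x +
      ((i == ord0)%:R * b * (weight x * g x) +
       (- ((i == ord0)%:R * b)) * (weight x * (weight x * g x)))).
    apply: weightedD; first exact: weightedM.
    by apply: weightedD; apply: weightedZ; do ?apply: weightedM.
  by apply/funext => x; rewrite partial_weightM//; ring.
- rewrite partialD; [|exact: weighted_differentiable..].
  exact: weightedD.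
- rewrite partialZ; last exact: weighted_differentiable.
  exact: weightedZ.
Qed.

Lemma smooth_weight f : smooth f -> smooth (fun x => weight x * f x).
Proof.
move=> sf s.
have : weighted (foldr partial (fun x => weight x * f x) s).
  elim: s => [|i s IH] /=; last exact: weighted_partial.
  exact/weightedM/weighted_smooth.
by move=> /weighted_differentiable; exact.
Qed.

Lemma test_fun_weight D f : test_fun D f -> test_fun D (fun x => weight x * f x).
Proof.
move=> [sf cf fD].
have sw : supp (fun x => weight x * f x) `<=` supp f.
  apply: supp_sub; first exact: closed_closure.
  by move=> x /supp_out ->; rewrite mulr0.
split; first exact: smooth_weight.
- by apply: (subclosed_compact _ cf sw); exact: closed_closure.
- exact: subset_trans sw fD.
Qed.

End logistic.

(** * The Agmon estimate for test functions *)

Section decay.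
Context {R : realType} {n : nat}.
Local Notation leb := (lebesgue_rV n.+1).
Variables (Omega : set 'rV[R]_n.+1) (oO : open Omega).
Hypothesis Ooo : (leb Omega < +oo)%E.
Hypothesis O'oo : (lebesgue_rV n (shadow Omega) < +oo)%E.
Implicit Types (phi u : 'rV[R]_n.+1 -> R) (w c : R -> R).

Let mO : measurable Omega.
Proof. exact: measurable_rV_open. Qed.

Lemma measurable_slice t : measurable (slice Omega t).
Proof. by apply: measurable_rV_open; exact: open_slice. Qed.

Lemma measurable_shadow : measurable (shadow Omega).
Proof. by apply: measurable_rV_open; exact: open_shadow. Qed.

Lemma lebesgue_slice t : (lebesgue_rV n (slice Omega t) < +oo)%E.
Proof.
apply: le_lt_trans O'oo; apply: le_measure; rewrite ?inE.
- exact: measurable_slice.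
- exact: measurable_shadow.
- exact: slice_sub_shadow.
Qed.

Lemma measurable_fun_coord0 w : measurable_fun setT w ->
  measurable_fun setT (fun x : 'rV[R]_n.+1 => w (x ord0 ord0)).
Proof. by move=> mw; apply: measurableT_comp => //; exact: measurable_rV_coord. Qed.

Lemma sqint_coord0 w (M : R) (f : 'rV[R]_n.+1 -> R) : measurable_fun setT w ->
  (forall t, `|w t| <= M) -> sqint leb setT f ->
  sqint leb setT (fun x => w (x ord0 ord0) * f x).
Proof.
move=> mw wM; apply: (sqint_mul_bounded measurableT (M := M)) => //.
exact: measurable_fun_coord0.
Qed.

Lemma ge0_ip_coord0 w (M : R) (f : 'rV[R]_n.+1 -> R) : measurable_fun setT w ->
  (forall t, 0 <= w t <= M) -> sqint leb setT f ->
  ((ip leb setT (fun x => w (x ord0 ord0) * f x) f)%:E =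
   \int[@lebesgue_measure R]_t
     ((w t)%:E * \int[lebesgue_rV n]_y (slice_fun f t y ^+ 2)%:E))%E.
Proof.
move=> mw wM sf; have [mf _] := sf.
have wM' t : `|w t| <= M by have /andP[w0 ?] := wM t; rewrite ger0_norm.
have swf := sqint_coord0 mw wM' sf.
rewrite /ip /Rintegral fineK; last first.
  by apply: integrable_fin_num => //; exact: (sqint_integrable measurableT swf sf).
rewrite ge0_integral_rV_cons; last 2 first.
- apply/measurable_EFinP; apply: measurable_funM => //.
  by have [] := swf.
- move=> x; rewrite lee_fin -mulrA mulr_ge0 -?expr2 ?sqr_ge0//.
  by have /andP[] := wM (x ord0 ord0).
apply: eq_integral => t _.
have msl : measurable_fun setT (fun y => (slice_fun f t y ^+ 2)%:E).
  apply/measurable_EFinP; apply: measurable_funX.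
  by apply: (measurableT_comp mf); exact: measurable_rV_cons.
have w0 : 0 <= w t by have /andP[] := wM t.
have sl0 y : [set: 'rV[R]_n] y -> (0 <= (slice_fun f t y ^+ 2)%:E)%E.
  by move=> _; rewrite lee_fin sqr_ge0.
rewrite -(ge0_integralZl_EFin _ measurableT sl0 msl w0).
by apply: eq_integral => y _; rewrite rV_cons0 -EFinM -mulrA -expr2.
Qed.

(** Tonelli in x1: on the slice at t the right side is w t times the Dirichlet form of the slice of
    phi, to which the lower bound c t applies since w t >= 0. *)
Lemma slice_rayleigh phi w (M : R) c (C : R) : test_fun Omega phi ->
  measurable_fun setT w -> (forall t, 0 <= w t <= M) ->
  measurable_fun setT c -> (forall t, 0 <= c t <= C) ->
  (forall t, c t * sqn (slice_fun phi t) <= dir (slice_fun phi t) (slice_fun phi t)) ->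
  ip leb setT (fun x => w (x ord0 ord0) * c (x ord0 ord0) * phi x) phi <=
  \sum_(j < n) ip leb setT (fun x => w (x ord0 ord0) * partial (lift ord0 j) phi x)
                 (partial (lift ord0 j) phi).
Proof.
move=> tphi mw wM mc cC Rayleigh.
have sphi := test_fun_sqint mO Ooo tphi.
have spart j := test_fun_sqint_partial (lift ord0 j) mO Ooo tphi.
have tsl t := test_fun_slice t tphi.
have ssl t := test_fun_sqint (measurable_slice t) (lebesgue_slice t) (tsl t).
have sslp t j := test_fun_sqint_partial j (measurable_slice t) (lebesgue_slice t) (tsl t).
rewrite -lee_fin -sumEFin.
have -> : (\sum_(j < n) (ip leb setT (fun x => w (x ord0 ord0) * partial (lift ord0 j) phi x)
     (partial (lift ord0 j) phi))%:E =
    \sum_(j < n) \int[@lebesgue_measure R]_t ((w t)%:E *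
      \int[lebesgue_rV n]_y (slice_fun (partial (lift ord0 j) phi) t y ^+ 2)%:E))%E.
  by apply: eq_bigr => j _; exact: (ge0_ip_coord0 mw wM (spart j)).
have mwj (f : 'rV[R]_n.+1 -> R) : sqint leb setT f ->
    measurable_fun setT (fun t : measurableTypeR R => ((w t)%:E *
      \int[lebesgue_rV n]_y (slice_fun f t y ^+ 2)%:E)%E).
  move=> [mf _]; apply: emeasurable_funM; first exact/measurable_EFinP.
  apply: (@measurable_integral_rV_cons _ n (fun x => (f x ^+ 2)%:E)).
    by apply/measurable_EFinP; exact: measurable_funX.
  by move=> x; rewrite lee_fin sqr_ge0.
have int0 (f : 'rV[R]_n.+1 -> R) t : (0 <= \int[lebesgue_rV n]_y (slice_fun f t y ^+ 2)%:E)%E.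
  by apply: integral_ge0 => y _; rewrite lee_fin sqr_ge0.
have w0 t : 0 <= w t by have /andP[] := wM t.
have c0 t : 0 <= c t by have /andP[] := cC t.
rewrite -ge0_integral_sum//; last 2 first.
- by move=> j; exact: (mwj _ (spart j)).
- by move=> j t _; rewrite mule_ge0 ?lee_fin.
have mwc : measurable_fun setT (fun t => w t * c t) by exact: measurable_funM.
have wcM t : 0 <= w t * c t <= M * C.
  have /andP[_ ?] := wM t; have /andP[_ ?] := cC t.
  by rewrite mulr_ge0//= ler_pM.
rewrite (ge0_ip_coord0 (w := fun t => w t * c t) mwc wcM sphi).
apply: ge0_le_integral => //.
- by move=> t _; rewrite mule_ge0 ?lee_fin ?mulr_ge0.
- rewrite (_ : (fun _ => _) = (fun t => (c t)%:E * ((w t)%:E *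
      \int[lebesgue_rV n]_y (slice_fun phi t y ^+ 2)%:E))%E); last first.
    by apply/funext => t; rewrite muleA -EFinM mulrC.
  by apply: emeasurable_funM; [exact/measurable_EFinP|exact: mwj].
- by apply: emeasurable_sum => j; exact: mwj.
move=> t _; rewrite (ip_sqrE measurableT (ssl t)).
under eq_bigr => j _ do rewrite -partial_slice (ip_sqrE measurableT (sslp t j)).
rewrite -EFinM; under eq_bigr do rewrite -EFinM.
rewrite sumEFin lee_fin -mulr_sumr -mulrA.
by apply: ler_wpM2l => //; exact: Rayleigh.
Qed.

Definition bounded_weight w : Prop :=
  measurable_fun setT w /\ exists M, forall t, `|w t| <= M.

Lemma bounded_weight_cst (k : R) : bounded_weight (cst k).
Proof. by split; [exact: measurable_cst|exists `|k|]. Qed.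

Lemma bounded_weightD w1 w2 : bounded_weight w1 -> bounded_weight w2 ->
  bounded_weight (fun t => w1 t + w2 t).
Proof.
move=> [m1 [M1 b1]] [m2 [M2 b2]]; split; first exact: measurable_funD.
by exists (M1 + M2) => t; apply: (le_trans (ler_normD _ _)); exact: lerD.
Qed.

Lemma bounded_weightM w1 w2 : bounded_weight w1 -> bounded_weight w2 ->
  bounded_weight (fun t => w1 t * w2 t).
Proof.
move=> [m1 [M1 b1]] [m2 [M2 b2]]; split; first exact: measurable_funM.
by exists (M1 * M2) => t; rewrite normrM ler_pM.
Qed.

(** Linear and monotone in w, so that a pointwise inequality between functions of x1 becomes an
    integral estimate. *)
Definition wip w (phi : 'rV[R]_n.+1 -> R) : R :=
  ip leb setT (fun x => w (x ord0 ord0) * phi x) phi.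

Lemma wip_sqint w phi : bounded_weight w -> sqint leb setT phi ->
  sqint leb setT (fun x => w (x ord0 ord0) * phi x).
Proof. by move=> [mw [M wM]]; exact: sqint_coord0. Qed.

Lemma wipD w1 w2 phi : bounded_weight w1 -> bounded_weight w2 -> sqint leb setT phi ->
  wip (fun t => w1 t + w2 t) phi = wip w1 phi + wip w2 phi.
Proof.
move=> b1 b2 sphi.
rewrite /wip -(ipDl measurableT (wip_sqint b1 sphi) (wip_sqint b2 sphi) sphi).
by apply: eq_ip => // x _; rewrite mulrDl.
Qed.

Lemma wipZ w phi (k : R) : bounded_weight w -> sqint leb setT phi ->
  wip (fun t => k * w t) phi = k * wip w phi.
Proof.
move=> b1 sphi; rewrite /wip -(ipZl measurableT k (wip_sqint b1 sphi) sphi).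
by apply: eq_ip => // x _; rewrite mulrA.
Qed.

Lemma wip_le w1 w2 phi : bounded_weight w1 -> bounded_weight w2 -> sqint leb setT phi ->
  (forall t, w1 t <= w2 t) -> wip w1 phi <= wip w2 phi.
Proof.
move=> b1 b2 sphi w12.
apply: (ip_le measurableT (wip_sqint b1 sphi) sphi (wip_sqint b2 sphi) sphi).
by move=> x _; rewrite -!mulrA ler_wpM2r// -expr2 sqr_ge0.
Qed.

Lemma wip_cst k phi : sqint leb setT phi -> wip (cst k) phi = k * sqn phi.
Proof. by move=> sphi; rewrite /wip ipZl. Qed.

Lemma measurable_logistic (b d : R) : measurable_fun setT (logistic b d).
Proof.
apply: continuous_measurable_fun => t.
have [dt _] := is_derive_logistic b d t.
by apply: differentiable_continuous; apply/derivable1_diffP.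
Qed.

Lemma bounded_logistic (b d : R) : bounded_weight (logistic b d).
Proof.
split; first exact: measurable_logistic.
by exists 1 => t; rewrite ger0_norm ltW ?logistic_gt0 ?logistic_lt1.
Qed.

Section decay_estimate.
Variables (s kappa a l mu' : R).
Hypotheses (s1 : s ^+ 2 = 1) (kappa0 : 0 <= kappa) (mu'0 : 0 <= mu') (mu'l : mu' <= l).
Hypothesis a0 : 0 < a.
Hypothesis slice_mu' : forall t (phi : 'rV[R]_n -> R), test_fun (slice Omega t) phi -> mu' * sqn phi <= dir phi phi.
Hypothesis slice_large : forall t, a < s * t -> forall phi : 'rV[R]_n -> R, test_fun (slice Omega t) phi ->
  (l + kappa ^+ 2) * sqn phi <= dir phi phi.

(** The sign s selects one end of the horn. With these b and d the weight is at least 1/2 where s t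
    >= 2 a and at most exp (- 2 kappa a) where s t <= a. The rate is 2 kappa because eta'^2 / (4
    eta) then equals kappa^2 eta (1 - eta)^2. *)
Let b := s * (2 * kappa).
Let d := 4 * kappa * a.
Let c t := if a < s * t then l + kappa ^+ 2 else mu'.

Definition half_line t : R := \1_[set t | 2 * a <= s * t] t.

Lemma measurable_half_line : measurable_fun setT half_line.
Proof.
apply: measurable_indic.
rewrite (_ : [set t | _] = (fun t => s * t) @^-1` `[2 * a, +oo[); last first.
  by apply/seteqP; split => t /=; rewrite in_itv/= andbT.
rewrite -[X in measurable X]setTI; apply: measurable_funM => //.
Qed.

Lemma bounded_half_line : bounded_weight half_line.
Proof.
split; first exact: measurable_half_line.
by exists 1 => t; rewrite /half_line indicE; case: (_ \in _); rewrite ?normr1 ?normr0.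
Qed.

Let l0 : 0 <= l := le_trans mu'0 mu'l.

Let cC t : 0 <= c t <= l + kappa ^+ 2.
Proof.
by rewrite /c; case: ifP => _; rewrite ?addr_ge0 ?sqr_ge0//= mu'0 (le_trans mu'l)// lerDl sqr_ge0.
Qed.

Let mc : measurable_fun setT c.
Proof.
have mlt : measurable_fun setT (fun t => a < s * t).
  by apply: measurable_fun_ltr => //; apply: measurable_funM.
by apply: measurable_fun_if => //; exact: measurable_cst.
Qed.

Let bc : bounded_weight c.
Proof. by split => //; exists (l + kappa ^+ 2) => t; have /andP[c0 ?] := cC t; rewrite ger0_norm. Qed.

(** Where s t > a, the gain kappa^2 eta exceeds the loss kappa^2 eta (1 - eta)^2 by kappa^2 eta^2 (2
    - eta), which increases with eta and is 3/8 kappa^2 at eta = 1/2. Where s t <= a, the deficit is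
    at most (l - mu' + kappa^2) eta, and eta is exponentially small. *)
Let weight_bound t : 3 / 8 * kappa ^+ 2 * half_line t + l * logistic b d t <=
  (l - mu' + kappa ^+ 2) * expR (- (2 * kappa * a)) +
  (- kappa ^+ 2 * (logistic b d t * (1 - logistic b d t) ^+ 2) + logistic b d t * c t).
Proof.
have e0 := expR_gt0 (- (2 * kappa * a)).
have eta0 := logistic_gt0 b d t; have eta1 := logistic_lt1 b d t.
have k2 := sqr_ge0 kappa.
have dl : 0 <= l - mu' by rewrite subr_ge0.
rewrite /half_line indicE /c; case: ifPn => [ast|].
  have [|_] := boolP (t \in _); last first.
    rewrite mulr0 add0r.
    have : 0 <= (l - mu' + kappa ^+ 2) * expR (- (2 * kappa * a)).
      by apply: mulr_ge0; [exact: addr_ge0|exact: ltW].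
    have : 0 <= kappa ^+ 2 * (logistic b d t ^+ 2 * (2 - logistic b d t)).
      by rewrite !mulr_ge0 ?sqr_ge0//; lra.
    by move: (logistic b d t) (expR _) (kappa ^+ 2) => eta e k; lra.
  rewrite inE/= => ast2.
  have : 2^-1 <= logistic b d t.
    apply: logistic_ge2V; rewrite /b /d.
    have := ler_wpM2l kappa0 ast2; lra.
  have : 0 <= (l - mu' + kappa ^+ 2) * expR (- (2 * kappa * a)).
    by apply: mulr_ge0; [exact: addr_ge0|exact: ltW].
  move: (_ * expR _) => X X0 h.
  have : 0 <= kappa ^+ 2 * (logistic b d t ^+ 2 * (2 - logistic b d t) - 3 / 8).
    (* eta^2 (2 - eta) - 3/8 vanishes at eta = 1/2; the cofactor is positive on (0, 1). *)
    apply: mulr_ge0 => //; rewrite (_ : _ - _ = (logistic b d t - 2^-1) *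
      (3 / 4 + logistic b d t / 2 + logistic b d t * (1 - logistic b d t))); last by field.
    by rewrite mulr_ge0 ?subr_ge0// !addr_ge0 ?divr_ge0 ?mulr_ge0 ?subr_ge0// ltW.
  by move: (logistic b d t) (kappa ^+ 2) X0 => eta k; lra.
rewrite -leNgt => sta.
have -> : (t \in [set t | 2 * a <= s * t]) = false.
  by apply/negbTE/negP; rewrite inE/= => ast2; move: a0 sta ast2; lra.
have : logistic b d t <= expR (- (2 * kappa * a)).
  apply: (le_trans (logistic_le_exp b d t)); rewrite ler_expR /b /d.
  by have := ler_wpM2l kappa0 sta; lra.
rewrite mulr0 add0r => le_e.
have : 0 <= (l - mu' + kappa ^+ 2) * (expR (- (2 * kappa * a)) - logistic b d t).
  by apply: mulr_ge0; [exact: addr_ge0|rewrite subr_ge0].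
have : 0 <= kappa ^+ 2 * (logistic b d t * (1 - (1 - logistic b d t) ^+ 2)).
  apply: mulr_ge0 => //; apply: mulr_ge0; first exact: ltW.
  by move: (logistic b d t) eta0 eta1 => eta; nra.
by move: (logistic b d t) (expR _) (kappa ^+ 2) => eta e k; lra.
Qed.

(** The last bracket is the residual of phi in the eigenvalue equation against eta phi, kept because
    phi only approximates an eigenfunction. *)
Lemma decay_test phi : test_fun Omega phi ->
  3 / 8 * kappa ^+ 2 * wip half_line phi <=
  (l - mu' + kappa ^+ 2) * expR (- (2 * kappa * a)) * sqn phi +
  (dir phi (fun x => weight b d x * phi x) -
   l * ip leb setT phi (fun x => weight b d x * phi x)).
Proof.
move=> tphi.
pose eta := logistic b d; pose psi x := weight b d x * phi x.
have beta : bounded_weight eta := bounded_logistic b d.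
have sphi := test_fun_sqint mO Ooo tphi.
have spart i := test_fun_sqint_partial i mO Ooo tphi.
have tpsi : test_fun Omega psi by exact: test_fun_weight.
have spsip i := test_fun_sqint_partial i mO Ooo tpsi.
have dphi : forall x, differentiable phi x.
  by have [sm _ _] := tphi => x; exact: smooth_differentiable.
(* The weight depends on x1 alone, so it commutes with the other derivatives, and only the x1 term
   needs the square to be completed. *)
have dirE : dir phi psi = ip leb setT (partial ord0 phi) (partial ord0 psi) +
    \sum_(j < n) ip leb setT (fun x => eta (x ord0 ord0) * partial (lift ord0 j) phi x)
                 (partial (lift ord0 j) phi).
  have tr j : partial (lift ord0 j) psi =
      fun x => eta (x ord0 ord0) * partial (lift ord0 j) phi x.
    apply/funext => x; rewrite partial_weightM//.
    by rewrite (_ : (lift ord0 j == ord0) = false)// !mul0r addr0.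
  rewrite /dir big_ord_recl.
  apply: congr1.
  apply: eq_bigr => j _.
  by rewrite tr; exact: (ipC leb setT).
have slices : wip (fun t => eta t * c t) phi <=
    \sum_(j < n) ip leb setT (fun x => eta (x ord0 ord0) * partial (lift ord0 j) phi x)
                 (partial (lift ord0 j) phi).
  have eta01 t : 0 <= eta t <= 1 by rewrite !ltW ?logistic_gt0 ?logistic_lt1.
  apply: (slice_rayleigh tphi (measurable_logistic b d) eta01 mc cC) => t.
  have tsl := test_fun_slice t tphi.
  by rewrite /c; case: ifPn => [ast|_]; [exact: (slice_large ast tsl)|exact: (slice_mu' tsl)].
pose w1 t := - kappa ^+ 2 * (eta t * (1 - eta t) ^+ 2).
have b1 : bounded_weight w1.
  apply: (bounded_weightM (bounded_weight_cst _)); apply: (bounded_weightM beta).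
  have bm : bounded_weight (fun t => 1 + -1 * eta t).
    apply: (bounded_weightD (bounded_weight_cst _)).
    exact: (bounded_weightM (bounded_weight_cst _)).
  rewrite (_ : (fun _ => _) = (fun t => (1 + -1 * eta t) * (1 + -1 * eta t))).
    exact: bounded_weightM.
  by apply/funext => t; rewrite mulN1r expr2.
(* eta f^2 + eta' f phi + kappa^2 eta (1 - eta)^2 phi^2 is a square times eta *)
have first_dir : wip w1 phi <= ip leb setT (partial ord0 phi) (partial ord0 psi).
  apply: (ip_le measurableT (wip_sqint b1 sphi) sphi (spart ord0) (spsip ord0)).
  move=> x _; rewrite partial_weightM// eqxx mul1r /w1 /weight -/eta.
  have eta0 : 0 <= eta (x ord0 ord0) by exact/ltW/logistic_gt0.
  have : 0 <= eta (x ord0 ord0) *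
      (partial ord0 phi x + s * kappa * (1 - eta (x ord0 ord0)) * phi x) ^+ 2.
    by apply: mulr_ge0 => //; exact: sqr_ge0.
  move: (eta _) (partial _ _ _) (phi x) => e f p h; rewrite -subr_ge0 /b.
  have -> : - kappa ^+ 2 = - (s ^+ 2 * kappa ^+ 2) by rewrite s1 mul1r.
  by rewrite [X in _ <= X](_ : _ = e * (f + s * kappa * (1 - e) * p) ^+ 2)//; ring.
have bce : bounded_weight (fun t => eta t * c t) by exact: bounded_weightM.
have cb k : bounded_weight (fun=> k) := bounded_weight_cst k.
have bh := bounded_half_line.
have key : wip (fun t => 3 / 8 * kappa ^+ 2 * half_line t + l * eta t) phi <=
   wip (fun t => (l - mu' + kappa ^+ 2) * expR (- (2 * kappa * a)) +
     (w1 t + eta t * c t)) phi.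
  refine (wip_le _ _ sphi weight_bound).
    exact: (bounded_weightD (bounded_weightM (cb _) bh) (bounded_weightM (cb _) beta)).
  exact: (bounded_weightD (cb _) (bounded_weightD b1 bce)).
rewrite (wipD (bounded_weightM (cb _) bh) (bounded_weightM (cb _) beta) sphi) in key.
rewrite (wipZ _ bh sphi) (wipZ _ beta sphi) in key.
rewrite (wipD (cb _) (bounded_weightD b1 bce) sphi) (wipD b1 bce sphi) in key.
rewrite (wip_cst _ sphi) in key.
have E : ip leb setT phi (fun x => weight b d x * phi x) = wip eta phi by rewrite ipC.
rewrite E -/psi dirE.
move: key slices first_dir.
move: (wip half_line phi) (wip eta phi) (sqn phi) (wip w1 phi) (wip _ phi) => x1 x2 x3 x4 x5.
move: (\sum_(j < n) _) (ip _ _ _ _) (expR _) (3 / 8 * _) => x6 x7 x8 x9.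
move: (_ * x8) => x10; lra.
Qed.

End decay_estimate.
End decay.

(** * Passage of the Agmon estimate to the eigenfunction *)

Section decay_eigenfunction.
Context {R : realType} {n : nat}.
Local Notation leb := (lebesgue_rV n.+1).
Variables (Omega : set 'rV[R]_n.+1) (oO : open Omega).
Hypothesis Ooo : (leb Omega < +oo)%E.
Hypothesis O'oo : (lebesgue_rV n (shadow Omega) < +oo)%E.
Implicit Types (Phi : ('rV[R]_n.+1 -> R)^nat) (phi u : 'rV[R]_n.+1 -> R) (w : R -> R).

Let mO : measurable Omega.
Proof. exact: measurable_rV_open. Qed.

Lemma sqn_weight_le b d phi : test_fun Omega phi ->
  sqn (fun x => weight b d x * phi x) <= sqn phi.
Proof.
move=> tphi.
have s1 := test_fun_sqint mO Ooo tphi.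
have s2 := test_fun_sqint mO Ooo (test_fun_weight b d tphi).
apply: (ip_le measurableT s2 s2 s1 s1) => x _.
rewrite -!expr2 exprMn ler_piMl ?sqr_ge0// expr_le1// ltW ?logistic_gt0 ?logistic_lt1//.
Qed.

(** Makes the weighted functions admissible in the last clause of [eigen_approx]. Only boundedness
    matters, so the derivative of the weight is charged to all n.+1 directions alike. *)
Lemma dir_weight_le b d phi : test_fun Omega phi ->
  dir (fun x => weight b d x * phi x) (fun x => weight b d x * phi x) <=
  2 * dir phi phi + n.+1%:R * (2 * b ^+ 2 * sqn phi).
Proof.
move=> tphi.
have s1 := test_fun_sqint mO Ooo tphi.
have sp i := test_fun_sqint_partial i mO Ooo tphi.
have dphi : forall x, differentiable phi x.
  by have [sm _ _] := tphi => x; exact: smooth_differentiable.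
have w01 x : 0 <= @weight R b d n x <= 1.
  by rewrite !ltW ?logistic_gt0 ?logistic_lt1.
have mw := @measurable_weight R b d n.
have -> : n.+1%:R * (2 * b ^+ 2 * sqn phi) = \sum_(i < n.+1) (2 * b ^+ 2 * sqn phi).
  by rewrite sumr_const card_ord mulr_natl.
rewrite /dir mulr_sumr -big_split/=; apply: ler_sum => i _.
pose A x := weight b d x * partial i phi x.
pose B x := (i == ord0)%:R * b * (weight b d x - weight b d x * weight b d x) * phi x.
have sA : sqint leb setT A.
  apply: (sqint_mul_bounded measurableT (M := 1) mw) => // x _.
  by have /andP[w0 w1] := w01 x; rewrite ger0_norm.
have B1 (x : 'rV[R]_n.+1) : `|(i == ord0)%:R * b * (weight b d x - weight b d x * weight b d x)| <= `|b|.
  have /andP[w0 w1] := w01 x.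
  have : 0 <= weight b d x - weight b d x * weight b d x <= 1 by nra.
  move=> /andP[v0 v1]; rewrite !normrM (ger0_norm v0) normr_nat.
  by case: eqP => _; rewrite ?mul0r// mul1r ler_piMr.
have mB : measurable_fun setT (fun x => (i == ord0)%:R * b * (weight b d x - weight b d x * @weight R b d n x)).
  by do ?[apply: measurable_funM|apply: measurable_funB].
have sB : sqint leb setT B.
  by apply: (sqint_mul_bounded measurableT (M := `|b|) mB).
have E : partial i (fun x => weight b d x * phi x) = fun x => A x + B x.
  by apply/funext => x; rewrite partial_weightM.
have hA : ip leb setT A A <= ip leb setT (partial i phi) (partial i phi).
  apply: (ip_le measurableT sA sA (sp i) (sp i)) => x _.
  have /andP[w0 w1] := w01 x.
  by rewrite -!expr2 exprMn ler_piMl ?sqr_ge0// expr_le1.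
have hB : ip leb setT B B <= b ^+ 2 * sqn phi.
  rewrite /sqn -(ipZl measurableT (b ^+ 2) s1 s1).
  apply: (ip_le measurableT sB sB (sqintZ measurableT _ s1) s1) => x _.
  rewrite -[leRHS]mulrA -[phi x * phi x]expr2 -[leLHS]expr2 /B exprMn.
  apply: ler_wpM2r; first exact: sqr_ge0.
  rewrite -(real_normK (num_real b)) -[leLHS](real_normK (num_real _)).
  by rewrite lerXn2r ?nnegrE.
have := ip_ge0 leb setT (fun x => A x - B x).
rewrite (ip_sqrB measurableT sA sB) E (ip_sqrD measurableT sA sB).
move: hA hB; move: (ip leb setT A A) (ip leb setT B B) (ip leb setT A B) => x y z.
by move: (ip _ _ _ _) (sqn phi) => p q; nra.
Qed.

Lemma cvg_bounded_ub (v : R^nat) (L : R) : v @ \oo --> L -> exists M, forall k, v k <= M.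
Proof.
move=> vL; have /cvg_seq_bounded[M [_ /(_ (M + 1)) HM]] : cvgn v by apply/cvg_ex; exists L.
exists (M + 1) => k; apply: (le_trans (ler_norm _)).
by apply: HM => //; rewrite ltrDl.
Qed.

Lemma weighted_residual b d l u Phi : eigen_approx Omega l u Phi ->
  dir (Phi k) (fun x => weight b d x * Phi k x) -
  l * ip leb setT (Phi k) (fun x => weight b d x * Phi k x) @[k --> \oo] --> 0.
Proof.
move=> [t _ c1 c2 res].
have [M1 M1P] := cvg_bounded_ub c1; have [M2 M2P] := cvg_bounded_ub c2.
have tw k := test_fun_weight b d (t k).
apply: (res (Num.max M1 (2 * M2 + n.+1%:R * (2 * b ^+ 2 * M1))) _ tw) => k.
  by apply: (le_trans (sqn_weight_le b d (t k))); rewrite le_max M1P.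
apply: (le_trans (dir_weight_le b d (t k))); rewrite le_max; apply/orP; right.
apply: lerD; first by rewrite ler_wpM2l.
by apply: ler_wpM2l => //; apply: ler_wpM2l => //; rewrite mulr_ge0 ?sqr_ge0.
Qed.

Lemma cvg_wip l u Phi w : eigen_approx Omega l u Phi -> sqint leb Omega u ->
  bounded_weight w ->
  wip w (Phi k) @[k --> \oo] --> ip leb Omega (fun x => w (x ord0 ord0) * u x) u.
Proof.
move=> [t cu _ _ _] su [mw [M wM]].
have mwO : measurable_fun Omega (fun x => w (x ord0 ord0)).
  by apply: measurable_funTS; exact: measurable_fun_coord0.
have sphi k := test_sqint mO Ooo (t k).
have sM f : sqint leb Omega f -> sqint leb Omega (fun x => w (x ord0 ord0) * f x).
  by move=> sf; apply: (sqint_mul_bounded mO (M := M) mwO).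
rewrite (_ : (fun k => _) = fun k => ip leb Omega (fun x => w (x ord0 ord0) * Phi k x) (Phi k)); last first.
  by apply/funext => k; rewrite /wip (ip_test _ (t k)).
apply: (cvg_ip mO (fun k => sM _ (sphi k)) sphi (sM _ su) su _ cu).
have c0 : (M ^+ 2 * ip leb Omega (fun x => Phi k x - u x) (fun x => Phi k x - u x)) @[k --> \oo] --> 0.
  by rewrite -(mulr0 (M ^+ 2)); exact: cvgMr.
apply: (squeeze_cvgr _ (cvg_cst 0) c0); apply: nearW => k.
rewrite ip_ge0/=.
have sd := sqintB mO (sphi k) su.
rewrite -(ipZl mO _ sd sd).
apply: (ip_le mO) => //.
- exact: (sqintB mO (sM _ (sphi k)) (sM _ su)).
- exact: (sqintB mO (sM _ (sphi k)) (sM _ su)).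
- exact: (sqintZ mO _ sd).
move=> x _; rewrite -mulrBr -expr2 exprMn -mulrA -expr2 ler_wpM2r ?sqr_ge0//.
rewrite -[leLHS](real_normK (num_real _)).
by rewrite lerXn2r ?nnegrE// (le_trans _ (wM 0)).
Qed.

Lemma eigenfunction_decay (s kappa a l mu' : R) u Phi : s ^+ 2 = 1 -> 0 <= kappa ->
  0 <= mu' -> mu' <= l -> 0 < a ->
  (forall t (f : 'rV[R]_n -> R), test_fun (slice Omega t) f -> mu' * sqn f <= dir f f) ->
  (forall t, a < s * t -> forall f : 'rV[R]_n -> R, test_fun (slice Omega t) f ->
    (l + kappa ^+ 2) * sqn f <= dir f f) ->
  eigen_approx Omega l u Phi -> sqint leb Omega u ->
  3 / 8 * kappa ^+ 2 * ip leb Omega (fun x => half_line s a (x ord0 ord0) * u x) u <=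
  (l - mu' + kappa ^+ 2) * expR (- (2 * kappa * a)) * ip leb Omega u u.
Proof.
move=> s1 k0 mu'0 mu'l a0 H1 H2 ea su.
have [t _ c1 _ _] := ea.
have ch := cvg_wip ea su (bounded_half_line s a).
have cr := weighted_residual (s * (2 * kappa)) (4 * kappa * a) ea.
have cL : 3 / 8 * kappa ^+ 2 * wip (half_line s a) (Phi k) @[k --> \oo] -->
  3 / 8 * kappa ^+ 2 * ip leb Omega (fun x => half_line s a (x ord0 ord0) * u x) u.
  exact: cvgMr.
have cR : (l - mu' + kappa ^+ 2) * expR (- (2 * kappa * a)) * sqn (Phi k) +
    (dir (Phi k) (fun x => weight (s * (2 * kappa)) (4 * kappa * a) x * Phi k x) -
     l * ip leb setT (Phi k) (fun x => weight (s * (2 * kappa)) (4 * kappa * a) x * Phi k x))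
    @[k --> \oo] -->
    (l - mu' + kappa ^+ 2) * expR (- (2 * kappa * a)) * ip leb Omega u u + 0.
  by apply: cvgD; [exact: cvgMr|exact: cr].
rewrite -[leRHS]addr0 -(cvg_lim _ cL)// -(cvg_lim _ cR)//; apply: ler_lim.
- by apply/cvg_ex; eexists; exact: cL.
- by apply/cvg_ex; eexists; exact: cR.
- apply: nearW => k.
  exact: (decay_test oO Ooo O'oo s1 k0 mu'0 mu'l a0 H1 H2 (t k)).
Qed.

End decay_eigenfunction.

(** * Strict inequality between the eigenvalues of Omega and its shadow *)

Section strict.
Context {R : realType} {n : nat}.
Local Notation leb := (lebesgue_rV n.+1).
Variables (Omega : set 'rV[R]_n.+1) (oO : open Omega).
Hypothesis Ooo : (leb Omega < +oo)%E.
Hypothesis O'oo : (lebesgue_rV n (shadow Omega) < +oo)%E.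
Implicit Types (Phi : ('rV[R]_n.+1 -> R)^nat) (phi u : 'rV[R]_n.+1 -> R).

Let mO : measurable Omega.
Proof. exact: measurable_rV_open. Qed.

Lemma dir_slice_ge (mu' : R) phi : 0 <= mu' ->
  (forall t (f : 'rV[R]_n -> R), test_fun (slice Omega t) f -> mu' * sqn f <= dir f f) ->
  test_fun Omega phi ->
  ip leb setT (partial ord0 phi) (partial ord0 phi) + mu' * sqn phi <= dir phi phi.
Proof.
move=> mu'0 Rayleigh tphi.
have sphi := test_fun_sqint mO Ooo tphi.
rewrite /dir big_ord_recl; apply: lerD => //.
have b1 (t : R) : 0 <= cst (1 : R) t <= (1 : R) by rewrite /= ler01 lexx.
have b2 (t : R) : 0 <= cst mu' t <= mu' by rewrite /= mu'0 lexx.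
have H t : cst mu' t * sqn (slice_fun phi t) <= dir (slice_fun phi t) (slice_fun phi t).
  by apply: Rayleigh; exact: test_fun_slice.
have := slice_rayleigh oO Ooo O'oo tphi (measurable_cst _) b1 (measurable_cst _) b2 H.
rewrite /= mul1r (ipZl measurableT mu' sphi sphi) => h.
apply: (le_trans h); rewrite le_eqVlt; apply/orP; left; apply/eqP.
apply: eq_bigr => j _; apply: eq_ip => // x _.
by rewrite mul1r.
Qed.

(** w - w^2 is the derivative of w = [logistic 1 0], so this integrates the x1-derivative of w
    phi^2. It controls a norm of phi with positive weight by the x1-derivative alone. *)
Lemma wip_logistic phi : test_fun Omega phi ->
  wip (fun t => logistic 1 0 t + -1 * (logistic 1 0 t * logistic 1 0 t)) phi =
  -2 * ip leb setT (fun x => weight 1 0 x * phi x) (partial ord0 phi).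
Proof.
move=> tphi.
have tpsi := test_fun_weight 1 0 tphi.
have s1 := test_fun_sqint mO Ooo tphi.
have s2 := test_fun_sqint mO Ooo tpsi.
have p1 := test_fun_sqint_partial ord0 mO Ooo tphi.
have p2 := test_fun_sqint_partial ord0 mO Ooo tpsi.
have dphi : forall x, differentiable phi x.
  by have [sm _ _] := tphi => x; exact: smooth_differentiable.
have IBP := ip_partial (test_fun_C1 tphi) (test_fun_C1 tpsi) s1 s2 p1 p2.
have bl := bounded_logistic (1 : R) 0.
have bw := bounded_weightD bl (bounded_weightM (bounded_weight_cst (-1)) (bounded_weightM bl bl)).
have sw := wip_sqint bw s1.
have sf := wip_sqint bl p1.
have E : ip leb setT phi (partial ord0 (fun x => weight 1 0 x * phi x)) =
    ip leb setT (fun x => weight 1 0 x * phi x) (partial ord0 phi) +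
    wip (fun t => logistic 1 0 t + -1 * (logistic 1 0 t * logistic 1 0 t)) phi.
  rewrite [in RHS]/wip [X in _ + X](ipC leb setT).
  have -> : ip leb setT (fun x => weight 1 0 x * phi x) (partial ord0 phi) =
      ip leb setT phi (fun x => logistic 1 0 (x ord0 ord0) * partial ord0 phi x).
    by rewrite /ip; apply: eq_Rintegral => x _; rewrite mulrCA mulrA.
  rewrite -(ipDr measurableT sf sw s1); apply: eq_ip => // x _.
  by rewrite partial_weightM// eqxx !mul1r mulN1r.
rewrite E in IBP.
move: IBP; move: (wip _ _) (ip _ _ _ _) => x y h.
by rewrite mulNr mulr_natl mulr2n opprD -{1}h [y + x]addrC addrK.
Qed.

(** If l <= mu', [dir_slice_ge] bounds the squared x1-derivative of Phi k by dir - l sqn, which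
    tends to 0. By [wip_logistic] the integral of (w - w^2) u^2 is then 0, although w - w^2 > 0. *)
Lemma eigenvalue_gt_shadow (l mu' : R) u Phi : 0 <= mu' ->
  (forall t (f : 'rV[R]_n -> R), test_fun (slice Omega t) f -> mu' * sqn f <= dir f f) ->
  eigen_approx Omega l u Phi -> sqint leb Omega u ->
  ~ {ae leb, forall x, Omega x -> u x = 0} -> mu' < l.
Proof.
move=> mu'0 Rayleigh ea su nu; rewrite ltNge; apply/negP => lmu; apply: nu.
have [t cu c1 c2 _] := ea.
have cf : ip leb setT (partial ord0 (Phi k)) (partial ord0 (Phi k)) @[k --> \oo] --> 0.
  have c3 : dir (Phi k) (Phi k) - l * sqn (Phi k) @[k --> \oo] --> 0.
    by rewrite -(subrr (l * ip leb Omega u u)); apply: cvgB => //; exact: cvgMr.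
  apply: (squeeze_cvgr _ (cvg_cst 0) c3); apply: nearW => k.
  rewrite ip_ge0/= lerBrDr; apply: le_trans (dir_slice_ge mu'0 Rayleigh (t k)).
  by rewrite lerD2l ler_wpM2r// sqn_ge0.
have [M MP] := cvg_bounded_ub c1.
have bl := bounded_logistic (1 : R) 0.
have bw := bounded_weightD bl (bounded_weightM (bounded_weight_cst (-1)) (bounded_weightM bl bl)).
have c4 : wip (fun t => logistic 1 0 t + -1 * (logistic 1 0 t * logistic 1 0 t)) (Phi k)
    @[k --> \oo] --> 0.
  rewrite (_ : (fun k => _) = fun k => -2 *
      ip leb setT (fun x => weight 1 0 x * Phi k x) (partial ord0 (Phi k))); last first.
    by apply/funext => k; exact: wip_logistic.
  rewrite -[X in _ --> X](mulr0 (-2)); apply: cvgMr; apply: (cvg_bounded_mul0 (M := M) cf) => k.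
  have tpsi := test_fun_weight 1 0 (t k).
  apply: (le_trans (cauchy_schwarz measurableT (test_fun_sqint mO Ooo tpsi)
    (test_fun_sqint_partial ord0 mO Ooo (t k)))).
  rewrite mulrC; apply: ler_wpM2l; first exact: ip_ge0.
  exact: (le_trans (sqn_weight_le oO Ooo 1 0 (t k))).
have c5 := cvg_wip oO Ooo ea su bw.
have : ip leb Omega (fun x => (logistic 1 0 (x ord0 ord0) +
    -1 * (logistic 1 0 (x ord0 ord0) * logistic 1 0 (x ord0 ord0))) * u x) u = 0.
  rewrite -[RHS](cvg_lim _ c4)//; apply/esym/cvg_lim => //; exact: c5.
(* The root of the weight is absorbed in v, so that [ip_eq0] applies to the weighted integral. *)
pose v (x : 'rV[R]_n.+1) := Num.sqrt (logistic 1 0 (x ord0 ord0) * (1 - logistic 1 0 (x ord0 ord0))) * u x.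
have h0 (x : 'rV[R]_n.+1) : 0 < logistic 1 0 (x ord0 ord0) * (1 - logistic 1 0 (x ord0 ord0)) :> R.
  by rewrite mulr_gt0 ?logistic_gt0// subr_gt0 logistic_lt1.
have -> : ip leb Omega (fun x => (logistic 1 0 (x ord0 ord0) +
    -1 * (logistic 1 0 (x ord0 ord0) * logistic 1 0 (x ord0 ord0))) * u x) u = ip leb Omega v v.
  rewrite /ip; apply: eq_Rintegral => x _; rewrite /v [RHS]mulrACA -[Num.sqrt _ * _]expr2.
  by rewrite sqr_sqrtr ?ltW// mulN1r mulrBr mulr1 mulrA.
move/(ip_eq0 mO).
have sv : sqint leb Omega v.
  have mroot : measurable_fun setT (fun x : 'rV[R]_n.+1 =>
      Num.sqrt (logistic 1 0 (x ord0 ord0) * (1 - logistic 1 0 (x ord0 ord0))) : R).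
    apply: (@measurable_fun_coord0 _ n (fun t => Num.sqrt (logistic 1 0 t * (1 - logistic 1 0 t)))).
    apply: (measurableT_comp (continuous_measurable_fun (@sqrt_continuous R))).
    by have [ml _] := bl; apply: measurable_funM => //; exact: measurable_funB.
  apply: (sqint_mul_bounded mO (M := 1) (measurable_funTS mroot)) => // x _.
  rewrite ger0_norm ?sqrtr_ge0// -[leRHS]sqrtr1 ler_wsqrtr//.
  rewrite mulr_ile1 ?subr_ge0 ?lerBlDr ?lerDl ?ltW ?logistic_gt0 ?logistic_lt1//.
move=> /(_ sv); apply: filterS => x vx Ox; apply/eqP.
have /eqP := vx Ox; rewrite /v mulf_eq0 => /orP[|//].
by rewrite sqrtr_eq0 leNgt h0.
Qed.

End strict.

(** * Numerical inequalities *)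

Section numerics.
Context {R : realType}.

Lemma expR_le_inv (x : R) : x < 1 -> expR x <= (1 - x)^-1.
Proof.
move=> x1; rewrite -[x in expR x]opprK expRN lef_pV2 ?posrE ?expR_gt0 ?subr_gt0//.
exact: expR_ge1Dx.
Qed.

(** 16/3 is twice 8/3, the inverse of 3/8, for the two ends of the horn. From 2 L >= 3 the prefactor
    is at most 8, while the exponential is at most 2 (eps / q)^2 <= eps / 9. *)
Lemma tail_numerics (q eps : R) : 3 <= q -> 0 < eps -> eps <= 2^-1 ->
  let L := ln (q / eps) in
  3 / 2 <= L /\
  16 / 3 * (2 * L / (2 * L - 1)) * expR (- Num.sqrt (2 * L * (2 * L - 1))) <= eps.
Proof.
move=> q3 e0 e2 L.
have q0 : 0 < q by apply: lt_le_trans q3.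
have qe : 6 <= q / eps.
  by rewrite ler_pdivlMr//; lra.
have L32 : 3 / 2 <= L.
  rewrite -(expRK (3 / 2 : R)) /L ler_ln ?posrE ?expR_gt0 ?divr_gt0//.
  apply: le_trans qe.
  have -> : 3 / 2 = 3 / 10 * 5%:R :> R by field.
  rewrite expRM_natr.
  (* The bound 1 / (1 - x) is good only for small x, so 3/2 is cut into five parts; (10/7)^5 < 6. *)
  have h : expR (3 / 10 : R) <= 10 / 7.
    rewrite (_ : 10 / 7 = (1 - 3 / 10)^-1); last by field.
    by apply: expR_le_inv; lra.
  apply: (@le_trans _ _ ((10 / 7) ^+ 5)).
    by rewrite lerXn2r ?nnegrE ?expR_ge0//; lra.
  by lra.
split => //.
have eL : expR (- L) = eps / q.
  by rewrite expRN /L lnK ?posrE ?divr_gt0// invf_div.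
(* The root is close to 2 L - 1/2 for large L; 3/5 leaves room, and exp (3/5) is still at most 2. *)
have s06 : 2 * L - 3 / 5 <= Num.sqrt (2 * L * (2 * L - 1)).
  rewrite -[leLHS]ger0_norm; last by lra.
  by rewrite -sqrtr_sqr ler_wsqrtr//; nra.
have e06 : expR (3 / 5 : R) <= 2.
  have -> : 3 / 5 = 1 / 5 * 3%:R :> R by field.
  rewrite expRM_natr.
  have h : expR (1 / 5 : R) <= 5 / 4.
    rewrite (_ : 5 / 4 = (1 - 1 / 5)^-1); last by field.
    by apply: expR_le_inv; lra.
  apply: (@le_trans _ _ ((5 / 4) ^+ 3)); last by lra.
  by rewrite lerXn2r ?nnegrE ?expR_ge0//; lra.
have h1 : expR (- Num.sqrt (2 * L * (2 * L - 1))) <= (eps / q) ^+ 2 * 2.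
  apply: (@le_trans _ _ (expR (- L * 2%:R + 3 / 5))); first by rewrite ler_expR; lra.
  rewrite expRD expRM_natr eL ler_wpM2l ?sqr_ge0//.
have h2 : 2 * L / (2 * L - 1) <= 3 / 2 by rewrite ler_pdivrMr; lra.
have h3 : (eps / q) ^+ 2 * 2 <= eps / 9.
  have x6 : eps / q <= 6^-1 by rewrite ler_pdivrMr//; lra.
  have x0 : 0 < eps / q by rewrite divr_gt0.
  rewrite [X in _ <= X / 9](_ : _ = eps / q * q); last by rewrite divfK// gt_eqF.
  by move: (eps / q) x6 x0 => x x6 x0; nra.
have p0 := expR_gt0 (- Num.sqrt (2 * L * (2 * L - 1))).
have h4 : 0 <= 2 * L / (2 * L - 1) by rewrite divr_ge0; lra.
apply: (@le_trans _ _ (16 / 3 * (3 / 2) * (eps / 9))); last by lra.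
apply: ler_pM => //; first by rewrite mulr_ge0.
- by rewrite ler_wpM2l.
- exact: le_trans h1 h3.
Qed.

(** The left side is twice the length of [-T, T] for T = sqrt (2 L / D), the factor of |Omega'| /
    |Omega| that the splitting of the L^1 norm produces. *)
Lemma constant_powR (D L : R) : 0 < D -> 0 <= L ->
  4 * Num.sqrt (2 * L / D) = 2 `^ (5 / 2) * D `^ (- (1 / 2)) * L `^ (1 / 2).
Proof.
move=> D0 L0.
have -> : 5 / 2 = 2%:R + 2^-1 :> R by field.
rewrite powRD ?pnatr_eq0 ?implybT// powR_mulrn// !mul1r powRN (powR12_sqrt (ltW D0)) (powR12_sqrt L0) powR12_sqrt//.
rewrite sqrtrM ?mulr_ge0// sqrtrM// sqrtrV ?ltW//.
by rewrite -[2 ^+ 2]/(2 * 2) -natrM; ring.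
Qed.

(* S need not be measurable; lebesgue_measure S is its outer measure. *)
Lemma outer_measurable (S : set R) (e : R) : 0 < e -> exists U : set (measurableTypeR R),
  [/\ measurable U, S `<=` U & (lebesgue_measure U <= lebesgue_measure S + e%:E)%E].
Proof.
move=> e0; have [U [oU SU Ue]] := outer_measure_open_le S e0.
by exists U; split => //; exact: open_measurable.
Qed.

(** With a^2 = 3 / l, the best choice in dimension 2, the factor 1 - a^2 l / 6 is 1/2. As l <= 2
    mu', V^2 mu'^m >= (12 mu' / l)^m / 4 >= 6^m / 4 for m = n.+1, and this is at least 9 because m
    >= 2. *)
Lemma faber_krahn_numerics (n : nat) (V l mu' : R) : (1 <= n)%N -> 0 < l -> 0 < mu' ->
  n%:R * (l - mu') <= mu' ->
  (2 * Num.sqrt (3 / l)) ^+ n.+1 * (1 - Num.sqrt (3 / l) ^+ 2 / 6 * l) <= V ->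
  3 <= V * mu' `^ (n.+1%:R / 2).
Proof.
move=> n1 l0 m0 lm.
have l3 : 0 <= 3 / l by rewrite divr_ge0// ltW.
rewrite sqr_sqrtr// (_ : 1 - _ = 2^-1); last by field; rewrite gt_eqF.
move=> FK.
have V0 : 0 <= V by apply: le_trans FK; rewrite mulr_ge0// exprn_ge0 ?mulr_ge0 ?sqrtr_ge0.
have p0 := powR_ge0 mu' (n.+1%:R / 2).
have psq : (mu' `^ (n.+1%:R / 2)) ^+ 2 = mu' ^+ n.+1.
  by rewrite -powR_mulrn// -powRrM divfK ?pnatr_eq0// powR_mulrn ?ltW.
have l2 : l <= 2 * mu'.
  have n1R : 1 <= n%:R :> R by rewrite ler1n.
  by nra.
have V2 : (12 / l) ^+ n.+1 / 4 <= V ^+ 2.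
  have : (2 * Num.sqrt (3 / l)) ^+ n.+1 / 2 <= V by [].
  have h0 : 0 <= (2 * Num.sqrt (3 / l)) ^+ n.+1 / 2.
    by rewrite divr_ge0// exprn_ge0 ?mulr_ge0 ?sqrtr_ge0.
  move=> h; have : ((2 * Num.sqrt (3 / l)) ^+ n.+1 / 2) ^+ 2 <= V ^+ 2.
    by rewrite lerXn2r ?nnegrE.
  rewrite expr_div_n exprAC [(2 * Num.sqrt _) ^+ 2]exprMn sqr_sqrtr//.
  have e4 : 2 ^+ 2 = 4 :> R by rewrite -natrX.
  by rewrite !e4 mulrA -natrM.
have : 3 ^+ 2 <= (V * mu' `^ (n.+1%:R / 2)) ^+ 2.
  rewrite exprMn psq.
  apply: (@le_trans _ _ ((12 / l) ^+ n.+1 / 4 * mu' ^+ n.+1)); last first.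
    by apply: ler_wpM2r => //; rewrite exprn_ge0// ltW.
  rewrite mulrAC -exprMn ler_pdivlMr//.
  apply: (@le_trans _ _ (6 ^+ n.+1)).
    rewrite (_ : 3 ^+ 2 * 4 = 6 ^+ 2); last by rewrite -!natrX -natrM.
    by rewrite ler_weXn2l// ?ltnS//; lra.
  have h6 : 6 <= 12 / l * mu' by rewrite mulrAC ler_pdivlMr//; lra.
  by rewrite lerXn2r ?nnegrE// (le_trans _ h6).
by rewrite ler_sqr ?nnegrE// mulr_ge0.
Qed.

End numerics.

Lemma ln_powR_le (R : realType) (c a b m : R) : 0 < c -> 0 < a -> a <= b -> 0 <= m ->
  ln (c * a `^ m) <= ln (c * b `^ m).
Proof.
move=> c0 a0 ab m0; have b0 := lt_le_trans a0 ab.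
have p1 : 0 < c * a `^ m by apply: mulr_gt0 => //; exact: powR_gt0.
have p2 : 0 < c * b `^ m by apply: mulr_gt0 => //; exact: powR_gt0.
rewrite ler_ln ?posrE//; apply: ler_wpM2l; first exact: ltW.
by apply: ge0_ler_powR; rewrite ?nnegrE// ltW.
Qed.

(** * Horn-shaped sets: volume of strips and the tail *)

Section horn.
Context {R : realType} {n : nat}.
Local Notation leb := (lebesgue_rV n.+1).
Variables (Omega : set 'rV[R]_n.+1) (hornO : horn_shaped Omega).
Hypothesis Ooo : (leb Omega < +oo)%E.
Hypothesis O'oo : (lebesgue_rV n (shadow Omega) < +oo)%E.

Let oO : open Omega.
Proof. by case: hornO. Qed.

Let mO : measurable Omega.
Proof. exact: measurable_rV_open. Qed.

(** Every slice of Omega lies in its shadow; integrate over x1 in W. *)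
Lemma strip_volume (W : set (measurableTypeR R)) : measurable W ->
  (leb (Omega `&` [set x | W (x ord0 ord0)]) <=
   lebesgue_rV n (shadow Omega) * lebesgue_measure W)%E.
Proof.
move=> mW; set A := _ `&` _.
have mA : measurable A.
  apply: (measurableI _ _ mO).
  by rewrite -[X in measurable X]setTI; exact: (measurable_rV_coord ord0 measurableT mW).
have -> : leb A = (\int[leb]_x (\1_A x)%:E)%E by rewrite integral_indic// setIT.
rewrite ge0_integral_rV_cons; last 2 first.
- by apply/measurable_EFinP; exact: measurable_indic.
- by move=> x; rewrite lee_fin.
have mS := measurable_shadow oO.
have -> : (lebesgue_rV n (shadow Omega) * lebesgue_measure W =
    \int[@lebesgue_measure R]_t (lebesgue_rV n (shadow Omega) * (\1_W t)%:E))%E.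
  rewrite ge0_integralZl//.
  - by rewrite integral_indic// setIT.
  - by apply/measurable_EFinP; exact: measurable_indic.
apply: ge0_le_integral => //.
- by move=> t _; apply: integral_ge0 => y _; rewrite lee_fin.
- apply: (@measurable_integral_rV_cons _ n (fun x => (\1_A x)%:E)).
    by apply/measurable_EFinP; exact: measurable_indic.
  by move=> x; rewrite lee_fin.
- apply: emeasurable_funM; first exact: measurable_cst.
  by apply/measurable_EFinP; exact: measurable_indic.
move=> t _.
have -> : (lebesgue_rV n (shadow Omega) * (\1_W t)%:E =
    \int[lebesgue_rV n]_y ((\1_W t)%:E * (\1_(shadow Omega) y)%:E))%E.
  rewrite ge0_integralZl//.
  - by rewrite integral_indic// setIT muleC.
  - by apply/measurable_EFinP; exact: measurable_indic.
apply: ge0_le_integral => //.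
- apply/measurable_EFinP.
  have mi : measurable_fun setT (\1_A : 'rV[R]_n.+1 -> R) by exact: measurable_indic.
  by apply: (measurableT_comp mi); exact: measurable_rV_cons.
- apply: emeasurable_funM; first exact: measurable_cst.
  by apply/measurable_EFinP; exact: measurable_indic.
move=> y _; rewrite -EFinM lee_fin [X in X <= _]indicE.
have [|_] := boolP (_ \in A); last by rewrite mulr_ge0.
rewrite inE => -[Oty]; rewrite /= rV_cons0 => Wt.
by rewrite !indicE !mem_set ?mulr1//; exists t.
Qed.

(** [strip_volume] over the whole line, with the convention 0 * oo = 0. *)
Lemma shadow_gt0 : 0 < vol Omega -> 0 < vol (shadow Omega).
Proof.
move=> V0; rewrite lt_def vol_ge0 andbT; apply/eqP => V'0.
have := strip_volume (@measurableT _ (measurableTypeR R)).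
rewrite (_ : _ `&` _ = Omega); last by apply/seteqP; split => [x []//|x Ox]; split.
rewrite (lebesgue_vol O'oo) V'0 mul0e (lebesgue_vol Ooo) lee_fin.
by rewrite leNgt V0.
Qed.

Lemma horn_slice (s t y : R) : s ^+ 2 = 1 -> 0 < y -> y < s * t ->
  slice Omega t `<=` slice Omega (s * y).
Proof.
move=> /eqP; rewrite sqrf_eq1 => s1 y0; have [_ _ h1 h2] := hornO.
case/orP: s1 => /eqP ->; rewrite ?mul1r ?mulN1r => yt; first exact: h1.
by apply: h2; rewrite ?oppr_lt0// ltrNr.
Qed.

Let mu' := first_eigenvalue (shadow Omega).

Lemma rayleigh_shadow t (f : 'rV[R]_n -> R) : test_fun (slice Omega t) f ->
  mu' * sqn f <= dir f f.
Proof.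
move=> tf; apply: (first_eigenvalue_le (measurable_shadow oO) O'oo).
by apply: test_fun_sub tf; exact: slice_sub_shadow.
Qed.

Lemma test_fun_set0 (f : 'rV[R]_n -> R) : test_fun set0 f -> sqn f = 0.
Proof.
move=> tf; rewrite /sqn -(@ip_setT _ _ set0); first by rewrite /ip Rintegral_set0.
by move=> x x0; rewrite (test_fun_out tf x0) mul0r.
Qed.

Variables (V m eps D : R).
Hypotheses (V0 : 0 < V) (m0 : 0 <= m) (eps0 : 0 < eps) (D0 : 0 < D) (mu'0 : 0 < mu').
Let L := ln (eps^-1 * V * mu' `^ m).
Let S : set R := [set x1 : R | slice Omega (x1 / 2) !=set0 /\
  (first_eigenvalue (slice Omega (x1 / 2)) - mu') / (2 * D)
  <= ln (eps^-1 * V * first_eigenvalue (slice Omega (x1 / 2)) `^ m)].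

(* As Omega is horn-shaped, the slice at t is contained in the slice at s * y / 2,
   whose first eigenvalue is large because s * y is not in S. *)
Lemma rayleigh_slice (s t y : R) (f : 'rV[R]_n -> R) : s ^+ 2 = 1 -> 0 < y ->
  ~ S (s * y) -> y / 2 < s * t -> test_fun (slice Omega t) f ->
  (mu' + 2 * D * L) * sqn f <= dir f f.
Proof.
move=> s1 y0 nS yt tf.
have y20 : 0 < y / 2 by rewrite divr_gt0.
have tf2 : test_fun (slice Omega (s * y / 2)) f.
  by apply: test_fun_sub tf; rewrite -mulrA; exact: horn_slice.
have [f0|f0] := eqVneq (sqn f) 0; first by rewrite f0 mulr0 dir_ge0.
have fp : 0 < sqn f by rewrite lt_def f0 sqn_ge0.
have ms := measurable_slice oO (s * y / 2).
have soo := lebesgue_slice oO O'oo (s * y / 2).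
set M := first_eigenvalue (slice Omega (s * y / 2)).
have muM : mu' <= M.
  by apply: (first_eigenvalue_ge ms soo tf2 fp) => g; exact: rayleigh_shadow.
(* S only contains points with a nonempty slice, so this is needed to read ~ S as failure of the
   inequality. An empty slice would force f to vanish. *)
have ne : slice Omega (s * y / 2) !=set0.
  have [E|/set0P//] := eqVneq (slice Omega (s * y / 2)) set0.
  by move: tf2 f0; rewrite E => /test_fun_set0 ->; rewrite eqxx.
have : ~ (M - mu') / (2 * D) <= ln (eps^-1 * V * M `^ m) by move=> h; apply: nS; split.
move=> /negP; rewrite -ltNge => hM.
have LM : L <= ln (eps^-1 * V * M `^ m).
  have c0 : 0 < eps^-1 * V by rewrite mulr_gt0 ?invr_gt0.
  exact: (ln_powR_le c0 mu'0 muM m0).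
have := le_lt_trans LM hM; rewrite ltr_pdivlMr ?mulr_gt0// => h.
apply: le_trans (first_eigenvalue_le ms soo tf2); rewrite -/M.
by rewrite ler_wpM2r ?(ltW fp)//; lra.
Qed.

Variables (l T kappa : R) (u : 'rV[R]_n.+1 -> R).
Variable Phi : ('rV[R]_n.+1 -> R)^nat.
Hypotheses (mul : mu' <= l) (T0 : 0 < T) (kappa0 : 0 <= kappa).
Hypothesis kappaE : l + kappa ^+ 2 <= mu' + 2 * D * L.
Hypotheses (ea : eigen_approx Omega l u Phi) (su : sqint leb Omega u).

(** h is the indicator of s t >= inf B, or 0 if B is empty. The infimum need not be attained: for s
    t > a = inf B / 2 there is still some y in B with y / 2 < s t, as [rayleigh_slice] requires.
    Finally 2 a >= T turns exp (- 2 kappa a) into exp (- kappa T). *)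
Lemma tail_weight (s : R) : s ^+ 2 = 1 -> exists h : R -> R,
  [/\ bounded_weight h, forall t, 0 <= h t,
      forall t, T < s * t -> ~ S t -> 1 <= h t &
      3 / 8 * kappa ^+ 2 * ip leb Omega (fun x => h (x ord0 ord0) * u x) u <=
      (l - mu' + kappa ^+ 2) * expR (- (kappa * T)) * ip leb Omega u u].
Proof.
move=> s1; pose B := [set y | T < y /\ ~ S (s * y)].
have iu0 := ip_ge0 leb Omega u.
have c0 : 0 <= l - mu' + kappa ^+ 2 by rewrite addr_ge0 ?sqr_ge0 ?subr_ge0.
have ssK t : s * (s * t) = t by rewrite mulrA -expr2 s1 mul1r.
have [B0|/set0P B0] := eqVneq B set0.
  exists (cst 0); split => //; first exact: bounded_weight_cst.
    move=> t Tt nSt; exfalso.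
    suff : set0 (s * t) by [].
    by rewrite -B0; split; [exact: Tt|rewrite ssK; exact: nSt].
  rewrite (_ : ip _ _ _ _ = 0).
    by rewrite mulr0 mulr_ge0// mulr_ge0 ?expR_ge0.
  rewrite /ip; under eq_Rintegral do rewrite mul0r mul0r.
  by rewrite Rintegral_cst// mul0r.
have lbB : lbound B T by move=> y [/ltW].
pose a := inf B / 2.
have Ta : T <= inf B by apply: lb_le_inf.
have a0 : 0 < a by rewrite divr_gt0// (lt_le_trans T0).
have a2 : 2 * a = inf B by rewrite /a mulrC divfK.
exists (half_line s a); split.
- exact: bounded_half_line.
- by move=> t; rewrite /half_line.
- move=> t Tt nSt; rewrite /half_line indicE mem_set//=.
  by rewrite a2; apply: ge_inf; [exists T|split; [exact: Tt|rewrite ssK; exact: nSt]].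
apply: (le_trans (eigenfunction_decay oO Ooo O'oo s1 kappa0 (ltW mu'0) mul a0
  rayleigh_shadow _ ea su)).
  move=> t ast f tf.
  have : inf B < 2 * (s * t) by rewrite -a2 ltr_pM2l.
  move=> /(inf_lt B0)[y [Ty nSy] yt].
  apply: (@le_trans _ _ ((mu' + 2 * D * L) * sqn f)); first by rewrite ler_wpM2r ?sqn_ge0.
  apply: (rayleigh_slice s1 (lt_trans T0 Ty) nSy _ tf).
  by rewrite ltr_pdivrMr// mulrC.
apply: ler_wpM2r => //; apply: ler_wpM2l => //.
rewrite ler_expR lerN2 [2 * _]mulrC -mulrA a2.
exact: ler_wpM2l.
Qed.

End horn.

(** * Splitting the L^1 norm *)

Section splitting.
Context {R : realType} {n : nat}.
Local Notation leb := (lebesgue_rV n.+1).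
Variables (Omega : set 'rV[R]_n.+1) (hornO : horn_shaped Omega).
Hypothesis Ooo : (leb Omega < +oo)%E.
Hypothesis O'oo : (lebesgue_rV n (shadow Omega) < +oo)%E.
Variable u : 'rV[R]_n.+1 -> R.
Hypothesis (su : sqint leb Omega u).
Hypothesis (u1 : ip leb Omega u u = 1).

Let mO : measurable Omega.
Proof. by have [oO _ _ _] := hornO; exact: measurable_rV_open. Qed.

Let sau : sqint leb Omega (fun x => `|u x|).
Proof.
have [mu _] := su; apply: (sqint_le mO _ _ su); first exact: measurableT_comp.
by move=> x _; rewrite real_normK ?num_real.
Qed.

Let ipau : ip leb Omega (fun x => `|u x|) (fun x => `|u x|) = 1.
Proof.
rewrite -u1 /ip; apply: eq_Rintegral => x _.
by rewrite -!expr2 real_normK ?num_real.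
Qed.

Let s1 : sqint leb Omega (fun=> 1).
Proof. by apply: (sqint_bounded (M := 1) mO Ooo) => // x _; rewrite normr1. Qed.

Let ip11 : ip leb Omega (fun=> 1) (fun=> 1) = vol Omega.
Proof. by rewrite /ip Rintegral_cst// !mul1r. Qed.

Lemma L1_sqr_le_vol : ip leb Omega (fun x => `|u x|) (fun=> 1) ^+ 2 <= vol Omega.
Proof. by have := cauchy_schwarz mO sau s1; rewrite ipau ip11 mul1r. Qed.

Lemma integral_abs : (\int[leb]_(x in Omega) `|u x|%:E =
  (ip leb Omega (fun x => `|u x|) (fun=> 1))%:E)%E.
Proof.
rewrite /ip /Rintegral fineK; last first.
  by apply: integrable_fin_num => //; exact: (sqint_integrable mO sau s1).
by apply: eq_integral => x _; rewrite mulr1.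
Qed.

(** Cauchy-Schwarz on each piece: inside the strip against its indicator, with the L^2 norm of u
    equal to 1; outside against the constant 1, where h >= 1 dominates. *)
Lemma L1_split (U : set (measurableTypeR R)) (h : R -> R) (sigma T eps : R) :
  measurable U -> (lebesgue_measure U <= sigma%:E)%E -> 0 <= T ->
  bounded_weight h -> (forall t, 0 <= h t) ->
  (forall t, ~ U t -> T < `|t| -> 1 <= h t) ->
  ip leb Omega (fun x => h (x ord0 ord0) * u x) u <= eps ->
  ip leb Omega (fun x => `|u x|) (fun=> 1) ^+ 2 <=
  2 * (vol (shadow Omega) * (sigma + 2 * T)) + 2 * (eps * vol Omega).
Proof.
move=> mU Us T0 [mh [M hM]] h0 hU heps.
pose I : set (measurableTypeR R) := `[(- T), T]%classic.
have mI : measurable I by exact: measurable_itv.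
have muI : @lebesgue_measure R I = (2 * T)%:E.
  rewrite /I lebesgue_measure_itv/= lte_fin; case: ifPn => [_|].
    by rewrite -EFinB; congr EFin; ring.
  by rewrite -leNgt => TT; congr EFin; lra.
pose W := U `|` I; have mW : measurable W by exact: measurableU.
pose w (x : 'rV[R]_n.+1) : R := \1_W (x ord0 ord0).
have mw : measurable_fun setT w.
  apply: (@measurable_fun_coord0 _ n (\1_W)).
  exact: measurable_indic.
have w01 x : 0 <= w x <= 1 by rewrite /w indicE; case: (_ \in _); rewrite /= ?ler01 ?lexx.
have sw : sqint leb Omega w.
  apply: (sqint_bounded (M := 1) mO Ooo); first exact: measurable_funTS.
  by move=> x _; have /andP[w0 w1] := w01 x; rewrite ger0_norm.
have sw' := sqintB mO s1 sw.
have E : ip leb Omega (fun x => `|u x|) (fun=> 1) =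
    ip leb Omega (fun x => `|u x|) w + ip leb Omega (fun x => `|u x|) (fun x => 1 - w x).
  rewrite -(ipDr mO sw sw' sau); apply: eq_ip => // x _.
  by rewrite addrC subrK.
have ww : ip leb Omega w w <= vol (shadow Omega) * (sigma + 2 * T).
  rewrite -lee_fin -ip_sqrE//.
  have -> : (\int[leb]_(x in Omega) (w x ^+ 2)%:E =
      leb (Omega `&` [set x | W (x ord0 ord0)]))%E.
    rewrite setIC -integral_indic//; last first.
      by rewrite -[X in measurable X]setTI; exact: (measurable_rV_coord ord0 measurableT mW).
    apply: eq_integral => x _; congr EFin; rewrite /w !indicE.
    have -> : (x \in [set x0 : 'rV[R]_n.+1 | W (x0 ord0 ord0)]) = (x ord0 ord0 \in W).
      by apply/idP/idP; rewrite !inE.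
    by case: (_ \in _); rewrite ?expr1n ?expr0n.
  apply: (le_trans (strip_volume hornO mW)).
  rewrite (lebesgue_vol O'oo) EFinM lee_wpmul2l ?lee_fin ?vol_ge0//.
  apply: (le_trans (measureU2 _ _ _)) => //.
  rewrite EFinD leeD// -muI; exact: lexx.
have ab2 (p q : R) : (p + q) ^+ 2 <= 2 * p ^+ 2 + 2 * q ^+ 2.
  by rewrite -subr_ge0 (_ : _ - _ = (p - q) ^+ 2) ?sqr_ge0//; ring.
rewrite E; apply: (le_trans (ab2 _ _)); apply: lerD; apply: ler_wpM2l => //.
  by apply: (le_trans (cauchy_schwarz mO sau sw)); rewrite ipau mul1r.
have shu : sqint leb Omega (fun x => h (x ord0 ord0) * u x).
  apply: (sqint_mul_bounded mO (M := M)) => //.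
  by apply: measurable_funTS; exact: measurable_fun_coord0.
have sbu : sqint leb Omega (fun x => (1 - w x) * `|u x|).
  apply: (sqint_mul_bounded mO (M := 1) _ _ sau); first by case: sw'.
  move=> x _; have /andP[w0 w1] := w01 x; rewrite ger0_norm ?subr_ge0//.
  by rewrite lerBlDr lerDl.
have -> : ip leb Omega (fun x => `|u x|) (fun x => 1 - w x) =
    ip leb Omega (fun x => (1 - w x) * `|u x|) (fun=> 1).
  by rewrite /ip; apply: eq_Rintegral => x _; rewrite mulr1 mulrC.
apply: (le_trans (cauchy_schwarz mO sbu s1)); rewrite ip11.
apply: ler_wpM2r; first exact: vol_ge0.
apply: le_trans heps; apply: (ip_le mO sbu sbu shu su) => x _.
rewrite -expr2 exprMn real_normK ?num_real// -mulrA -expr2 ler_wpM2r ?sqr_ge0//.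
have [Wx|Wx] := pselect (W (x ord0 ord0)).
  by rewrite /w indicE mem_set//= subrr expr0n.
rewrite /w indicE memNset//= subr0 expr1n.
apply: hU => [Ux|]; first by apply: Wx; left.
rewrite ltNge; apply/negP => xT; apply: Wx; right.
by rewrite /I/= in_itv/= -ler_norml.
Qed.

End splitting.
(* m = n + 1 *)
Theorem theorem6 (R : realType) (n : nat) (n_ge1 : (1 <= n)%N)
    (Omega : set 'rV[R]_n.+1) (u : 'rV[R]_n.+1 -> R) (lambda eps : R) :
  Omega !=set0 ->
  horn_shaped Omega ->
  (lebesgue_rV n.+1 Omega < +oo)%E ->
  (lebesgue_rV n (shadow Omega) < +oo)%E ->
  first_eigenfunction Omega u ->
  let m : R := n.+1%:R in
  let mu (D : set 'rV[R]_n) : R := first_eigenvalue D in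
  let mu' : R := mu (shadow Omega) in
  let V : R := vol Omega in
  let V' : R := vol (shadow Omega) in
  first_eigenvalue Omega <= lambda ->
  mu' >= (m - 1) * (lambda - mu') ->
  0 < eps -> eps <= V * mu' `^ (m / 2) ->
  let S : set R :=
    [set x1 : R | slice Omega (x1 / 2) !=set0 /\
       (mu (slice Omega (x1 / 2)) - mu') / (2 * (lambda - mu'))
       <= ln (eps^-1 * V * mu (slice Omega (x1 / 2)) `^ (m / 2))] in
  ((V^-1)%:E * (\int[lebesgue_rV n.+1]_(x in Omega) `|u x|%:E) ^+ 2
   <= (2 * eps)%:E
      + (2 * V' / V)%:E * lebesgue_measure S
      + (2 `^ (5 / 2) * V' / V * (lambda - mu') `^ (- (1 / 2))
         * (ln (eps^-1 * V * mu' `^ (m / 2))) `^ (1 / 2))%:E)%E.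
Proof.
move=> ne hornO Ooo O'oo [eu _ u2] m mu mu' V V' llam mulam eps0 epsle; cbv zeta.
set S := (X in lebesgue_measure X).
have [oO _ _ _] := hornO.
have mO : measurable Omega := measurable_rV_open oO.
have mO' := measurable_shadow oO.
have mu'_ge0 : 0 <= mu' := first_eigenvalue_ge0 mO' O'oo.
have V_ge0 : 0 <= V := vol_ge0 _.
have m2 : 0 < m / 2 by rewrite divr_gt0// ltr0n.
have V0 : 0 < V.
  rewrite lt_def V_ge0 andbT; apply/eqP => V0.
  by move: epsle; rewrite V0 mul0r leNgt eps0.
have mu'0 : 0 < mu'.
  rewrite lt_def mu'_ge0 andbT; apply/eqP => mu'0.
  by move: epsle; rewrite mu'0 powR0 ?gt_eqF// mulr0 leNgt eps0.
have V'0 : 0 < V' := shadow_gt0 hornO Ooo O'oo V0.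
have su : sqint (lebesgue_rV n.+1) Omega u.
  by have [[_ [g [Lu _ _ _] _]] _] := eu.
have u1 : ip (lebesgue_rV n.+1) Omega u u = 1.
  by have := ip_sqrE mO su; rewrite u2 => -[].
have [Phi ea] := eigenfunction_approx mO Ooo eu.1.
set l := first_eigenvalue Omega in eu llam ea *.
have mul : mu' < l.
  apply: (eigenvalue_gt_shadow oO Ooo O'oo mu'_ge0 _ ea su eu.2) => t f.
  exact: rayleigh_shadow.
have l0 : 0 < l by exact: lt_trans mul.
have D0 : 0 < lambda - mu' by rewrite subr_gt0; exact: lt_le_trans llam.
set D := lambda - mu' in mulam D0 *.
set q := V * mu' `^ (m / 2) in epsle.
have LE : ln (eps^-1 * V * mu' `^ (m / 2)) = ln (q / eps).
  by rewrite -mulrA mulrC.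
rewrite (integral_abs hornO Ooo su) -[X in (_ * X <= _)%E]EFin_expe -EFinM.
set I := ip _ _ _ _.
have third0 : 0 <= 2 `^ (5 / 2) * V' / V * D `^ (- (1 / 2)) *
    ln (eps^-1 * V * mu' `^ (m / 2)) `^ (1 / 2).
  by rewrite !mulr_ge0 ?powR_ge0 ?invr_ge0// ltW.
have c0 : 0 < 2 * V' / V by rewrite divr_gt0// mulr_gt0.
have second0 : (0 <= (2 * V' / V)%:E * lebesgue_measure S)%E.
  by apply: mule_ge0; [rewrite lee_fin ltW|exact: measure_ge0].
(* For eps >= 1/2 the first term is at least 1 and suffices; otherwise eps <= 1/2 is what
   [tail_numerics] requires. *)
have [eps12|eps12] := leP 2^-1 eps.
  rewrite -[leLHS]adde0 leeD ?lee_fin// -[leLHS]adde0 leeD ?lee_fin//.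
  apply: (@le_trans _ _ 1); last by lra.
  by rewrite ler_pdivrMl// mulr1 L1_sqr_le_vol.
(* the side of the cube is 2 a with a^2 = 3 / l *)
have q3 : 3 <= q.
  have a0 : 0 < Num.sqrt (3 / l) by rewrite sqrtr_gt0 divr_gt0.
  apply: (faber_krahn_numerics n_ge1 l0 mu'0 _ (faber_krahn mO Ooo eu a0)).
  apply: le_trans mulam; rewrite /m -natr1 addrK.
  by rewrite ler_wpM2l// lerB.
have [L32 tail] := tail_numerics q3 eps0 (ltW eps12).
set L := ln (q / eps) in L32 tail.
(* mu' + 2 D L = lambda + D (2 L - 1), so this is the largest kappa that lambda >= l guarantees. The
   next line takes the T for which 4 T V' / V is the third term. *)
pose kappa := Num.sqrt (D * (2 * L - 1)).
pose T := Num.sqrt (2 * L / D).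
have k2 : kappa ^+ 2 = D * (2 * L - 1) by rewrite sqr_sqrtr// mulr_ge0 ?ltW//; lra.
have T0 : 0 < T by rewrite sqrtr_gt0 divr_gt0//; lra.
have kT : kappa * T = Num.sqrt (2 * L * (2 * L - 1)).
  rewrite -sqrtrM; last by rewrite mulr_ge0 ?ltW//; lra.
  by congr Num.sqrt; field; rewrite gt_eqF.
have kE : l + kappa ^+ 2 <= mu' + 2 * D * ln (eps^-1 * V * mu' `^ (m / 2)).
  by rewrite LE -/L k2 /D; lra.
have tw s (s1 : s ^+ 2 = 1) := tail_weight hornO Ooo O'oo V0 (ltW m2) eps0 D0 mu'0
  (ltW mul) T0 (sqrtr_ge0 _) kE ea su s1.
(* l - mu' <= D gives l - mu' + kappa^2 <= 2 L D, so D cancels against kappa^2 and only L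
   remains. *)
have tail_le A : 3 / 8 * kappa ^+ 2 * A <= (l - mu' + kappa ^+ 2) * expR (- (kappa * T)) * 1 ->
    A <= 8 / 3 * (2 * L / (2 * L - 1)) * expR (- Num.sqrt (2 * L * (2 * L - 1))).
  rewrite mulr1 -kT k2 => h.
  have L1 : 0 < 2 * L - 1 by lra.
  have DL : 0 < D * (2 * L - 1) by rewrite mulr_gt0.
  rewrite -(ler_pM2l (mulr_gt0 (_ : 0 < 3 / 8) DL))//; apply: (le_trans h).
  rewrite [leRHS](_ : _ = 2 * L * D * expR (- (kappa * T))); last first.
    by field; rewrite gt_eqF.
  rewrite ler_wpM2r ?expR_ge0//.
  rewrite (_ : 2 * L * D = D + D * (2 * L - 1)); last by ring.
  by rewrite lerD2r /D lerB.
have [hp [bp p0 hpS Ep]] := tw 1 (expr1n _ _).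
have [hm [bm m0 hmS Em]] := tw (-1) (etrans (sqrrN _) (expr1n _ _)).
rewrite u1 in Ep Em.
pose h t := hp t + hm t.
have heps : ip (lebesgue_rV n.+1) Omega (fun x => h (x ord0 ord0) * u x) u <= eps.
  apply: le_trans tail.
  have sp w : bounded_weight w -> sqint (lebesgue_rV n.+1) Omega (fun x => w (x ord0 ord0) * u x).
    move=> [mw [M wM]]; apply: (sqint_mul_bounded mO (M := M)) => //.
    by apply: measurable_funTS; exact: measurable_fun_coord0.
  have -> : ip (lebesgue_rV n.+1) Omega (fun x => h (x ord0 ord0) * u x) u =
      ip (lebesgue_rV n.+1) Omega (fun x => hp (x ord0 ord0) * u x) u +
      ip (lebesgue_rV n.+1) Omega (fun x => hm (x ord0 ord0) * u x) u.
    rewrite -(ipDl mO (sp _ bp) (sp _ bm) su); apply: eq_ip => // x _.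
    by rewrite mulrDl.
  have := lerD (tail_le _ Ep) (tail_le _ Em).
  by move: (expR _) (_ / (_ - _)) (ip _ _ _ _) (ip _ _ _ _) => e1 e3 e4 e5; lra.
have S0 : (0 <= lebesgue_measure S)%E by exact: measure_ge0.
(* If S has infinite measure the right side is +oo, because the coefficient 2 V' / V is positive. *)
case sE : (lebesgue_measure S) S0 => [sigma| |//] _; last first.
  by rewrite gt0_muley ?lte_fin// addey// addye// leey.
rewrite -EFinM -!EFinD lee_fin.
apply/ler_addgt0Pr => e e0.
(* S is enlarged to a measurable set U; the excess of measure times the coefficient 2 V' / V is
   e. *)
have e'0 : 0 < e / (2 * V' / V) by rewrite divr_gt0.
have [U [mU SU Us]] := outer_measurable S e'0.
rewrite sE -EFinD in Us.
have hU t : ~ U t -> T < `|t| -> 1 <= h t.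
  move=> nUt Tt; have nSt : ~ S t by move=> /SU.
  (* The sign of t decides which end of the horn, hence which of hp and hm, is at least 1; the other
     one is nonnegative. *)
  have [t0|t0] := leP 0 t.
    have : 1 <= hp t by apply: hpS => //; rewrite mul1r -(ger0_norm t0).
    by move=> ?; rewrite /h ler_wpDr.
  have : 1 <= hm t by apply: hmS => //; rewrite mulN1r -ltr0_norm.
  by move=> ?; rewrite /h ler_wpDl.
have h0 t : 0 <= h t by rewrite addr_ge0.
have := L1_split hornO Ooo O'oo su u1 mU Us (ltW T0) (bounded_weightD bp bm) h0 hU heps.
rewrite -/I -/V -/V' => I_le; rewrite ler_pdivrMl// LE -/L.
apply: (le_trans I_le).
have -> : 2 `^ (5 / 2) * V' / V * D `^ (- (1 / 2)) * L `^ (1 / 2) = 4 * T * V' / V.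
  by rewrite /T constant_powR//; [ring|lra].
rewrite le_eqVlt; apply/orP; left; apply/eqP; field.
by rewrite !gt_eqF.
Qed.
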